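(* Let $\rho>0$, $w\sim\mathcal{N}(0,\rho^2)$, $m_t:=\mathbb{E}\,w^t$, and for $T\in\mathbb{N}^*$ let $B_T:=(m_{i+j})_{0\le i,j\le T}$ with eigenvalues $\lambda_T(B_T)\le\cdots\le\lambda_0(B_T)$, $\lambda_{\max}(B_T)=\lambda_0(B_T)$, $\lambda_{\min}(B_T)=\lambda_T(B_T)$. Then \[ \frac{\lambda_{\max}(B_T)}{\sum_{i=0}^T\lambda_i(B_T)}\xrightarrow[T\to\infty]{}1, \] and, as $T\to\infty$, \[ \lambda_{\max}(B_T)\simeq\sqrt2\left(\frac{2\rho^2T}{e}\right)^T,\qquad \lambda_{\min}(B_T)\simeq\frac{2^{5/2}\pi T^{1/4}}{\rho^{3/2}}\exp\left(\frac{1}{2\rho^2}-\frac{2\sqrt T}{\rho}\right). \]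
   Context: For positive sequences, $x_T\simeq y_T$ as $T\to\infty$ means $x_T/y_T\to1$. *)

(* Defs.v *)
From HB Require Import structures.
From mathcomp Require Import all_boot all_order all_algebra.
From mathcomp Require Import all_classical all_reals all_analysis.
Set Implicit Arguments. Unset Strict Implicit. Unset Printing Implicit Defensive.
Import Order.TTheory GRing.Theory Num.Theory.
Local Open Scope classical_set_scope.
Local Open Scope ring_scope.

Definition gauss_moment {R : realType} (rho : R) (t : nat) : R :=
  fine (\int[normal_prob 0 rho]_x (x ^+ t)%:E)%E.

Definition hankelB {R : realType} (rho : R) (T : nat) : 'M[R]_T.+1 :=
  \matrix_(i < T.+1, j < T.+1) gauss_moment rho (i + j).

(* Eigenvalues with multiplicity, listed in nonincreasing order:
   lambda_0 >= lambda_1 >= ... >= lambda_(n-1), i.e. the (unique) sorted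
   sequence whose linear factors give the characteristic polynomial.
   (For real symmetric matrices such a sequence exists.) *)
Definition spectrum {R : realType} (n : nat) (A : 'M[R]_n) : seq R :=
  xget [::] [set s : seq R | sorted (>=%R) s /\
                             char_poly A = \prod_(a <- s) ('X - a%:P)].

Definition eigval {R : realType} (n : nat) (A : 'M[R]_n) (i : nat) : R :=
  nth 0 (spectrum A) i.

Definition lambda_max {R : realType} (T : nat) (A : 'M[R]_T.+1) : R := eigval A 0.
Definition lambda_min {R : realType} (T : nat) (A : 'M[R]_T.+1) : R := eigval A T.

(* Main.v *)
Require Import Defs.
From HB Require Import structures.
From mathcomp Require Import all_boot all_order all_algebra.
From mathcomp Require Import all_classical all_reals all_analysis.
From mathcomp Require Import complex ring lra zify measurable_realfun.
Import Order.TTheory GRing.Theory Num.Def Num.Theory.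
Import numFieldNormedType.Exports.
Local Open Scope classical_set_scope.
Local Open Scope ring_scope.

Set Implicit Arguments.
Unset Strict Implicit.
Unset Printing Implicit Defensive.

(** Let [C] be the coefficient matrix of the orthonormal polynomials of
    [N(0, rho^2)], the normalized Hermite polynomials. Then [C B_T C^T = 1], so
    [B_T^-1 = C^T C], which splits into two parity blocks. Each block is nearly
    of rank one: for [j] close to [sqrt T / rho], the coefficients of [x^j] in
    consecutive polynomials of one parity near degree [T] have a ratio
    [1 - (1 + o(1)) / (rho sqrt T)]. Hence [1 / lambda_min] is at most the
    trace of a block, and a trial vector with geometric weights shows that this
    is sharp. Summing over the degrees is a geometric sum. Summing over [j]
    yields the weights [y^(2j) / (2j)!], [y = 2 sqrt T / rho], times a ratio of
    falling factorials and two central binomial coefficients. These weights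
    concentrate at [j ~ sqrt T / rho], and [cosh y +- cos y] gives their total
    over each parity of [j]. Wallis' formula, obtained from the log-convexity of
    the half moments of the Gaussian, evaluates the binomial coefficients.

    As for [lambda_max], it lies between [m_(2T)] and the trace of [B_T], which
    is equivalent to its last term [m_(2T) = rho^(2T) (2T)! / (2^T T!)], and
    Stirling's formula applies. *)


(** * Spectra of real symmetric matrices *)

(** The parity split is what makes a trace bound sharp: the two blocks have equivalent traces, so
    the trace of all of [B_T^-1] would lose a factor 2. Within a block, let [r = 1 - d],
    [d ~ 1 / (rho sqrt T)], be the ratio of consecutive coefficients near the peak. Summing squares
    over the degrees gives [1 / (1 - r^2) ~ 1 / (2 d)]. Weights [q^u] in the trial vector give
    [(1 - q^2) / (1 - r q)^2], which is largest at [q = r], where it equals [1 / (1 - r^2)]. Since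
    the relevant [j] all lie close to [sqrt T / rho], one [q] serves them all. Elsewhere the weights
    only need polynomial bounds, because the mass away from the peak is smaller by a factor
    exponential in [sqrt T]. *)

Lemma char_poly_conj (F : fieldType) (n : nat) (P D : 'M[F]_n) :
  P \in unitmx -> char_poly (invmx P *m D *m P) = char_poly D.
Proof.
move=> Pu; rewrite /char_poly /char_poly_mx.
have e : map_mx polyC (invmx P) *m map_mx polyC P = 1%:M.
  by rewrite -map_mxM mulVmx// map_mx1.
have -> : 'X%:M - map_mx polyC (invmx P *m D *m P) =
  map_mx polyC (invmx P) *m ('X%:M - map_mx polyC D) *m map_mx polyC P.
  rewrite mulmxBr mulmxBl !map_mxM; congr (_ - _).
  by rewrite mul_mx_scalar -scalemxAl e scalemx1.
by rewrite !det_mulmx mulrAC -det_mulmx e det1 mul1r.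
Qed.

Definition qform {R : realType} (n : nat) (A : 'M[R]_n) (v : 'rV[R]_n) : R :=
  (v *m A *m v^T) 0 0.

Section SymmetricSpectrum.
Variables (R : realType) (n : nat) (A : 'M[R]_n).
Hypothesis symA : A^T = A.

(** Obtained from the spectral theorem for normal complex matrices, whose unitary basis may be
    complex even though the eigenvalues are real. Only the squared moduli [N v i] of the coordinates
    of [v] are kept: they are real, and they are all that Rayleigh quotients require. *)
Lemma symmetric_diagonalization :
  exists (d : 'I_n -> R) (N : 'rV[R]_n -> 'I_n -> R),
  [/\ char_poly A = \prod_(i < n) ('X - (d i)%:P),
      forall v i, 0 <= N v i,
      forall v, qform A v = \sum_i d i * N v i
    & forall v, qform 1%:M v = \sum_i N v i].
Proof.
pose cplx := real_complex R.
pose Ac := map_mx cplx A.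
have Acsym : Ac \is symmetricmx.
  by apply/is_hermitianmxP; rewrite expr0 scale1r map_mx_id// /Ac map_trmx symA.
have Acreal : Ac \is a (mxOver Num.real).
  by apply/mxOverP => i j; rewrite mxE complex_real.
have Ach := realsym_hermsym Acsym Acreal.
have /orthomx_spectralP EA := hermitian_normalmx Ach.
have Dreal := hermitian_spectral_diag_real Ach.
have Puni := spectral_unitarymx Ac.
set P := spectralmx Ac in EA Puni; set D := spectral_diag Ac in EA Dreal.
have Punit := unitarymx_unit Puni.
pose d i := complex.Re (D 0 i).
have dE i : (d i)%:C%C = D 0 i by apply/RRe_real/mxOverP.
pose Y (v : 'rV[R]_n) := map_mx cplx v *m invmx P.
pose N v i := complex.Re (Y v 0 i) ^+ 2 + complex.Im (Y v 0 i) ^+ 2.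
have key (B : 'rV[R[i]]_n) v : (Y v *m diag_mx B *m map_mx conjC (Y v)^T) 0 0
   = \sum_i B 0 i * (cplx (N v i)).
  rewrite /N; move: (Y v) => y; rewrite mxE; apply: eq_bigr => i _.
  rewrite mul_mx_diag !mxE /cplx add_Re2_Im2 normCK.
  by rewrite [_ * B 0 i]mulrC -mulrA.
have realv (v : 'rV[R]_n) : map_mx conjC (map_mx cplx v)^T = map_mx cplx v^T.
  by apply/matrixP => i j; rewrite !mxE conj_Creal // complex_real.
have Yt v : map_mx conjC (Y v)^T = P *m map_mx cplx v^T.
  by rewrite /Y trmx_mul map_mxM realv invmx_unitary//= trmxCK.
exists d, N; split.
- apply: (map_poly_inj cplx).
  rewrite map_char_poly rmorph_prod.
  rewrite -/Ac EA char_poly_conj// char_poly_trig ?diag_mx_is_trig//.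
  apply: eq_bigr => i _; rewrite mxE eqxx mulr1n rmorphB /= map_polyX map_polyC.
  by congr (_ - _%:P); rewrite -dE.
- by move=> v i; rewrite addr_ge0 ?sqr_ge0.
- move=> v; apply: (@complexI R); rewrite rmorph_sum /=.
  under eq_bigr do rewrite rmorphM /= dE.
  rewrite -key Yt /Y.
  have -> : map_mx cplx v *m invmx P *m diag_mx D *m (P *m map_mx cplx v^T) =
    map_mx cplx v *m (invmx P *m diag_mx D *m P) *m map_mx cplx v^T.
    by rewrite !mulmxA.
  by rewrite -EA /Ac -!map_mxM mxE.
- move=> v; apply: (@complexI R); rewrite rmorph_sum /=.
  have -> : \sum_i (N v i)%:C%C = \sum_i (const_mx 1 : 'rV_n) 0 i * (cplx (N v i)).
    by apply: eq_bigr => i _; rewrite mxE mul1r.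
  rewrite -key Yt /Y diag_const_mx mulmx1 -mulmxA (mulmxA (invmx P)) mulVmx// mul1mx.
  by rewrite -map_mxM /qform mulmx1 [RHS]mxE.
Qed.

(** [spectrum] is a choice with default [[::]]; the sorted diagonal [d] shows that the set chosen
    from is inhabited. *)
Lemma symmetric_spectrumP :
  sorted (>=%R) (spectrum A) /\ char_poly A = \prod_(a <- spectrum A) ('X - a%:P).
Proof.
have [d [_ [Ed _ _ _]]] := symmetric_diagonalization.
rewrite /spectrum; case: xgetP => [s _ []//|/(_ (sort (>=%R) (codom d)))].
case; split; first by apply: sort_sorted => x y; exact: le_total.
rewrite (perm_big (codom d)) ?perm_sort// Ed codomE big_map.
by rewrite big_enum.
Qed.

Lemma size_spectrum : size (spectrum A) = n.
Proof.
have [_ /(congr1 (fun p : {poly R} => size p))] := symmetric_spectrumP.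
by rewrite size_char_poly size_prod_XsubC => -[].
Qed.

Lemma mem_spectrum a : (a \in spectrum A) = root (char_poly A) a.
Proof. by rewrite symmetric_spectrumP.2 root_prod_XsubC. Qed.

(** Vieta: compare the coefficients of degree [n - 1] in the two forms of the characteristic
    polynomial. *)
Lemma sum_eigval : \sum_(i < n) eigval A i = \tr A.
Proof.
have [n0|n0] := posnP n.
  have noord (i : 'I_n) : False by have := ltn_ord i; rewrite {2}n0.
  by rewrite /mxtrace !big1// => i; case: (noord i).
have E : \sum_(i < n) eigval A i = \sum_(a <- spectrum A) a.
  by rewrite (big_nth 0) size_spectrum big_mkord.
apply: oppr_inj; rewrite -(char_poly_trace A n0) symmetric_spectrumP.2 E.
have -> : n.-1 = (size (spectrum A)).-1 by rewrite size_spectrum.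
by rewrite coefPn_prod_XsubC ?size_spectrum ?lt0n_neq0.
Qed.

(** Evaluate the hypothesis at an eigenvector for [eigval A i]. *)
Lemma eigval_ge_qform (c : R) i : (i < n)%N ->
  (forall v, c * qform 1%:M v <= qform A v) -> c <= eigval A i.
Proof.
move=> ltin cA.
have : eigenvalue A (eigval A i).
  by rewrite eigenvalue_root_char -mem_spectrum mem_nth ?size_spectrum.
move=> /eigenvalueP[v vA v0].
have := cA v; rewrite /qform vA mulmx1 -scalemxAl [in leRHS]mxE ler_pM2r//.
rewrite mxE lt0r; apply/andP; split.
  apply: contra v0; rewrite psumr_eq0 => [/allP h|j _]; last first.
    by rewrite mxE -expr2 sqr_ge0.
  apply/eqP/matrixP => k j; rewrite ord1 mxE.
  have := h j (mem_index_enum _); rewrite /= mxE -expr2 sqrf_eq0.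
  by move=> /eqP.
by apply: sumr_ge0 => j _; rewrite mxE -expr2 sqr_ge0.
Qed.

Lemma eigval_root_bounds a : root (char_poly A) a ->
  eigval A n.-1 <= a <= eigval A 0.
Proof.
rewrite -mem_spectrum => /(nthP 0); case=> i; rewrite size_spectrum => ltin <-.
have srt := symmetric_spectrumP.1.
have tr : transitive (>=%R : rel R) by move=> x y z /= h1 h2; exact: le_trans h2 h1.
have rf : reflexive (>=%R : rel R) by move=> x /=.
have mono := sorted_leq_nth tr rf 0 srt.
have n0 : (0 < n)%N by case: (n) ltin.
apply/andP; split.
  by apply: mono => //; rewrite ?inE ?size_spectrum ?prednK// -ltnS prednK.
by apply: mono => //; rewrite ?inE ?size_spectrum.
Qed.

Lemma qform_bounds v :
  eigval A n.-1 * qform 1%:M v <= qform A v <= eigval A 0 * qform 1%:M v.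
Proof.
have [d [N [Ed N0 EA E1]]] := symmetric_diagonalization.
have dP i : eigval A n.-1 <= d i <= eigval A 0.
  apply: eigval_root_bounds; rewrite Ed /root horner_prod.
  by rewrite (bigD1 i)//= hornerXsubC subrr mul0r.
rewrite EA E1 !mulr_sumr; apply/andP; split; apply: ler_sum => i _;
  by apply: ler_wpM2r => //; case/andP: (dP i).
Qed.
End SymmetricSpectrum.

(** * Gaussian moments *)

Section GaussianMoments.
Variables (R : realType) (rho : R).
Hypothesis rho_gt0 : 0 < rho.
Local Notation mu := (@lebesgue_measure R).
Local Notation g := (normal_pdf 0 rho).

Let rho_neq0 : rho != 0. Proof. exact: lt0r_neq0. Qed.

(** The Radon-Nikodym derivative agrees almost everywhere with the density, since both have the same
    integral over every measurable set; the change of variables is applied to the former. *)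
Lemma ge0_integral_normal_prob (h : measurableTypeR R -> \bar R) :
  (forall x, 0 <= h x)%E -> measurable_fun setT h ->
  (\int[normal_prob 0 rho]_x h x = \int[mu]_x (h x * (g x)%:E))%E.
Proof.
move=> h0 mh.
rewrite -(Radon_Nikodym_SigmaFinite.change_of_variables
  (normal_prob_dominates 0 rho) h0 measurableT mh).
apply: ae_eq_integral => //=.
- apply: emeasurable_funM => //; apply: (measurable_int mu).
  exact: (Radon_Nikodym_SigmaFinite.f_integrable (normal_prob_dominates 0 rho)).
- apply: emeasurable_funM => //; apply/measurable_EFinP.
  exact: measurable_normal_pdf.
- apply: ae_eqe_mul2l; apply: integral_ae_eq => //=.
  + exact: (Radon_Nikodym_SigmaFinite.f_integrable (normal_prob_dominates 0 rho)).
  + by apply/measurable_EFinP; exact: measurable_normal_pdf.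
  + by move=> E _ mE; rewrite -(Radon_Nikodym_SigmaFinite.f_integral (normal_prob_dominates 0 rho)).
Qed.

Lemma normal_pdf0E x :
  g x = normal_peak rho * expR (- x ^+ 2 / (rho ^+ 2 *+ 2)).
Proof. by rewrite normal_pdfE// /normal_fun subr0. Qed.

Lemma is_derive_normal_pdf (x : R) : is_derive x 1 g (- x / rho ^+ 2 * g x).
Proof.
have -> : g = fun y => normal_peak rho * expR (- y ^+ 2 / (rho ^+ 2 *+ 2)).
  by apply/funext => y; rewrite normal_pdf0E.
apply: is_derive_eq.
set e := expR _; rewrite scaler0 add0r !scaler1 -![_ *: _]/(_ * _).
by move: e (normal_peak rho) => e p; rewrite -(mulr_natr (rho ^+ 2)); field.
Qed.

Lemma normal_pdfN x : g (- x) = g x.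
Proof. by rewrite !normal_pdf0E sqrrN. Qed.

Lemma cvg_pow_normal_pdf k : x ^+ k * g x @[x --> +oo] --> (0 : R).
Proof.
(* From [expR y >= y^(k+1) / (k+1)!] at [y = x^2 / (2 rho^2)]: this leaves [x^(-k-2)], which is at
   most [1 / x] for [x >= 1]. *)
pose C := normal_peak rho * (k.+1`!%:R * (rho ^+ 2 *+ 2) ^+ k.+1).
have r2 : 0 < rho ^+ 2 *+ 2 by rewrite pmulrn_lgt0// exprn_gt0.
have C0 : 0 <= C.
  by rewrite !mulr_ge0 ?normal_peak_ge0 ?ler0n// exprn_ge0// ltW.
have bnd x : 1 <= x -> x ^+ k * g x <= C / x.
  move=> x1; have x0 : 0 < x by exact: lt_le_trans x1.
  rewrite normal_pdf0E mulNr expRN.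
  have y0 : 0 <= x ^+ 2 / (rho ^+ 2 *+ 2) by exact: divr_ge0 (sqr_ge0 _) (ltW r2).
  have := expR_ge1Dxn k y0; set y := x ^+ 2 / _ => ey.
  have ey' : y ^+ k.+1 / k.+1`!%:R <= expR y by apply: le_trans ey; rewrite lerDr.
  have yk : 0 < y ^+ k.+1 / k.+1`!%:R.
    by rewrite divr_gt0 ?ltr0n ?fact_gt0// exprn_gt0// /y divr_gt0// exprn_gt0.
  rewrite ler_pdivlMr// /C mulrCA -!mulrA ler_wpM2l ?normal_peak_ge0//.
  have : (expR y)^-1 <= (y ^+ k.+1 / k.+1`!%:R)^-1 by rewrite lef_pV2// posrE expR_gt0.
  move=> /(ler_wpM2r (_ : 0 <= x ^+ k.+1)) => /(_ (exprn_ge0 _ (ltW x0))) h.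
  rewrite mulrCA -exprSr mulrC [leLHS]mulrC; apply: le_trans h _.
  rewrite /y expr_div_n invf_div invf_div -!mulrA.
  rewrite ler_wpM2l ?ler0n// -[leRHS]mulr1 ler_wpM2l ?exprn_ge0 ?(ltW r2)//.
  by rewrite ler_pdivrMl ?exprn_gt0// mulr1 -exprM ler_weXn2l// leq_pmull.
apply/cvgr0Pnorm_le => e e0.
near=> x.
have x1 : 1 <= x by near: x; apply: nbhs_pinfty_ge; rewrite num_real.
have x0 : 0 < x by exact: lt_le_trans x1.
rewrite ger0_norm ?mulr_ge0 ?exprn_ge0 ?normal_pdf_ge0 ?(ltW x0)//.
apply: le_trans (bnd _ x1) _.
have xe : e^-1 * C <= x by near: x; apply: nbhs_pinfty_ge; rewrite num_real.
by rewrite ler_pdivrMr// -ler_pdivrMl.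
Unshelve. all: by end_near. Qed.

(** On the half line the odd moments do not vanish, so log-convexity relates consecutive exponents;
    this is the source of Wallis' bounds. The moments over the whole line follow by splitting at
    0. *)
Definition half_moment t := (\int[mu]_(x in `[0%R, +oo[) (x ^+ t * g x)%:E)%E.

Lemma continuous_pow_normal_pdf t : continuous (fun x : R => x ^+ t * g x).
Proof.
move=> x; apply: cvgM; first exact: exprn_continuous.
exact: continuous_normal_pdf.
Qed.

Lemma half_moment0 : half_moment 0 = (2^-1)%:E.
Proof.
have := @ge0_symfun_integralT R g.
rewrite integral_normal_pdf.
move=> /(_ (normal_pdf_ge0 _ _) (continuous_normal_pdf rho_neq0)).
move=> /(_ (fun x => esym (normal_pdfN x))).
rewrite -set_itvcy => e.
have -> : half_moment 0 = (\int[mu]_(x in `[0%R, +oo[) (g x)%:E)%E.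
  by apply: eq_integral => x _; rewrite expr0 mul1r.
move: (\int[mu]_(x in `[0%R, +oo[) (g x)%:E)%E e.
case=> [r|/eqP|/eqP].
- by move=> /(congr1 fine) /= e; congr EFin; lra.
- by rewrite gt0_muley ?lte_fin.
- by rewrite gt0_muleNy ?lte_fin.
Qed.

Lemma half_moment1 : half_moment 1 = (rho ^+ 2 * normal_peak rho)%:E.
Proof.
rewrite /half_moment (@ge0_continuous_FTC2y R _ (fun x => - rho ^+ 2 * g x) 0 0).
- rewrite -EFinB sub0r mulNr opprK normal_pdf0E expr0n /= oppr0 mul0r expR0 mulr1//.
- by move=> x x0; rewrite mulr_ge0 ?normal_pdf_ge0// exprn_ge0.
- apply: continuous_subspaceT; exact: continuous_pow_normal_pdf.
- rewrite -[X in _ --> X](mulr0 (- rho ^+ 2)); apply: cvgM; first exact: cvg_cst.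
  by have := cvg_pow_normal_pdf 0; under eq_fun do rewrite expr0 mul1r.
- move=> x _; have := is_derive_normal_pdf x => ?; exact: ex_derive.
- apply: cvg_at_right_filter; apply: cvgM; [exact: cvg_cst|exact: continuous_normal_pdf].
- move=> x _; rewrite derive1E.
  have ? := is_derive_normal_pdf x.
  rewrite derive_val -![_ *: _]/(_ * _) expr1; field; done.
Qed.

(** Integration by parts on [[0, i + 1]] with [x g(x) = (- rho^2 g)'], then [i] to infinity: the
    boundary term vanishes and the integrals converge monotonically. Finiteness is assumed here and
    established afterwards by induction with this very recursion. *)
Lemma half_momentS t : (half_moment t < +oo)%E ->
  half_moment t.+2 = ((t.+1%:R * rho ^+ 2)%:E * half_moment t)%E.
Proof.
move=> fint.
pose F i : set R := `[0, i.+1%:R]%classic.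
have nnf u x : 0 <= x -> (0 <= (x ^+ u * g x)%:E)%E.
  by move=> x0; rewrite lee_fin mulr_ge0 ?normal_pdf_ge0// exprn_ge0.
have mf u (D : set R) : measurable_fun D (fun x => (x ^+ u * g x)%:E).
  apply/measurable_EFinP; apply: measurable_funTS; apply: continuous_measurable_fun.
  exact: continuous_pow_normal_pdf.
have FU : \bigcup_i F i = `[0, +oo[%classic.
  apply/seteqP; split => [x [i _]|x] /=; rewrite !in_itv/= ?andbT.
    by case/andP.
  move=> x0; exists (truncn x) => //; rewrite /F /= in_itv/= x0 /=.
  by apply: ltW; rewrite truncnS_gt.
have lim u : (\int[mu]_(x in F i) (x ^+ u * g x)%:E @[i --> \oo] --> half_moment u)%E.
  rewrite /half_moment -FU; apply: ge0_nondecreasing_set_cvg_integral => //.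
  - apply/nondecreasing_seqP => n; rewrite subsetEset; apply: subset_itvl.
    by rewrite bnd_simp ler_nat.
  - by move=> i; exact: measurable_itv.
  - by move=> i; exact: mf.
  - by move=> i x; rewrite /F/= in_itv/= => /andP[? _]; exact: nnf.
pose c := t.+1%:R * rho ^+ 2.
have parts i : (\int[mu]_(x in F i) (x ^+ t.+2 * g x)%:E =
   (- rho ^+ 2 * (i.+1%:R ^+ t.+1 * g i.+1%:R))%:E +
   c%:E * \int[mu]_(x in F i) (x ^+ t * g x)%:E)%E.
  have i0 : (0 : R) < i.+1%:R by rewrite ltr0n.
  have dX (x : R) : is_derive x 1 (fun x => x ^+ t.+1) (t.+1%:R * x ^+ t).
    have := @is_deriveX R R id t.+1 x 1 1 (is_derive_id _ _).
    rewrite -[_ *: _]/(_ * _) mulr1.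
    by rewrite (_ : id ^+ t.+1 = (fun x : R => x ^+ t.+1))// exprfctE.
  have dG (x : R) : is_derive x 1 (fun x => - rho ^+ 2 * g x) (x * g x).
    have ? := is_derive_normal_pdf x.
    by apply: is_derive_eq; rewrite -![_ *: _]/(_ * _); field; done.
  have := @integration_by_parts R (fun x => x ^+ t.+1) (fun x => - rho ^+ 2 * g x)
    (fun x => t.+1%:R * x ^+ t) (fun x => x * g x) 0 i.+1%:R i0.
  have cX : continuous (fun x : R => t.+1%:R * x ^+ t).
    by move=> x; apply: cvgM; [exact: cvg_cst|exact: exprn_continuous].
  have cG : continuous (fun x : R => x * g x).
    by move=> x; apply: cvgM => //; exact: continuous_normal_pdf.
  have drX : derivable_oo_LRcontinuous (fun x : R => x ^+ t.+1) 0 i.+1%:R.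
    split.
    - by move=> x _; exact: ex_derive.
    - exact: cvg_at_right_filter (@exprn_continuous _ _ _).
    - exact: cvg_at_left_filter (@exprn_continuous _ _ _).
  have ccG : continuous (fun x : R => - rho ^+ 2 * g x).
    by move=> x; apply: cvgM; [exact: cvg_cst|exact: continuous_normal_pdf].
  have drG : derivable_oo_LRcontinuous (fun x : R => - rho ^+ 2 * g x) 0 i.+1%:R.
    split.
    - by move=> x _; exact: ex_derive.
    - exact: cvg_at_right_filter (ccG _).
    - exact: cvg_at_left_filter (ccG _).
  move=> /(_ (continuous_subspaceT cX) drX).
  have e1 : {in `]0, i.+1%:R[, (fun x : R => x ^+ t.+1)^`()%classic =1
      (fun x => t.+1%:R * x ^+ t)}.
    by move=> x _; rewrite derive1E derive_val.
  have e2 : {in `]0, i.+1%:R[, (fun x : R => - rho ^+ 2 * g x)^`()%classic =1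
      (fun x => x * g x)}.
    by move=> x _; rewrite derive1E derive_val.
  move=> /(_ e1 (continuous_subspaceT cG) drG e2).
  rewrite expr0n /= mul0r subr0.
  rewrite -/(F i) => e.
  transitivity (\int[mu]_(x in F i) (x ^+ t.+1 * (x * g x))%:E)%E.
    by apply: eq_integral => x _; rewrite mulrA -exprSr.
  rewrite e mulrCA; congr (_ + _)%E.
  have int : mu.-integrable (F i) (fun x => (x ^+ t * g x)%:E).
    apply: continuous_compact_integrable; first exact: segment_compact.
    by apply: continuous_subspaceT; exact: continuous_pow_normal_pdf.
  transitivity (- \int[mu]_(x in F i) ((- c)%:E * (x ^+ t * g x)%:E))%E.
    congr (- _)%E; apply: eq_integral => x _; rewrite -EFinM; congr EFin.
    by rewrite /c; ring.
  have -> : (\int[mu]_(x in F i) ((- c)%:E * (x ^+ t * g x)%:E) =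
      (- c)%:E * \int[mu]_(x in F i) (x ^+ t * g x)%:E)%E.
    by apply: integralZl => //; exact: measurable_itv.
  by rewrite -mulNe -EFinN opprK.
have fin : half_moment t \is a fin_num.
  by rewrite ge0_fin_numE// integral_ge0// => x /=; rewrite in_itv/= andbT => /nnf; exact.
have cr : - rho ^+ 2 * (i.+1%:R ^+ t.+1 * g i.+1%:R) @[i --> \oo] --> (0 : R).
  rewrite -[X in _ --> X](mulr0 (- rho ^+ 2)); apply: cvgM; first exact: cvg_cst.
  apply: (cvg_comp (fun i => i.+1%:R) _ _ (cvg_pow_normal_pdf t.+1)).
  apply/cvgryPge => A; near=> i; apply: (@le_trans _ _ i%:R); last by rewrite ler_nat.
  by near: i; exact: nbhs_infty_ger.
have lim2 : ((- rho ^+ 2 * (i.+1%:R ^+ t.+1 * g i.+1%:R))%:E +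
   c%:E * \int[mu]_(x in F i) (x ^+ t * g x)%:E @[i --> \oo] -->
   0%:E + c%:E * half_moment t)%E.
  apply: cvgeD.
  - by rewrite fin_num_adde_defr// fin_numM.
  - by apply: cvg_EFin; [near=> i|exact: cr].
  - by apply: cvgeZl => //; exact: lim.
have := lim t.+2.
under eq_fun do rewrite parts.
move=> /cvg_unique => /(_ (@ereal_hausdorff R)) /(_ _ lim2) ->.
by rewrite add0e.
Unshelve. all: by end_near. Qed.

Lemma half_moment_fin t : half_moment t \is a fin_num.
Proof.
suff [] : half_moment t \is a fin_num /\ half_moment t.+1 \is a fin_num by [].
elim: t => [|t [h1 h2]]; first by rewrite half_moment0 half_moment1.
split=> //; rewrite half_momentS ?fin_numM//.
by move: h1; rewrite fin_numElt => /andP[].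
Qed.

Definition hm t := fine (half_moment t).

Lemma hmE t : half_moment t = (hm t)%:E.
Proof. by rewrite fineK// half_moment_fin. Qed.

Lemma hm0 : hm 0 = 2^-1. Proof. by rewrite /hm half_moment0. Qed.

Lemma hm1 : hm 1 = rho ^+ 2 * normal_peak rho.
Proof. by rewrite /hm half_moment1. Qed.

Lemma hmS t : hm t.+2 = t.+1%:R * rho ^+ 2 * hm t.
Proof. by rewrite /hm half_momentS ?hmE ?ltry. Qed.

Lemma hm_gt0 t : 0 < hm t.
Proof.
suff [] : 0 < hm t /\ 0 < hm t.+1 by [].
elim: t => [|t [h1 h2]].
  by rewrite hm0 hm1 invr_gt0 mulr_gt0 ?normal_peak_gt0 ?exprn_gt0// ltr0n.
by split=> //; rewrite hmS !mulr_gt0 ?exprn_gt0// ltr0n.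
Qed.

Let nnf u x : 0 <= x -> (0 <= (x ^+ u * g x)%:E)%E.
Proof. by move=> x0; rewrite lee_fin mulr_ge0 ?normal_pdf_ge0// exprn_ge0. Qed.

Let mf u (D : set R) : measurable_fun D (fun x => (x ^+ u * g x)%:E).
Proof.
apply/measurable_EFinP; apply: measurable_funTS; apply: continuous_measurable_fun.
exact: continuous_pow_normal_pdf.
Qed.

(** Integrate [x^t g(x) (x - s)^2 >= 0] and take the minimizing [s = hm t.+1 / hm t]. The cross term
    is moved to the other side so that only nonnegative functions are integrated. *)
Lemma hm_logconvex t : hm t.+1 ^+ 2 <= hm t * hm t.+2.
Proof.
have key s : 0 <= s -> 2 * s * hm t.+1 <= hm t.+2 + s ^+ 2 * hm t.
  move=> s0; rewrite -lee_fin EFinD !EFinM -!hmE /half_moment.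
  have s20 : (0 <= (s ^+ 2)%:E)%E by rewrite lee_fin sqr_ge0.
  have ts0 : (0 <= (2 * s)%:E)%E by rewrite lee_fin mulr_ge0.
  have in0 (x : R) : `[0%R, +oo[%classic x -> 0 <= x by rewrite /= in_itv/= andbT.
  rewrite -EFinM -!ge0_integralZl//; try exact: mf; try by move=> x /in0 /nnf; exact.
  rewrite -ge0_integralD//; last first.
  - by apply: measurable_funeM; exact: mf.
  - by move=> x /in0 x0; rewrite mule_ge0 ?nnf.
  - exact: mf.
  - by move=> x /in0 /nnf; exact.
  apply: ge0_le_integral => //.
  - by move=> x /in0 x0; rewrite mule_ge0 ?nnf.
  - by apply: measurable_funeM; exact: mf.
  - by apply: emeasurable_funD; [exact: mf|apply: measurable_funeM; exact: mf].
  - move=> x /in0 x0; rewrite -!EFinM -EFinD lee_fin -subr_ge0.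
    have -> : x ^+ t.+2 * g x + s ^+ 2 * (x ^+ t * g x) -
        2 * s * (x ^+ t.+1 * g x) = x ^+ t * g x * (x - s) ^+ 2.
      by rewrite !exprS; ring.
    apply: mulr_ge0; last exact: sqr_ge0.
    by apply: mulr_ge0; [exact: exprn_ge0|exact: normal_pdf_ge0].
have h0 := hm_gt0 t; have h1 := hm_gt0 t.+1.
have := key (hm t.+1 / hm t) (divr_ge0 (ltW h1) (ltW h0)).
move=> /(ler_wpM2l (ltW h0)); rewrite -subr_ge0 => h; rewrite -subr_ge0.
apply: le_trans h _; rewrite le_eqVlt; apply/orP; left; apply/eqP; field.
exact: lt0r_neq0.
Qed.

Lemma ge0_integralT_split (k : R -> R) : (forall x, 0 <= k x) -> continuous k ->
  (\int[mu]_x (k x)%:E = \int[mu]_(x in `[0%R, +oo[) (k x)%:E +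
    \int[mu]_(x in `[0%R, +oo[) (k (- x))%:E)%E.
Proof.
move=> k0 ck.
have mk : measurable_fun [set: R] k by exact: continuous_measurable_fun.
have mposnums : measurable [set x : R | 0 <= x]%R by rewrite -set_itvcy.
rewrite -(setUv [set x : R | 0 <= x]%R) ge0_integral_setU//= ; last 4 first.
  exact: measurableC.
  by apply/measurable_EFinP; rewrite setUv.
  by move=> x _; rewrite lee_fin.
  exact/disj_setPCl.
rewrite -set_itvcy// setCitvr; congr (_ + _)%E.
rewrite integral_itv_bndo_bndc; last exact/measurable_EFinP/measurable_funTS.
rewrite -{1}oppr0 ge0_integration_by_substitutionNy//.
exact: continuous_subspaceT.
Qed.

Lemma gauss_moment_even t : ~~ odd t -> gauss_moment rho t = 2 * hm t.
Proof.
move=> et; rewrite /gauss_moment ge0_integral_normal_prob; last 2 first.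
- by move=> x; rewrite lee_fin exprn_even_ge0.
- by apply/measurable_EFinP; exact: exprn_measurable.
have := @ge0_integralT_split (fun x => x ^+ t * g x).
have k0 (x : R) : 0 <= x ^+ t * g x by rewrite mulr_ge0 ?exprn_even_ge0 ?normal_pdf_ge0.
move=> /(_ k0 (continuous_pow_normal_pdf (t := t))) e.
under eq_integral do rewrite -EFinM.
rewrite e; under [X in (_ + X)%E]eq_integral
  do rewrite normal_pdfN exprNn -signr_odd (negbTE et) expr0 mul1r.
by rewrite -/(half_moment t) hmE /= mulr2n mulrDl mul1r.
Qed.

(** The positive and the negative part both integrate to [half_moment t], whose finiteness makes
    their difference 0. *)
Lemma gauss_moment_odd t : odd t -> gauss_moment rho t = 0.
Proof.
move=> ot; rewrite /gauss_moment integralE.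
have cpow : continuous (fun x : R => x ^+ t) by exact: exprn_continuous.
have mpow : measurable_fun [set: measurableTypeR R] (fun x : measurableTypeR R => (x ^+ t)%:E).
  by apply/measurable_EFinP; exact: exprn_measurable.
have powN (x : R) : (- x) ^+ t = - x ^+ t.
  by rewrite exprNn -signr_odd ot expr1 mulN1r.
rewrite ge0_integral_normal_prob//; last exact: measurable_funepos.
rewrite ge0_integral_normal_prob//; last exact: measurable_funeneg.
under eq_integral do rewrite funeposE -EFin_max -EFinM.
under [X in (_ - X)%E]eq_integral do rewrite funenegE -EFinN -EFin_max -EFinM.
have cmax (f : R -> R) : continuous f -> continuous (fun x => maxr (f x) 0).
  by move=> cf x; exact: (continuous_max (cf x) (@cst_continuous _ _ (0 : R^o) x)).
have max_ge0 (y : R) : 0 <= maxr y 0 by rewrite le_max lexx orbT.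
rewrite !ge0_integralT_split.
- rewrite [X in (X + _ - _)%E](_ : _ = half_moment t); last first.
    apply: eq_integral => x; rewrite inE /= in_itv/= andbT => x0.
    by rewrite max_l// exprn_ge0.
  rewrite [X in (_ + X - _)%E](_ : _ = 0%E); last first.
    apply: integral0_eq => x; rewrite /= in_itv/= andbT => x0.
    by rewrite powN max_r ?mul0r// oppr_le0 exprn_ge0.
  rewrite [X in (_ - (X + _))%E](_ : _ = 0%E); last first.
    apply: integral0_eq => x; rewrite /= in_itv/= andbT => x0.
    by rewrite max_r ?mul0r// oppr_le0 exprn_ge0.
  rewrite [X in (_ - (_ + X))%E](_ : _ = half_moment t); last first.
    apply: eq_integral => x; rewrite inE /= in_itv/= andbT => x0.
    by rewrite powN opprK max_l ?exprn_ge0// normal_pdfN.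
  by rewrite adde0 add0e hmE subee.
- by move=> x; rewrite mulr_ge0 ?normal_pdf_ge0.
- move=> x; apply: cvgM; last exact: continuous_normal_pdf.
  have cN : continuous (fun y : R => - y ^+ t) by move=> z; apply: cvgN; exact: cpow.
  exact: (cmax _ cN x).
- by move=> x; rewrite mulr_ge0 ?normal_pdf_ge0.
- move=> x; apply: cvgM; last exact: continuous_normal_pdf.
  exact: (cmax _ cpow x).
Qed.

Lemma gauss_moment0 : gauss_moment rho 0 = 1.
Proof. by rewrite gauss_moment_even// hm0 divff. Qed.

Lemma gauss_moment1 : gauss_moment rho 1 = 0.
Proof. by rewrite gauss_moment_odd. Qed.

Lemma gauss_momentS t :
  gauss_moment rho t.+2 = t.+1%:R * rho ^+ 2 * gauss_moment rho t.
Proof.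
case: (boolP (odd t)) => ot.
  by rewrite !gauss_moment_odd ?mulr0//= negbK.
by rewrite !gauss_moment_even ?negbK// hmS; ring.
Qed.

End GaussianMoments.

(** The normalized central binomial coefficient ['C(2m, m) / 4^m], equivalent to
    [1 / sqrt (pi m)]. *)
Definition cbin {R : realType} (m : nat) : R := (m.*2)`!%:R / (m`!%:R ^+ 2 * 4 ^+ m).

(** * Wallis' bounds for central binomial coefficients *)

Section Wallis.
Variable R : realType.

Lemma cbinS m : @cbin R m.+1 = (m.*2.+1)%:R / (m.*2.+2)%:R * cbin m.
Proof.
rewrite /cbin doubleS !factS !natrM (exprS 4).
have -> : (m.*2.+2)%:R = 2 * m.+1%:R :> R by rewrite -natrM; congr _%:R; lia.
by field; rewrite pnatr_eq0 -lt0n fact_gt0 expf_neq0// nat1r pnatr_eq0.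
Qed.

Lemma cbin_gt0 m : 0 < @cbin R m.
Proof.
by rewrite /cbin divr_gt0 ?mulr_gt0 ?exprn_gt0 ?ltr0n ?fact_gt0.
Qed.

(** For [rho = 1] the even half moments contain [cbin] and the odd ones do not. Log-convexity
    centred at an odd exponent bounds [cbin] from below, centred at an even one from above. *)
Lemma wallis m : 2 / (m.*2.+1)%:R <= pi * @cbin R m ^+ 2 /\ pi * m%:R * @cbin R m ^+ 2 <= 1.
Proof.
have hev k : hm (1 : R) k.*2 = 2^-1 * (2 ^+ k * k`!%:R * cbin k).
  elim: k => [|k IH]; first by rewrite hm0// /cbin /= fact0; field.
  rewrite doubleS hmS// IH cbinS expr1n factS natrM exprS.
  have -> : (k.*2.+2)%:R = 2 * k.+1%:R :> R by rewrite -natrM; congr _%:R; lia.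
  by field; rewrite nat1r pnatr_eq0.
have hodd k : hm (1 : R) k.*2.+1 = normal_peak 1 * (2 ^+ k * k`!%:R).
  elim: k => [|k IH]; first by rewrite hm1// fact0 expr1n !expr0 !mulr1 mul1r.
  rewrite doubleS hmS// IH expr1n factS natrM exprS.
  have -> : (k.*2.+2)%:R = 2 * k.+1%:R :> R by rewrite -natrM; congr _%:R; lia.
  ring.
(* The number [pi] enters through the peak of the density, which is the first odd half moment. *)
have pk : normal_peak (1 : R) ^+ 2 = (pi *+ 2)^-1.
  by rewrite /normal_peak expr1n mul1r exprVn sqr_sqrtr// mulrn_wge0// pi_ge0.
have pi0 := @pi_gt0 R.
move: (@pi R) pi0 pk => p p0 pk.
have fk k : 0 < 2 ^+ k * k`!%:R :> R by rewrite mulr_gt0 ?exprn_gt0 ?ltr0n ?fact_gt0.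
split.
- have := hm_logconvex (ltr01 : 0 < 1 :> R) m.*2.
  rewrite hmS// hodd hev exprMn pk expr1n mulr1 -(mulr_natr p).
  move: (2 ^+ m * _) (fk m) => f f0 h.
  rewrite ler_pdivrMr ?ltr0n//.
  have : 0 <= (2^-1 * (f * cbin m)) * (m.*2.+1%:R * (2^-1 * (f * cbin m))) -
     (p * 2)^-1 * f ^+ 2 by rewrite subr_ge0.
  have f2 : 0 < 4 * p / f ^+ 2 by rewrite divr_gt0 ?mulr_gt0 ?exprn_gt0.
  move=> /(mulr_ge0 (ltW f2)) hh; rewrite -subr_ge0.
  apply: le_trans hh _; rewrite le_eqVlt; apply/orP; left; apply/eqP; field.
  by rewrite !lt0r_neq0.
- case: m => [|m]; first by rewrite mulr0 mul0r.
  have := hm_logconvex (ltr01 : 0 < 1 :> R) m.*2.+1.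
  rewrite (hmS (ltr01 : 0 < 1 :> R) m.*2.+1) hodd -doubleS hev expr1n mulr1.
  have -> : (m.*2.+2)%:R = 2 * m.+1%:R :> R by rewrite -natrM; congr _%:R; lia.
  have -> : 2 ^+ m.+1 * (m.+1)`!%:R = 2 * m.+1%:R * (2 ^+ m * m`!%:R) :> R.
    by rewrite exprS factS natrM; ring.
  move: (2 ^+ m * _) (fk m) => f f0 h.
  have {}h : (m.+1%:R * f * cbin m.+1) ^+ 2 <= normal_peak 1 ^+ 2 * (2 * m.+1%:R) * f ^+ 2.
    move: h; rewrite (_ : 2^-1 * _ = m.+1%:R * f * cbin m.+1); last by field.
    by rewrite (_ : _ * _ * (2 * _ * _) = normal_peak 1 ^+ 2 * (2 * m.+1%:R) * f ^+ 2)//; ring.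
  have {}h : (m.+1%:R * f * cbin m.+1) ^+ 2 <= (m.+1%:R / p) * f ^+ 2.
    apply: (le_trans h); rewrite pk -(mulr_natr p) le_eqVlt; apply/orP; left; apply/eqP.
    by field; rewrite lt0r_neq0.
  have m0 : 0 < m.+1%:R :> R by rewrite ltr0n.
  have f2 : 0 < p / (m.+1%:R * f ^+ 2) by rewrite divr_gt0 ?mulr_gt0 ?exprn_gt0.
  move: h => /(ler_wpM2l (ltW f2)); rewrite -subr_ge0 => hh; rewrite -subr_ge0.
  apply: le_trans hh _; rewrite le_eqVlt; apply/orP; left; apply/eqP; field.
  by rewrite !lt0r_neq0.
Qed.

End Wallis.

(** * Hermite polynomials *)

Section Hermite.
Variables (R : realType) (rho : R).
Hypothesis rho_gt0 : 0 < rho.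

(** The monic Hermite polynomials of variance [rho^2], generated by the operator
    [p -> 'X p - rho^2 p']. Under the Gaussian expectation it is [rho^2] times the adjoint of
    differentiation, which gives orthogonality at once. *)
Fixpoint hermite (n : nat) : {poly R} :=
  if n is n'.+1 then 'X * hermite n' - rho ^+ 2 *: (hermite n')^`() else 1.

Lemma coef_hermiteS n j : (hermite n.+1)`_j =
  (if j is j'.+1 then (hermite n)`_j' else 0)
  - rho ^+ 2 * (j.+1%:R * (hermite n)`_j.+1).
Proof.
rewrite /= coefB coefXM coefZ coef_deriv mulr_natl.
by case: j.
Qed.

Lemma coef_hermite_gt n j : (n < j)%N -> (hermite n)`_j = 0.
Proof.
elim: n j => [|n IH] j; first by rewrite coef1; case: j.
by case: j => // j ltnj; rewrite coef_hermiteS !IH ?mulr0 ?subr0//; lia.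
Qed.

Lemma coef_hermite_odd n j : odd (n + j) -> (hermite n)`_j = 0.
Proof.
elim: n j => [|n IH] j; first by rewrite coef1; case: j.
case: j => [|j] o; rewrite coef_hermiteS !IH ?mulr0 ?subr0//; lia.
Qed.

Lemma coef_hermite j m : (hermite (j + m.*2))`_j =
  (-1) ^+ m * rho ^+ m.*2 * (j + m.*2)`!%:R / (m`!%:R * j`!%:R * 2 ^+ m).
Proof.
have fneq k : k`!%:R != 0 :> R by rewrite pnatr_eq0 -lt0n fact_gt0.
have Sneq k : k.+1%:R != 0 :> R by rewrite pnatr_eq0.
(* Induction on the degree: the case [(j + 1, m + 1)] uses [(j, m + 1)] and [(j + 2, m)], both of
   degree one less. *)
move: {2}(j + m.*2)%N (leqnn (j + m.*2)) => N.
elim: N j m => [|N IH] j m leN.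
  have -> : j = 0%N by lia.
  have -> : m = 0%N by lia.
  by rewrite /= coef1 /= fact0 !expr0 !mulr1 divr1.
case: j m leN => [|j] [|m] leN.
- by rewrite /= coef1 /= fact0 !expr0 !mulr1 divr1.
- have -> : (0 + m.+1.*2 = (1 + m.*2).+1)%N by lia.
  rewrite coef_hermiteS IH; last by lia.
  rewrite sub0r (factS (1 + m.*2)) (factS m) (_ : 1`! = 1)%N// fact0 !natrM mul1r.
  have -> : (1 + m.*2).+1%:R = 2 * m.+1%:R :> R by rewrite -natrM; congr _%:R; lia.
  rewrite doubleS !exprS; field.
  by rewrite fneq nat1r Sneq expf_neq0.
- rewrite addn0 coef_hermiteS (coef_hermite_gt (_ : j < j.+2)%N)// ?mulr0 subr0.
  have := IH j 0%N; rewrite addn0 => ->; last by lia.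
  by rewrite fact0 !expr0; field; rewrite !fneq.
- have e : (j.+1 + m.+1.*2 = (j + m.+1.*2).+1)%N by lia.
  rewrite e coef_hermiteS IH; last by lia.
  have e' : (j + m.+1.*2 = j.+2 + m.*2)%N by lia.
  rewrite {2}e' IH; last by lia.
  rewrite -e' (factS (j + m.+1.*2)) (factS m) (factS j.+1) (factS j) !natrM.
  have -> : (j + m.+1.*2).+1%:R = j.+1%:R + 2 * m.+1%:R :> R.
    by rewrite -natrM -natrD; congr _%:R; lia.
  rewrite doubleS !exprS; field.
  by rewrite !fneq !nat1r !Sneq expf_neq0// -natrD pnatr_eq0.
Qed.

Definition hcoef n j : R := (hermite n)`_j / (rho ^+ n * Num.sqrt n`!%:R).

(** The absolute value of [hcoef n j] in closed form. Without the alternating sign, rows of the same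
    parity can be compared through their ratios. *)
Definition habs n j : R :=
  if (j <= n)%N && ~~ odd (n - j) then
    let m := (n - j)./2 in
    Num.sqrt n`!%:R / (m`!%:R * j`!%:R * 2 ^+ m * rho ^+ j)
  else 0.

Lemma hcoefE n j : hcoef n j = (-1) ^+ (n - j)./2 * habs n j.
Proof.
rewrite /habs; case: (leqP j n) => jn /=; last first.
  by rewrite /hcoef coef_hermite_gt// mul0r mulr0.
case: ifPn => o; last first.
  by rewrite /hcoef coef_hermite_odd ?mul0r ?mulr0//; lia.
have en : n = (j + (n - j)./2.*2)%N by lia.
set m := (n - j)./2 in en *; rewrite /hcoef.
have -> : (hermite n)`_j = (hermite (j + m.*2))`_j by rewrite -en.
rewrite coef_hermite -en.
have sq : Num.sqrt n`!%:R ^+ 2 = n`!%:R :> R by rewrite sqr_sqrtr.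
rewrite -{1}sq.
have s0 : Num.sqrt n`!%:R != 0 :> R by rewrite sqrtr_eq0 -ltNge ltr0n fact_gt0.
have -> : rho ^+ n = rho ^+ j * rho ^+ m.*2 by rewrite -exprD -en.
field; rewrite s0 !pnatr_eq0 -!lt0n !fact_gt0 !expf_neq0//; exact: lt0r_neq0.
Qed.

Variable mom : nat -> R.
Hypothesis mom0 : mom 0 = 1.
Hypothesis mom1 : mom 1 = 0.
Hypothesis momS : forall t, mom t.+2 = t.+1%:R * rho ^+ 2 * mom t.

(** The Gaussian expectation of a polynomial, kept formal: the recursion on [mom] already encodes
    integration by parts. *)
Definition momL (p : {poly R}) : R := \sum_(i < size p) p`_i * mom i.

Lemma momLE N (p : {poly R}) : (size p <= N)%N -> momL p = \sum_(i < N) p`_i * mom i.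
Proof.
move=> sN; rewrite /momL (big_ord_widen N (fun i => p`_i * mom i)) //.
rewrite big_mkcond; apply: eq_bigr => i _; case: ltnP => // si.
by rewrite nth_default// mul0r.
Qed.

Lemma momLD p q : momL (p + q) = momL p + momL q.
Proof.
pose N := maxn (size p) (size q).
rewrite !(@momLE N) ?leq_maxl ?leq_maxr ?size_polyD// -big_split/=.
by apply: eq_bigr => i _; rewrite coefD mulrDl.
Qed.

Lemma momLZ c p : momL (c *: p) = c * momL p.
Proof.
rewrite !(@momLE (size p)) ?size_scale_leq// mulr_sumr.
by apply: eq_bigr => i _; rewrite coefZ mulrA.
Qed.

Lemma momLB p q : momL (p - q) = momL p - momL q.
Proof. by rewrite -scaleN1r momLD momLZ mulN1r. Qed.

Lemma momL_sum n (F : 'I_n -> {poly R}) :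
  momL (\sum_i F i) = \sum_i momL (F i).
Proof.
elim/big_rec2: _ => [|i x y _ <-]; last by rewrite momLD.
by rewrite /momL size_poly0 big_ord0.
Qed.

Lemma momLXn k : momL 'X^k = mom k.
Proof.
rewrite (@momLE k.+1) ?size_polyXn// big_ord_recr/= coefXn eqxx mul1r big1 ?add0r//.
by move=> i _; rewrite coefXn ltn_eqF// mul0r.
Qed.

(** Stein's identity, read off coefficientwise from the moment recursion. *)
Lemma momLXM p : momL ('X * p) = rho ^+ 2 * momL p^`().
Proof.
rewrite (@momLE (size p).+2); last first.
  by rewrite (leq_trans (size_polyMleq _ _))// size_polyX /= leqnSn.
rewrite (@momLE (size p) p^`()); last exact: leq_trans (size_poly _ _) (leq_pred _).
rewrite 2!big_ord_recl /= coefXM /= mul0r add0r mom1 mulr0 add0r mulr_sumr.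
apply: eq_bigr => i _; rewrite /bump /= !add1n coefXM /= coef_deriv momS -mulr_natl.
ring.
Qed.

Lemma momL_hermiteS n (q : {poly R}) :
  momL (hermite n.+1 * q) = rho ^+ 2 * momL (hermite n * q^`()).
Proof.
rewrite /= mulrBl momLB -(mulrA 'X) momLXM derivM momLD.
by rewrite -(scalerAl (rho ^+ 2) _ q) momLZ; ring.
Qed.

Lemma momL_hermite n (q : {poly R}) : momL (hermite n * q) = rho ^+ n.*2 * momL q^`(n).
Proof.
elim: n q => [|n IH] q; first by rewrite mul1r expr0 mul1r.
by rewrite momL_hermiteS IH derivSn doubleS !exprS; ring.
Qed.

Lemma size_hermite n : (size (hermite n) <= n.+1)%N.
Proof. by apply/leq_sizeP => j; exact: coef_hermite_gt. Qed.

(** Moving all [n] raising operators to the other factor differentiates it [n] times: this kills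
    every lower degree and turns the monic degree [n] into [n!]. *)
Lemma hermite_orthogonal n k :
  momL (hermite n * hermite k) = if n == k then rho ^+ n.*2 * n`!%:R else 0.
Proof.
have lem a b : (b < a)%N -> momL (hermite a * hermite b) = 0.
  move=> ba; rewrite momL_hermite derivn_poly0 ?(leq_trans (size_hermite b))//.
  by rewrite /momL size_poly0 big_ord0 mulr0.
case: (ltngtP n k) => [nk|kn|<-]; [by rewrite mulrC lem|exact: lem|].
rewrite momL_hermite (@momLE 1); last first.
  apply/leq_sizeP => j j0; rewrite coef_derivn coef_hermite_gt ?mul0rn//; lia.
rewrite big_ord1 mom0 mulr1 coef_derivn addn0 ffactnn.
have := coef_hermite n 0; rewrite addn0 => ->.
rewrite fact0 !expr0; congr (_ * _); rewrite -mulr_natr; field.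
by rewrite pnatr_eq0 -lt0n fact_gt0.
Qed.

Lemma hcoef_orthonormal T (B : 'M[R]_T.+1) (C : 'M[R]_T.+1) :
  B = \matrix_(i, j) mom (i + j) -> C = \matrix_(n, j) hcoef n j ->
  C *m B *m C^T = 1%:M.
Proof.
move=> -> ->; apply/matrixP => n k; rewrite !mxE.
transitivity (momL (hermite n * hermite k) /
   ((rho ^+ n * Num.sqrt n`!%:R) * (rho ^+ k * Num.sqrt k`!%:R))); last first.
  rewrite hermite_orthogonal (inj_eq val_inj); case: eqP => [<-|_]; last by rewrite mul0r.
  have s0 : Num.sqrt n`!%:R != 0 :> R by rewrite sqrtr_eq0 -ltNge ltr0n fact_gt0.
  have sq : Num.sqrt n`!%:R ^+ 2 = n`!%:R :> R by rewrite sqr_sqrtr.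
  rewrite -{1}sq -addnn exprD mulr1n; field.
  by rewrite s0 expf_neq0//; exact: lt0r_neq0.
have polyE m : (m <= T)%N -> hermite m = \sum_(i < T.+1) (hermite m)`_i *: 'X^i.
  move=> mT; rewrite -poly_def; apply/polyP => i; rewrite coef_poly.
  by case: ltnP => // Ti; rewrite coef_hermite_gt//; lia.
rewrite (polyE n (ltn_ord n)) (polyE k (ltn_ord k)).
rewrite mulr_sumr momL_sum mulr_suml; apply: eq_bigr => j _.
rewrite [X in momL X]mulr_suml momL_sum !mxE !mulr_suml; apply: eq_bigr => i _.
have -> : (hermite n)`_i *: 'X^i * ((hermite k)`_j *: 'X^j) =
    ((hermite n)`_i * (hermite k)`_j) *: 'X^(i + j).
  by rewrite -scalerAl -scalerAr scalerA exprD.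
by rewrite !mxE momLZ momLXn /hcoef [in RHS]invfM; ring.
Qed.

End Hermite.

(** * Growth of the even moments *)

Section Stirling.
Variable R : realType.

Lemma ger0_is_derive_le (f df : R -> R) (b : R) : 0 <= b ->
  (forall x : R, 0 <= x -> is_derive x 1 f (df x)) ->
  (forall x : R, 0 <= x -> 0 <= df x) -> f 0 <= f b.
Proof.
move=> b0 fd df0.
have dfx (x : R) : x \in `]0, b[ -> derivable f x 1.
  by rewrite in_itv/= => /andP[x0 _]; case: (fd x (ltW x0)).
apply: (@ger0_derive1_le_cc R f 0 b) => //; rewrite ?in_itv/= ?lexx ?b0//.
- move=> x; rewrite in_itv/= => /andP[x0 _]; have ? := fd x (ltW x0).
  by rewrite derive1E derive_val df0 ?ltW.
- apply: derivable_within_continuous => x; rewrite in_itv/= => /andP[x0 _].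
  by case: (fd x x0).
Qed.

Lemma is_derive_ln1D (x : R) : 0 <= x ->
  is_derive x 1 (fun y : R => ln (1 + y)) ((1 + x)^-1).
Proof.
move=> x0; have x1 : 0 < 1 + x by lra.
have h2 : is_derive x 1 (fun y : R => 1 + y) (0 + 1) by apply: is_deriveD.
have := @is_derive1_comp R (@ln R) (fun y : R => 1 + y) x _ _ (is_derive1_ln x1) h2.
by rewrite add0r mulr1.
Qed.

Lemma ln1D_ge_frac (y : R) : 0 <= y -> y / (1 + y) <= ln (1 + y).
Proof.
move=> y0; have y1 : 0 < 1 + y by lra.
have := @le_ln1Dx R (- (y / (1 + y))).
have -> : 1 + - (y / (1 + y)) = (1 + y)^-1 by field; lra.
rewrite lnV ?posrE// => h.
have : - ln (1 + y) <= - (y / (1 + y)).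
  by apply: h; rewrite ltrN2 ltr_pdivrMr// mul1r; lra.
by rewrite lerN2.
Qed.

(** This bound and [ln1D_le] agree with [ln (1 + y)] up to order [y^2]. At [y = 1 / n] this is the
    precision that makes the increments of [stirling_err] summable. *)
Lemma ln1D_ge (y : R) : 0 <= y -> 2 * y <= (2 + y) * ln (1 + y).
Proof.
move=> y0; rewrite -subr_ge0.
have := @ger0_is_derive_le (fun y => (2 + y) * ln (1 + y) - 2 * y)
  (fun y => ln (1 + y) - y / (1 + y)) y y0.
rewrite !addr0 ln1 !mulr0 subr0; apply => x x0.
- have ? := is_derive_ln1D x0.
  by apply: is_derive_eq; rewrite -?[_ *: _]/(_ * _); field; lra.
- by rewrite subr_ge0 ln1D_ge_frac.
Qed.

Lemma ln1D_le (y : R) : 0 <= y -> 2 * (1 + y) * ln (1 + y) <= y * (2 + y).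
Proof.
move=> y0; rewrite -subr_ge0.
have := @ger0_is_derive_le (fun y => y * (2 + y) - 2 * (1 + y) * ln (1 + y))
  (fun y => 2 * (y - ln (1 + y))) y y0.
rewrite !addr0 ln1 !mulr0 mul0r subr0; apply => x x0.
- have ? := is_derive_ln1D x0.
  by apply: is_derive_eq; rewrite -?[_ *: _]/(_ * _); field; lra.
- by rewrite mulr_ge0// subr_ge0 le_ln1Dx//; lra.
Qed.

(** The logarithm of [n! / (n^(n + 1/2) e^(-n))]. Its limit cancels between [(2T)!] and [T!], so
    convergence is all that has to be shown. *)
Definition stirling_err (n : nat) : R :=
  ln n`!%:R - (n%:R + 2^-1) * ln n%:R + n%:R.

(** The increment is [(n + 1/2) ln (1 + 1/n) - 1]. The upper bound on the logarithm turns the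
    product into [(2n + 1)^2 / (4n (n + 1)) = 1 + 1 / (4n (n + 1))], whose excess over 1
    telescopes. *)
Lemma stirling_err_step n : (0 < n)%N ->
  0 <= stirling_err n - stirling_err n.+1 <= (4 * n%:R)^-1 - (4 * n.+1%:R)^-1.
Proof.
move=> n0; have nR : 0 < n%:R :> R by rewrite ltr0n.
have nS : n.+1%:R = n%:R + 1 :> R by rewrite natr1.
have iv : 0 <= n%:R^-1 :> R by rewrite invr_ge0 ltW.
have e : ln (n%:R + 1 : R) = ln n%:R + ln (1 + n%:R^-1).
  have p1 : 0 < 1 + n%:R^-1 :> R by apply: lt_le_trans ltr01 _; rewrite lerDl.
  rewrite -lnM ?posrE//.
  by congr ln; field; rewrite lt0r_neq0.
have -> : stirling_err n - stirling_err n.+1 =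
    (n%:R + 2^-1) * ln (1 + n%:R^-1) - 1.
  rewrite /stirling_err factS natrM lnM ?posrE ?ltr0n ?fact_gt0// nS e; ring.
have := ln1D_ge iv; have := ln1D_le iv; rewrite nS.
set x := n%:R in nR *; set L := ln _ => h1 h2; apply/andP; split.
- have := ler_wpM2l (ltW nR) h2; rewrite mulrCA divff ?lt0r_neq0// mulr1.
  have -> : x * ((2 + x^-1) * L) = (2 * x + 1) * L by field; rewrite lt0r_neq0.
  lra.
- have xx : 0 < x ^+ 2 by rewrite exprn_gt0.
  have := ler_wpM2l (ltW xx) h1.
  have -> : x ^+ 2 * (2 * (1 + x^-1) * L) = 2 * x * (x + 1) * L.
    by field; rewrite lt0r_neq0.
  have -> : x ^+ 2 * (x^-1 * (2 + x^-1)) = 2 * x + 1 by field; rewrite lt0r_neq0.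
  have -> : (4 * x)^-1 - (4 * (x + 1))^-1 = (4 * x * (x + 1))^-1.
    by field; rewrite !lt0r_neq0; lra.
  move=> h; have x1 : 0 < 4 * x * (x + 1) by rewrite !mulr_gt0//; lra.
  rewrite -[leRHS]mul1r ler_pdivlMr//.
  have : 0 <= (2 * x + 1) * ((2 * x + 1) - 2 * x * (x + 1) * L).
    by rewrite mulr_ge0//; lra.
  nra.
Qed.

Lemma stirling_err_cvg : cvgn stirling_err.
Proof.
suff /cvg_ex[l] : cvgn (fun n => stirling_err n.+1).
  by rewrite cvg_shiftS => h; apply/cvg_ex; exists l.
apply: nonincreasing_is_cvgn.
  apply/nonincreasing_seqP => n.
  by rewrite -subr_ge0; case/andP: (@stirling_err_step n.+1 isT).
exists (stirling_err 1 - 4^-1) => _ [n _ <-].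
suff : stirling_err 1 - 4^-1 <= stirling_err n.+1 - (4 * n.+1%:R)^-1.
  move=> h; apply: le_trans h _; rewrite lerBlDr lerDl invr_ge0.
  by rewrite mulr_ge0 ?ler0n.
elim: n => [|n IH]; first by rewrite mulr1.
apply: le_trans IH _.
case/andP: (@stirling_err_step n.+1 isT) => _.
by move: (4 * n.+1%:R)^-1 (4 * n.+2%:R)^-1 (stirling_err _) (stirling_err _) => *; lra.
Qed.

(** The powers of [T] and [e] match exactly; the factor [sqrt 2] is [(2T)^(1/2) / T^(1/2)]. *)
Lemma double_fact_ratio T : (0 < T)%N ->
  (T.*2)`!%:R / (2 ^+ T * T`!%:R) / (Num.sqrt 2 * (2 * T%:R / expR 1) ^+ T)
  = expR (stirling_err T.*2 - stirling_err T).
Proof.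
move=> T0; have tR : 0 < T%:R :> R by rewrite ltr0n.
have f0 k : 0 < k`!%:R :> R by rewrite ltr0n fact_gt0.
apply: ln_inj; rewrite ?posrE ?expR_gt0//.
  by rewrite !(divr_gt0, mulr_gt0, exprn_gt0, sqrtr_gt0, expR_gt0).
have p2 : 0 < 2 :> R by [].
rewrite expRK !ln_div ?posrE ?(divr_gt0, mulr_gt0, exprn_gt0, sqrtr_gt0, expR_gt0)//.
rewrite !lnM ?posrE ?(divr_gt0, mulr_gt0, exprn_gt0, sqrtr_gt0, expR_gt0)//.
have lnXT x : 0 < x -> ln (x ^+ T) = T%:R * ln x :> R.
  by move=> x0; rewrite lnXn// mulr_natl.
rewrite !lnXT ?(divr_gt0, mulr_gt0, expR_gt0)//.
rewrite ln_div ?posrE ?(mulr_gt0, expR_gt0)// lnM ?posrE// expRK.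
have -> : ln (Num.sqrt 2) = 2^-1 * ln 2 :> R.
  have : ln (Num.sqrt 2 ^+ 2) = ln 2 :> R by rewrite sqr_sqrtr.
  by rewrite lnXn ?sqrtr_gt0// mulr2n; lra.
have e2 : T.*2%:R = 2 * T%:R :> R by rewrite -mul2n natrM.
by rewrite /stirling_err e2 lnM ?posrE//; field.
Qed.

Lemma double_fact_asymp :
  (T.*2)`!%:R / (2 ^+ T * T`!%:R) / (Num.sqrt 2 * (2 * T%:R / expR 1) ^+ T)
  @[T --> \oo] --> (1 : R).
Proof.
have /cvg_ex[l dl] := stirling_err_cvg.
have dl2 : stirling_err T.*2 @[T --> \oo] --> l.
  apply: cvg_comp dl; apply/cvgnyPge => A; near=> T.
  rewrite (@leq_trans T)//; last by rewrite -addnn leq_addr.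
  by near: T; exact: nbhs_infty_ge.
have : expR (stirling_err T.*2 - stirling_err T) @[T --> \oo] --> expR (l - l).
  by apply: continuous_cvg; [exact: continuous_expR|exact: cvgB].
rewrite subrr expR0; apply: cvg_trans; apply: near_eq_cvg; near=> T.
by rewrite double_fact_ratio//; near: T; exact: nbhs_infty_gt.
Unshelve. all: by end_near. Qed.

End Stirling.

Section TraceRatio.
Variables (R : realType) (rho : R) (M : nat -> R).
Hypothesis rho_gt0 : 0 < rho.
Hypothesis M0 : M 0 = 1.
Hypothesis MS : forall t, M t.+1 = t.*2.+1%:R * rho ^+ 2 * M t.

Lemma even_momentE t : M t = rho ^+ t.*2 * ((t.*2)`!%:R / (2 ^+ t * t`!%:R)).
Proof.
elim: t => [|t IH]; first by rewrite M0 double0 fact0 !expr0; field.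
rewrite MS IH doubleS !factS !natrM !exprS.
have -> : (t.*2.+2)%:R = 2 * t.+1%:R :> R by rewrite -natrM; congr _%:R; lia.
by field; rewrite pnatr_eq0 -lt0n fact_gt0 expf_neq0// nat1r pnatr_eq0.
Qed.

Lemma even_moment_gt0 t : 0 < M t.
Proof.
elim: t => [|t IH]; first by rewrite M0.
by rewrite MS !mulr_gt0 ?exprn_gt0 ?ltr0n.
Qed.

(** The normalized sum satisfies [s (T + 1) = 1 + s T / ((2T + 1) rho^2)]. Hence it is bounded, and
    feeding the bound back into the recursion gives the limit 1. *)
Lemma even_moment_sum_asymp :
  (\sum_(i < T.+1) M i) / M T @[T --> \oo] --> (1 : R).
Proof.
pose s T := (\sum_(i < T.+1) M i) / M T.
have r2 : 0 < rho ^+ 2 by rewrite exprn_gt0.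
have sS T : s T.+1 = 1 + s T / (T.*2.+1%:R * rho ^+ 2).
  rewrite /s big_ord_recr/= mulrDl divff ?lt0r_neq0 ?even_moment_gt0// addrC MS.
  congr (_ + _); field.
  by rewrite !lt0r_neq0 ?even_moment_gt0// addrC natr1 ltr0n.
have s0 T : 0 <= s T.
  by rewrite divr_ge0 ?(ltW (even_moment_gt0 _))// sumr_ge0// => i _; rewrite ltW// even_moment_gt0.
have [N hN] : exists N, forall T, (N <= T)%N -> 2 <= T.*2.+1%:R * rho ^+ 2.
  exists (truncn (2 / rho ^+ 2)).+1 => T NT.
  rewrite -ler_pdivrMr//; apply: (@le_trans _ _ (truncn (2 / rho ^+ 2)).+1%:R).
    by apply: ltW; rewrite truncnS_gt.
  by rewrite ler_nat; lia.
(* Once the divisor is at least 2, [x <= K] implies [1 + x / 2 <= K], because [K >= 2]. *)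
pose K := s N + 2.
have sK k : s (N + k)%N <= K.
  elim: k => [|k IH]; first by rewrite addn0 lerDl.
  rewrite addnS sS; have h := hN (N + k)%N (leq_addr _ _).
  have : s (N + k)%N / ((N + k).*2.+1%:R * rho ^+ 2) <= K / 2.
    apply: ler_pM => //; first by rewrite invr_ge0; lra.
    by rewrite lef_pV2 ?posrE//; lra.
  by rewrite /K; have := s0 N; move: (s N) (s (N + k)%N / _) => a b; lra.
rewrite -(cvg_shiftS s) /=.
have c1 : 1 + (K / rho ^+ 2) * T.+1%:R^-1 @[T --> \oo] --> (1 : R).
  rewrite -[X in _ --> X]addr0; apply: cvgD; first exact: cvg_cst.
  by rewrite -[X in _ --> X](mulr0 (K / rho ^+ 2)); apply: cvgM; [exact: cvg_cst|exact: cvg_harmonic].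
apply: (squeeze_cvgr _ (cvg_cst (1 : R)) c1).
near=> T; rewrite sS; have NT : (N <= T)%N by near: T; exact: nbhs_infty_ge.
have := sK (T - N)%N; rewrite subnKC// => sT.
have T1 : 0 < T.+1%:R :> R by rewrite ltr0n.
have T2 : 0 < T.*2.+1%:R :> R by rewrite ltr0n.
apply/andP; split; first by rewrite lerDl divr_ge0 ?s0// ltW// mulr_gt0.
rewrite lerD2l -mulrA -invfM; apply: ler_pM => //.
  by rewrite invr_ge0 ltW// mulr_gt0.
rewrite lef_pV2 ?posrE ?mulr_gt0// mulrC ler_wpM2r ?(ltW r2)//.
by rewrite ler_nat; lia.
Unshelve. all: by end_near. Qed.

End TraceRatio.

(** * Sums of squared Hermite coefficients *)

Section RowWeights.
Variable R : realType.

Let fneq k : k`!%:R != 0 :> R.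
Proof. by rewrite pnatr_eq0 -lt0n fact_gt0. Qed.

Lemma geometric_sum (z : R) U : z != 1 -> \sum_(u < U) z ^+ u = (1 - z ^+ U) / (1 - z).
Proof.
move=> z1; have z0 : 1 - z != 0 by rewrite subr_eq0 eq_sym.
by apply: (mulfI z0); rewrite mulrCA divff// mulr1 -(opprB _ 1) mulNr -subrX1 opprB.
Qed.

Lemma sum_parity_reindex (g : nat -> R) T :
  \sum_(n < T.+1 | odd n == odd T) g n = \sum_(u < T./2.+1) g (T - u.*2)%N.
Proof.
move: {2}T (leqnn T) => N; elim: N T => [|N IH] [|[|T]] //.
- by move=> _; rewrite !big_mkcond !big_ord_recl !big_ord0.
- by move=> _; rewrite !big_mkcond !big_ord_recl !big_ord0.
- by move=> _; rewrite !big_mkcond !big_ord_recl !big_ord0 /= add0r addr0.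
move=> leTN; rewrite big_mkcond big_ord_recr big_ord_recr /= negbK eqxx.
rewrite -[if _ == _ then g T.+1 else 0]/(if _ then _ else _).
have -> : (~~ odd T == odd T) = false by case: (odd T).
rewrite addr0 [RHS]big_ord_recl /= subn0 addrC; congr (_ + _).
rewrite -big_mkcond /= IH; last by lia.
by apply: eq_bigr => u _; rewrite /bump /= add1n doubleS.
Qed.

(** The full geometric series in the squared ratio bound of [habs_sq_step_le]. That bound is below 1
    only for [j > 1]; the other two columns get a crude polynomial value, harmless because they are
    far from the peak. *)
Definition upper_weight T j : R := if (1 < j)%N then
  (1 - (1 - j.-1%:R / T.-1%:R) ^+ 2)^-1 else T.+1%:R ^+ 2.

Lemma upper_weight_ge0 T j : (j <= T)%N -> 0 <= upper_weight T j.
Proof.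
move=> jT; rewrite /upper_weight; case: ifPn => [j1|_]; last by rewrite exprn_ge0.
have T1 : 0 < T.-1%:R :> R by rewrite ltr0n; lia.
have r0 : 0 <= 1 - j.-1%:R / T.-1%:R :> R.
  by rewrite subr_ge0 ler_pdivrMr// mul1r ler_nat; lia.
rewrite invr_ge0 subr_ge0 exprn_ile1// lerBlDr lerDl divr_ge0//; lia.
Qed.

Lemma upper_weight_le T j : (j <= T)%N -> upper_weight T j <= T.+1%:R ^+ 2.
Proof.
move=> jT; rewrite /upper_weight; case: ifPn => [j1|_] //.
have T1 : 0 < T.-1%:R :> R by rewrite ltr0n; lia.
have r0 : 0 <= 1 - j.-1%:R / T.-1%:R :> R.
  by rewrite subr_ge0 ler_pdivrMr// mul1r ler_nat; lia.
have a1 : T.-1%:R^-1 <= j.-1%:R / T.-1%:R :> R.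
  by rewrite -[leLHS]mul1r ler_wpM2r ?invr_ge0 ?(ltW T1)// ler1n; lia.
apply: (@le_trans _ _ (T.-1%:R)); last by rewrite -natrX ler_nat; nia.
have b0 : 0 < T.-1%:R^-1 :> R by rewrite invr_gt0.
have key : T.-1%:R^-1 <= 1 - (1 - j.-1%:R / T.-1%:R) ^+ 2 :> R.
  move: (T.-1%:R^-1) (j.-1%:R / T.-1%:R) r0 a1 b0 => b a r0 a1 b0.
  have : 0 <= a * (1 - a) by rewrite mulr_ge0//; lra.
  by rewrite expr2; lra.
by rewrite -[leRHS]invrK lef_pV2// posrE (lt_le_trans b0).
Qed.

(** The falling factorial [T (T - 1) ... (T - j + 1)] divided by [T^j]. *)
Definition ffrac T j : R := \prod_(i < j) (1 - i%:R / T%:R).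

Lemma ffracE T j : (j <= T)%N -> (0 < T)%N ->
  ffrac T j = T`!%:R / ((T - j)`!%:R * T%:R ^+ j).
Proof.
move=> jT T0; have TR : T%:R != 0 :> R by rewrite pnatr_eq0 -lt0n.
elim: j jT => [|j IH] jT.
  by rewrite /ffrac big_ord0 subn0 expr0 mulr1 divff.
rewrite /ffrac big_ord_recr /= -/(ffrac T j) IH; last by lia.
have -> : (T - j = (T - j.+1).+1)%N by lia.
have d : 1 - j%:R / T%:R = (T - j.+1).+1%:R / T%:R :> R.
  have -> : ((T - j.+1).+1 = T - j)%N by lia.
  by rewrite natrB ?mulrBl ?divff//; lia.
rewrite d factS natrM exprS; field.
by rewrite TR fneq expf_neq0// nat1r pnatr_eq0.
Qed.

Lemma ffrac_bounds T j : (j <= T)%N -> 0 <= ffrac T j <= 1.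
Proof.
move=> jT; have h (i : 'I_j) : 0 <= (1 - i%:R / T%:R : R) <= 1.
  have iT : i%:R <= T%:R :> R by rewrite ler_nat; have := ltn_ord i; lia.
  have T0 : 0 < T%:R :> R by rewrite ltr0n; have := ltn_ord i; lia.
  by rewrite subr_ge0 ler_pdivrMr// mul1r iT /= lerBlDr lerDl divr_ge0// ltW.
rewrite prodr_ge0 => [/=|i _]; last by case/andP: (h i).
by apply: prodr_ile1 => i _; exact: h.
Qed.

End RowWeights.

(** * Ratios of Hermite coefficients along a column *)

Section HermiteSums.
Variables (R : realType) (rho : R).
Hypothesis rho_gt0 : 0 < rho.
Local Notation habs := (habs rho).

Lemma habs_ge0 n j : 0 <= habs n j.
Proof.
rewrite /habs; case: ifP => // _.
by rewrite divr_ge0// !mulr_ge0// ?exprn_ge0// ltW.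
Qed.

Lemma habs_neq0 n j : habs n j != 0 -> (j <= n)%N && (odd j == odd n).
Proof. by rewrite /habs; case: ifP => [|_]; [lia|rewrite eqxx]. Qed.

Let fneq k : k`!%:R != 0 :> R.
Proof. by rewrite pnatr_eq0 -lt0n fact_gt0. Qed.

Lemma habs_sqE j m : habs (j + m.*2) j ^+ 2 =
  (j + m.*2)`!%:R / (m`!%:R ^+ 2 * j`!%:R ^+ 2 * 4 ^+ m * rho ^+ j.*2).
Proof.
rewrite /habs leq_addr /= addKn odd_double /= doubleK.
rewrite expr_div_n sqr_sqrtr// !exprMn -!exprM -[4]/(2 * 2)%:R natrM exprMn.
by rewrite !muln2 -addnn exprD.
Qed.

(** The squared ratio of consecutive rows, cross-multiplied so that it also holds when both entries
    vanish or when only [habs k j] does; in the latter case the truncated difference [k.+2 - j] is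
    0. *)
Lemma habs_sqSS k j : habs k j ^+ 2 * (k.+2%:R * k.+1%:R) =
  habs k.+2 j ^+ 2 * (k.+2 - j)%:R ^+ 2.
Proof.
case: (boolP (odd j == odd k)) => ojk; last first.
  have h n : odd j != odd n -> habs n j = 0.
    by move=> o; apply/eqP/negPn/negP => /habs_neq0; lia.
  by rewrite !h ?expr0n/= ?mul0r//; lia.
case: (leqP j k) => jk; last first.
  have -> : habs k j = 0 by apply/eqP/negPn/negP => /habs_neq0; lia.
  have -> : (k.+2 - j = 0)%N by lia.
  by rewrite !expr0n /= mul0r mulr0.
have ek : k = (j + (k - j)./2.*2)%N by lia.
set m := (k - j)./2 in ek; rewrite ek.
have -> : (j + m.*2).+2 = (j + m.+1.*2)%N by lia.
rewrite !habs_sqE.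
have -> : (j + m.+1.*2 - j)%:R = 2 * m.+1%:R :> R by rewrite -natrM; congr _%:R; lia.
have -> : (j + m.+1.*2 = (j + m.*2).+2)%N by lia.
rewrite !factS !natrM (exprS 4); field.
rewrite !fneq nat1r pnatr_eq0 !expf_neq0//; exact: lt0r_neq0.
Qed.

(** Replacing [(k + 2)(k + 1)] by [(k + 1)^2] bounds the ratio by [(k + 2 - j) / (k + 1) = 1 - (j -
    1) / (k + 1)], which increases with [k]; hence the shifts by one in [j - 1] and [T - 1]. *)
Lemma habs_sq_step_le T k j : (1 < j)%N -> (k.+2 <= T)%N ->
  habs k j ^+ 2 <= (1 - j.-1%:R / T.-1%:R) ^+ 2 * habs k.+2 j ^+ 2.
Proof.
move=> j2 kT; case: (leqP j k) => jk; last first.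
  have -> : habs k j = 0 by apply/eqP/negPn/negP => /habs_neq0; lia.
  by rewrite expr0n /= mulr_ge0 ?sqr_ge0.
have k1 : 0 < k.+1%:R :> R by rewrite ltr0n.
have T1 : 0 < T.-1%:R :> R by rewrite ltr0n; lia.
have kk : 0 < k.+2%:R * k.+1%:R :> R by rewrite mulr_gt0 ?ltr0n.
rewrite -(ler_pM2r kk) habs_sqSS [leRHS]mulrAC [leRHS]mulrC ler_wpM2l ?sqr_ge0//.
have h : (k.+2 - j)%:R / k.+1%:R <= 1 - j.-1%:R / T.-1%:R :> R.
  have -> : (k.+2 - j)%:R = k.+1%:R - j.-1%:R :> R.
    by rewrite -natrB; [congr _%:R|]; lia.
  rewrite mulrBl divff ?lt0r_neq0// lerD2l lerN2 ler_wpM2l//.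
  by rewrite lef_pV2 ?posrE// ler_nat; lia.
apply: (@le_trans _ _ (((k.+2 - j)%:R / k.+1%:R) ^+ 2 * (k.+2%:R * k.+1%:R))).
  rewrite expr_div_n -mulrA ler_peMr ?sqr_ge0//.
  by rewrite ler_pdivlMl ?exprn_gt0// mulr1 expr2 ler_wpM2r ?(ltW k1)// ler_nat.
by rewrite ler_wpM2r ?(ltW kk)// ler_sqr ?nnegrE//; last exact: le_trans h.
Qed.

(** Serves [j <= 1]. At [j = 0] the squared ratio is [(k + 2) / (k + 1)], so rows can decrease with
    the degree; in this form the loss telescopes to a factor at most [T + 1]. *)
Lemma habs_sq_step_poly k j : k.+1%:R * habs k j ^+ 2 <= k.+3%:R * habs k.+2 j ^+ 2.
Proof.
have kk : 0 < k.+2%:R :> R by rewrite ltr0n.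
rewrite -(ler_pM2r kk).
have -> : k.+1%:R * habs k j ^+ 2 * k.+2%:R = habs k.+2 j ^+ 2 * (k.+2 - j)%:R ^+ 2.
  by rewrite -habs_sqSS; ring.
rewrite [leRHS]mulrAC [leRHS]mulrC ler_wpM2l ?sqr_ge0//.
by rewrite -natrX -natrM ler_nat; nia.
Qed.

(** In the opposite direction [(k + 2)(k + 1)] is replaced by [(k + 2)^2], and [V] stands for the
    lowest degree in use. The maximum with 0 keeps the ratio nonnegative for [j > V], so that it can
    be raised to powers. *)
Lemma habs_step_ge V k j : (0 < V)%N -> (V <= k.+2)%N ->
  maxr 0 (1 - j%:R / V%:R) * habs k.+2 j <= habs k j.
Proof.
move=> V0 Vk; case: (leqP j k.+2) => jk; last first.
  have -> : habs k.+2 j = 0 by apply/eqP/negPn/negP => /habs_neq0; lia.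
  by rewrite mulr0 habs_ge0.
have k1 : 0 < k.+1%:R :> R by rewrite ltr0n.
have k2 : 0 < k.+2%:R :> R by rewrite ltr0n.
have VR : 0 < V%:R :> R by rewrite ltr0n.
have h : maxr 0 (1 - j%:R / V%:R) <= (k.+2 - j)%:R / k.+2%:R :> R.
  rewrite ge_max divr_ge0//= natrB// mulrBl divff ?lt0r_neq0// lerD2l lerN2.
  by rewrite ler_wpM2l// lef_pV2 ?posrE// ler_nat.
apply: (@le_trans _ _ ((k.+2 - j)%:R / k.+2%:R * habs k.+2 j)).
  by rewrite ler_wpM2r// habs_ge0.
rewrite -(@ler_pXn2r _ 2)// ?nnegrE ?mulr_ge0 ?divr_ge0 ?habs_ge0//.
rewrite exprMn -(ler_pM2r (mulr_gt0 k2 k1)) habs_sqSS expr_div_n.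
have k12 : k.+1%:R <= k.+2%:R :> R by rewrite ler_nat.
move: (k.+2 - j)%:R (habs k.+2 j) k.+2%:R k.+1%:R k1 k2 k12 => a h2 K2 K1 K1p K2p K12.
rewrite (_ : _ * _ * (_ * _) = h2 ^+ 2 * a ^+ 2 * (K1 / K2)); last first.
  by field; rewrite lt0r_neq0.
apply: ler_piMr; first exact: mulr_ge0 (sqr_ge0 _) (sqr_ge0 _).
by rewrite ler_pdivrMr// mul1r.
Qed.

Lemma habs_sq_le_ratio T j u : (1 < j)%N -> (u.*2 <= T)%N ->
  habs (T - u.*2) j ^+ 2 <= (1 - j.-1%:R / T.-1%:R) ^+ u.*2 * habs T j ^+ 2.
Proof.
move=> j1; elim: u => [|u IH] uT; first by rewrite subn0 expr0 mul1r.
have := IH (leq_trans (leqnSn _) (ltnW uT)).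
have e : (T - u.*2 = (T - u.+1.*2).+2)%N by lia.
have kT : ((T - u.+1.*2).+2 <= T)%N by lia.
have h := habs_sq_step_le j1 kT; rewrite -e in h.
move=> h2; apply: le_trans h _; rewrite (_ : u.+1.*2 = 2 + u.*2)%N; last by lia.
rewrite (exprD _ 2) -mulrA.
by rewrite ler_wpM2l// sqr_ge0.
Qed.

Lemma habs_sq_le_poly T j u : (u.*2 <= T)%N ->
  habs (T - u.*2) j ^+ 2 <= T.+1%:R * habs T j ^+ 2.
Proof.
move=> uT; apply: (@le_trans _ _ ((T - u.*2).+1%:R * habs (T - u.*2) j ^+ 2)).
  by rewrite ler_peMl ?sqr_ge0// ler1n.
elim: u uT => [|u IH] uT; first by rewrite subn0.
apply: le_trans (IH (leq_trans (leqnSn _) (ltnW uT))).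
have -> : (T - u.*2 = (T - u.+1.*2).+2)%N by lia.
exact: habs_sq_step_poly.
Qed.

Lemma habs_sq_column T j : (j <= T)%N ->
  \sum_(n < T.+1 | odd n == odd T) habs n j ^+ 2 <=
  upper_weight R T j * habs T j ^+ 2.
Proof.
move=> jT; rewrite (sum_parity_reindex (fun n => habs n j ^+ 2)) /upper_weight.
case: ifPn => j1; last first.
  apply: (@le_trans _ _ (\sum_(u < T./2.+1) T.+1%:R * habs T j ^+ 2)).
    by apply: ler_sum => u _; apply: habs_sq_le_poly; have := ltn_ord u; lia.
  rewrite sumr_const card_ord -(mulr_natl (T.+1%:R * habs T j ^+ 2)) mulrA ler_wpM2r ?sqr_ge0//.
  by rewrite expr2 ler_wpM2r// ler_nat; lia.
set r := 1 - j.-1%:R / T.-1%:R.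
have T1 : 0 < T.-1%:R :> R by rewrite ltr0n; lia.
have r0 : 0 <= r by rewrite subr_ge0 ler_pdivrMr// mul1r ler_nat; lia.
have r1 : r < 1 by rewrite gtrBl divr_gt0// ltr0n; lia.
apply: (@le_trans _ _ (\sum_(u < T./2.+1) (r ^+ 2) ^+ u * habs T j ^+ 2)).
  apply: ler_sum => u _; rewrite -exprM mul2n; apply: habs_sq_le_ratio => //.
  by have := ltn_ord u; lia.
rewrite -mulr_suml ler_wpM2r ?sqr_ge0//.
have r2 : 0 < 1 - r ^+ 2 by rewrite subr_gt0 expr_lt1.
rewrite geometric_sum; last by rewrite lt_eqF// -subr_gt0.
rewrite -[leRHS]mul1r ler_wpM2r ?invr_ge0 ?(ltW r2)// lerBlDr lerDl.
by rewrite exprn_ge0// sqr_ge0.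
Qed.

Lemma habs_ge_ratio T V j u : (0 < V)%N -> (V + u.*2 <= T)%N ->
  maxr 0 (1 - j%:R / V%:R) ^+ u * habs T j <= habs (T - u.*2) j.
Proof.
move=> V0; elim: u => [|u IH] uT; first by rewrite subn0 expr0 mul1r.
have r0 : 0 <= maxr 0 (1 - j%:R / V%:R) :> R by rewrite le_max lexx.
have e : (T - u.*2 = (T - u.+1.*2).+2)%N by lia.
apply: (@le_trans _ _ (maxr 0 (1 - j%:R / V%:R) * habs (T - u.*2) j)).
  by rewrite exprS -mulrA ler_wpM2l// IH; lia.
by rewrite e; apply: habs_step_ge => //; lia.
Qed.

(** Multiply and divide by [(T - j)!], [(2j)!] and [T^j]. All the rapid variation in [j] goes into
    the term of the exponential series; the three remaining factors vary slowly. *)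
Lemma habs_sq_weight T j : (j <= T)%N -> odd j == odd T -> (0 < T)%N ->
  habs T j ^+ 2 = (2 * Num.sqrt T%:R / rho) ^+ j.*2 / (j.*2)`!%:R *
    (ffrac R T j * cbin (T - j)./2 * cbin j).
Proof.
move=> jT oj T0; have TR : T%:R != 0 :> R by rewrite pnatr_eq0 -lt0n.
have eT : T = (j + (T - j)./2.*2)%N by lia.
rewrite ffracE//.
have -> : habs T j = habs (j + (T - j)./2.*2) j by rewrite -eT.
rewrite habs_sqE /cbin -eT.
have -> : (T - j)./2.*2 = (T - j)%N by lia.
have -> : (2 * Num.sqrt T%:R / rho) ^+ j.*2 = 4 ^+ j * T%:R ^+ j / rho ^+ j.*2.
  rewrite expr_div_n exprMn -!mul2n !exprM sqr_sqrtr//.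
  by rewrite expr2 -natrM.
field.
by rewrite !fneq !expf_neq0// lt0r_neq0.
Qed.

End HermiteSums.

(** * Concentration of Poisson-type weights *)

Section Chernoff.
Variable R : realType.
Implicit Types (y s : R).

Lemma expR_psum_le y N : 0 <= y -> \sum_(k < N) y ^+ k / k`!%:R <= expR y.
Proof.
move=> y0; have c := is_cvg_series_exp_coeff y.
have -> : \sum_(k < N) y ^+ k / k`!%:R = series (exp_coeff y) N.
  by rewrite /series /= big_mkord.
apply: nondecreasing_cvgn_le => //.
apply/nondecreasing_seqP => n; rewrite /series /= big_nat_recr//= lerDl.
by rewrite /exp_coeff /= divr_ge0// exprn_ge0.
Qed.

(* Chernoff bound for both tails of the Poisson weights: [s > 0] is the upper
   tail [k >= y e^s], [s < 0] the lower one. *)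
Lemma exp_tail_le y s N : 0 <= y ->
  \sum_(k < N | 0 <= s * (k%:R - expR s * y)) y ^+ k / k`!%:R <=
  expR (y * (expR s * (1 - s))).
Proof.
move=> y0; have es := expR_gt0 s.
pose b k := expR (- s * (expR s * y)) * ((expR s * y) ^+ k / k`!%:R).
apply: (@le_trans _ _ (\sum_(k < N) b k)).
  rewrite [leLHS]big_mkcond; apply: ler_sum => k _.
  have b0 : 0 <= b k by rewrite mulr_ge0 ?expR_ge0// divr_ge0// exprn_ge0// mulr_ge0// ltW.
  case: ifP => // h.
  rewrite /b mulrA ler_wpM2r// exprMn mulrA -[leLHS]mul1r ler_wpM2r ?exprn_ge0//.
  rewrite -expRM_natl -expRD -[leLHS]expR0 ler_expR.
  by move: h; rewrite mulrBr; lra.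
rewrite -mulr_sumr; have ey : 0 <= expR s * y by rewrite mulr_ge0// ltW.
apply: le_trans (ler_wpM2l (expR_ge0 _) (expR_psum_le N ey)) _.
rewrite -expRD ler_expR le_eqVlt; apply/orP; left; apply/eqP; ring.
Qed.

(** This is [expR (- s) > 1 - s]. It makes both tails of [exp_tail_le] exponentially smaller than
    the total [expR y]. *)
Lemma chernoff_rate_lt1 s : s != 0 -> expR s * (1 - s) < 1.
Proof.
move=> s0; have := @expR_gt1Dx R (- s); rewrite oppr_eq0 => /(_ s0).
by rewrite expRN => h; rewrite mulrC -ltr_pdivlMr ?expR_gt0// mul1r.
Qed.

(** The even terms of the series of [expR y]: up to normalization, Poisson weights at [k = 2j],
    which concentrate at [2j ~ y]. *)
Definition evw y j : R := y ^+ j.*2 / (j.*2)`!%:R.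

Lemma evw_ge0 y j : 0 <= evw y j.
Proof. by rewrite /evw divr_ge0// -mul2n exprM exprn_ge0// sqr_ge0. Qed.

Lemma sum_evw_le (P : pred nat) (Q : pred nat) y N : 0 <= y ->
  (forall j, P j -> Q j.*2) ->
  \sum_(j < N | P j) evw y j <= \sum_(k < N.*2 | Q k) y ^+ k / k`!%:R.
Proof.
move=> y0 PQ.
have t0 k : 0 <= y ^+ k / k`!%:R by rewrite divr_ge0// exprn_ge0.
elim: N => [|N IH]; first by rewrite !big_ord0.
rewrite doubleS; rewrite big_mkcond big_ord_recr /= -big_mkcond.
rewrite [leRHS]big_mkcond 2!big_ord_recr /= -big_mkcond -addrA lerD//.
case: ifP => [/PQ ->|_]; first by rewrite lerDl; case: ifP.
by rewrite addr_ge0//; case: ifP.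
Qed.

(** A roots-of-unity filter modulo 4 on the exponential series: the arguments [y] and [- y] give the
    exponentials, the two imaginary ones give [cos y]. *)
Lemma evw_parity_cvg y b :
  \sum_(j < N | odd j == b) evw y j @[N --> \oo] -->
  ((expR y + expR (- y)) / 4 + (-1) ^+ b * cos y / 2).
Proof.
have c1 : \sum_(k < N.*2) (y ^+ k / k`!%:R) @[N --> \oo] --> expR y.
  have h : series (exp_coeff y) @ \oo --> expR y by exact: is_cvg_series_exp_coeff.
  have d : N.*2 @[N --> \oo] --> \oo.
    apply/cvgnyPge => A; near=> T.
    rewrite (@leq_trans T)//; last by rewrite -addnn leq_addr.
    by near: T; exact: nbhs_infty_ge.
  have := cvg_comp _ _ d h; rewrite /comp /series /=.
  by under eq_fun do rewrite big_mkord.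
have c2 : \sum_(k < N.*2) ((- y) ^+ k / k`!%:R) @[N --> \oo] --> expR (- y).
  have h : series (exp_coeff (- y)) @ \oo --> expR (- y) by exact: is_cvg_series_exp_coeff.
  have d : N.*2 @[N --> \oo] --> \oo.
    apply/cvgnyPge => A; near=> T.
    rewrite (@leq_trans T)//; last by rewrite -addnn leq_addr.
    by near: T; exact: nbhs_infty_ge.
  have := cvg_comp _ _ d h; rewrite /comp /series /=.
  by under eq_fun do rewrite big_mkord.
have c3 : \sum_(j < N) (-1) ^+ j * evw y j @[N --> \oo] --> cos y.
  have := @cvg_cos_coeff' R y; rewrite /series /=.
  under eq_fun do rewrite big_mkord.
  by under eq_fun do under eq_bigr do rewrite /cos_coeff' -exprnP -mulrA.
have e N : \sum_(j < N | odd j == b) evw y j =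
  (\sum_(k < N.*2) (y ^+ k / k`!%:R) + \sum_(k < N.*2) ((- y) ^+ k / k`!%:R)) / 4
  + (-1) ^+ b * (\sum_(j < N) (-1) ^+ j * evw y j) / 2.
  elim: N => [|N IH]; first by rewrite !big_ord0; field.
  rewrite doubleS [LHS]big_mkcond !big_ord_recr /= -big_mkcond IH.
  have -> : (- y) ^+ N.*2 = y ^+ N.*2 by rewrite -mul2n !exprM sqrrN.
  have -> : (- y) ^+ N.*2.+1 = - y ^+ N.*2.+1.
    by rewrite !exprS -mul2n !exprM sqrrN mulNr.
  rewrite -/(evw y N) -(signr_odd _ N).
  by case: (odd N); case: b {IH}; rewrite /= ?expr0 ?expr1; field.
under eq_fun do rewrite e.
apply: cvgD.
  by apply: cvgM; [exact: cvgD|exact: cvg_cst].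
apply: cvgM; last exact: cvg_cst.
by apply: cvgM; [exact: cvg_cst|exact: c3].
Unshelve. all: by end_near. Qed.

Lemma evw_parity_le y b N :
  \sum_(j < N | odd j == b) evw y j <= (expR y + expR (- y)) / 4 + 2^-1.
Proof.
have c := @evw_parity_cvg y b.
have nd : nondecreasing_seq (fun N => \sum_(j < N | odd j == b) evw y j).
  apply/nondecreasing_seqP => n; rewrite [leRHS]big_mkcond big_ord_recr /= -big_mkcond.
  by rewrite lerDl; case: ifP => // _; exact: evw_ge0.
have := nondecreasing_cvgn_le nd (cvgP _ c) N.
rewrite (cvg_lim _ c)// => h; apply: le_trans h _; rewrite lerD2l.
have := cos_le1 y; have := cos_geN1 y.
by case: b {c nd}; rewrite ?expr0 ?expr1; lra.
Qed.

(** The terms with [j >= M] add up to at most 1: at [s = 1] the Chernoff exponent is 0. *)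
Lemma evw_parity_ge y b M : 0 <= y -> expR 1 * y <= M.*2%:R ->
  (expR y + expR (- y)) / 4 - 2^-1 - 1 <= \sum_(j < M | odd j == b) evw y j.
Proof.
move=> y0 yM; have c := @evw_parity_cvg y b.
have key N : \sum_(j < N | odd j == b) evw y j <=
    \sum_(j < M | odd j == b) evw y j + 1.
  apply: (@le_trans _ _ (\sum_(j < M | odd j == b) evw y j +
     \sum_(j < N | (M <= j)%N) evw y j)).
    have -> : \sum_(j < M | odd j == b) evw y j =
       \sum_(j < maxn M N | (odd j == b) && (j < M)%N) evw y j.
      by rewrite (big_ord_widen_cond _ (fun j => odd j == b) (fun j => evw y j) (leq_maxl M N)).
    have -> : \sum_(j < N | (M <= j)%N) evw y j =
       \sum_(j < maxn M N | (M <= j)%N && (j < N)%N) evw y j.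
      by rewrite (big_ord_widen_cond _ (fun j => M <= j)%N (fun j => evw y j) (leq_maxr M N)).
    rewrite (big_ord_widen_cond _ (fun j => odd j == b) (fun j => evw y j) (leq_maxr M N)).
    rewrite big_mkcond [X in _ <= X + _]big_mkcond [X in _ <= _ + X]big_mkcond -big_split.
    apply: ler_sum => j _ /=; have := evw_ge0 y j.
    by case: (odd j == b); case: (ltnP j M); case: (ltnP j N); rewrite /= ?addr0 ?add0r //; lra.
  rewrite lerD2l.
  have := @sum_evw_le (fun j => M <= j)%N (fun k => 0 <= 1 * (k%:R - expR 1 * y)) y N y0.
  move=> h; apply: le_trans (h _) _.
    move=> j Mj; rewrite mul1r subr_ge0; apply: le_trans yM _.
    by rewrite ler_nat leq_double.
  apply: le_trans (exp_tail_le _ _ y0) _.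
  by rewrite subrr !mulr0 expR0.
have : (expR y + expR (- y)) / 4 + (-1) ^+ b * cos y / 2 <=
    \sum_(j < M | odd j == b) evw y j + 1.
  rewrite -(cvg_lim _ c)//; apply: limr_le; first exact: cvgP c.
  by near=> N; exact: key.
have := cos_le1 y; have := cos_geN1 y.
by case: b {c key}; rewrite ?expr0 ?expr1; lra.
Unshelve. all: by end_near. Qed.

End Chernoff.

(** * Concentration of the even exponential weights at the peak *)

Section Concentration.
Variables (R : realType) (rho : R).
Hypothesis rho_gt0 : 0 < rho.

Definition peak_pos (T : nat) : R := Num.sqrt T%:R / rho.
Definition peak_exp (T : nat) : R := 2 * Num.sqrt T%:R / rho.

Lemma peak_expE T : peak_exp T = 2 * peak_pos T.
Proof. by rewrite /peak_exp mulrA. Qed.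

Lemma peak_pos_gt0 T : (0 < T)%N -> 0 < peak_pos T.
Proof. by move=> T0; rewrite divr_gt0// sqrtr_gt0 ltr0n. Qed.

Lemma peak_pos_ge0 T : 0 <= peak_pos T.
Proof. by rewrite divr_ge0// ltW. Qed.

Lemma peak_exp_ge0 T : 0 <= peak_exp T.
Proof. by rewrite peak_expE mulr_ge0// peak_pos_ge0. Qed.

(** The window is multiplicative because, with [peak_exp = 2 peak_pos] and [k = 2j], its edges are
    then exactly the thresholds of [exp_tail_le] at [s] and [- s]. *)
Definition in_window (s : R) (T j : nat) : bool :=
  expR (- s) * peak_pos T <= j%:R <= expR s * peak_pos T.

(* Pairs [(T, j)] with [T] large and [j rho / sqrt T] close to 1. *)
Definition near_peak : set_system (nat * nat) :=
  [set P | exists2 s : R, 0 < s &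
     \forall T \near \oo, forall j, in_window s T j -> P (T, j)].

Lemma in_window_le s s' T j : s <= s' -> in_window s T j -> in_window s' T j.
Proof.
move=> ss /andP[h1 h2]; apply/andP; split.
  by apply: le_trans h1; rewrite ler_wpM2r ?peak_pos_ge0// ler_expR lerN2.
by apply: le_trans h2 _; rewrite ler_wpM2r ?peak_pos_ge0// ler_expR.
Qed.

Global Instance near_peak_filter : Filter near_peak.
Proof.
split.
- by exists 1 => //; near=> T.
- move=> P Q [s s0 hP] [s' s'0 hQ]; exists (minr s s'); first by rewrite lt_min s0.
  near=> T => j w; split.
    have : forall j, in_window s T j -> P (T, j) by near: T.
    by apply; apply: in_window_le w; rewrite ge_min lexx.
  have : forall j, in_window s' T j -> Q (T, j) by near: T.
  by apply; apply: in_window_le w; rewrite ge_min lexx orbT.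
- move=> P Q PQ [s s0 hP]; exists s => //; near=> T => j w; apply: PQ.
  have hh : forall j, in_window s T j -> P (T, j) by near: T.
  exact: hh.
Unshelve. all: by end_near. Qed.

Lemma near_peak_fst (P : nat -> Prop) :
  (\forall T \near \oo, P T) -> \forall q \near near_peak, P q.1.
Proof.
move=> h; exists 1 => //; near=> T => j _ /=; near: T; exact: h.
Unshelve. all: by end_near. Qed.

Lemma near_peak_cvg_fst (U : Type) (f : nat -> U) (G : set_system U) :
  f T @[T --> \oo] --> G -> f q.1 @[q --> near_peak] --> G.
Proof. by move=> fG P /fG; exact: near_peak_fst. Qed.

Lemma near_peak_ratio : q.2%:R / peak_pos q.1 @[q --> near_peak] --> (1 : R).
Proof.
apply/cvgrPdist_le => e e0; exists (ln (1 + e)); first by rewrite ln_gt0// ltrDl.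
near=> T => j; rewrite /in_window /= expRN lnK ?posrE ?addr_gt0//.
have x0 : 0 < peak_pos T by apply: peak_pos_gt0; near: T; exact: nbhs_infty_gt.
move=> /andP[h1 h2]; rewrite ler_distlC; apply/andP; split; last first.
  by rewrite ler_pdivrMr.
rewrite ler_pdivlMr//; apply: le_trans h1; rewrite ler_wpM2r ?(ltW x0)//.
rewrite -[leRHS]mul1r ler_pdivlMr ?addr_gt0//.
have : 0 <= e ^+ 2 by rewrite sqr_ge0.
by rewrite expr2 mulrBl mul1r mulrDr mulr1; lra.
Unshelve. all: by end_near. Qed.

Lemma poly_exp_cvg0 p c : 0 < c ->
  T.+1%:R ^+ p * expR (- (c * peak_exp T)) @[T --> \oo] --> (0 : R).
Proof.
move=> c0; pose a := c * 2 / rho; have a0 : 0 < a by rewrite divr_gt0// mulr_gt0.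
(* The exponent [n.+1 = 2p + 2] makes [(sqrt T)^(n + 1) = T^(p + 1)], one power more than required;
   the factor [2^(p + 1)] in [D] pays for [T + 1 <= 2T]. *)
pose n := (p.+1.*2).-1.
pose D := 2 ^+ p.+1 * n.+1`!%:R / a ^+ n.+1.
have D0 : 0 < D by rewrite divr_gt0 ?exprn_gt0// mulr_gt0 ?exprn_gt0// ltr0n fact_gt0.
have cD : D * T.+1%:R^-1 @[T --> \oo] --> (0 : R).
  rewrite -[X in _ --> X](mulr0 D); apply: cvgM; first exact: cvg_cst.
  exact: cvg_harmonic.
apply: (squeeze_cvgr _ (cvg_cst (0 : R)) cD).
near=> T; have T0 : (0 < T)%N by near: T; exact: nbhs_infty_gt.
rewrite mulr_ge0 ?expR_ge0 ?exprn_ge0//= expRN.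
have -> : c * peak_exp T = a * Num.sqrt T%:R by rewrite /a /peak_exp; ring.
rewrite ler_pdivrMr ?expR_gt0// mulrAC ler_pdivlMr ?ltr0n// -exprSr.
have z0 : 0 <= a * Num.sqrt T%:R by rewrite mulr_ge0// ltW.
have h := expR_ge1Dxn n z0.
apply: (@le_trans _ _ (D * ((a * Num.sqrt T%:R) ^+ n.+1 / n.+1`!%:R))); last first.
  by rewrite ler_wpM2l ?(ltW D0)//; apply: le_trans h; rewrite lerDr.
have -> : D * ((a * Num.sqrt T%:R) ^+ n.+1 / n.+1`!%:R) = (2 * T%:R) ^+ p.+1.
  rewrite exprMn; have -> : Num.sqrt T%:R ^+ n.+1 = T%:R ^+ p.+1 :> R.
    by rewrite /n prednK// -mul2n exprM sqr_sqrtr.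
  rewrite [(2 * _) ^+ _]exprMn /D.
  have A0 : a ^+ n.+1 != 0 by rewrite expf_neq0// lt0r_neq0.
  have F0 : n.+1`!%:R != 0 :> R by rewrite pnatr_eq0 -lt0n fact_gt0.
  move: (a ^+ n.+1) (n.+1`!%:R) (2 ^+ p.+1) (T%:R ^+ p.+1) A0 F0 => A F B C A0 F0.
  by field; rewrite A0 F0.
rewrite ler_pXn2r ?nnegrE ?mulr_ge0// -natrM ler_nat; lia.
Unshelve. all: by end_near. Qed.

Lemma evw_peak_asymp :
  (\sum_(j < T.+1 | odd j == odd T) evw (peak_exp T) j) / (expR (peak_exp T) / 4)
  @[T --> \oo] --> (1 : R).
Proof.
have c0 : expR (- peak_exp T) @[T --> \oo] --> (0 : R).
  have := poly_exp_cvg0 0 ltr01.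
  by under eq_fun do rewrite expr0 mul1r mul1r.
(* The constants are [6 = 4 (1/2 + 1)], for the cosine and the truncated tail, and
   [3 = 4 (1/4 + 1/2)], for [expR (- y) <= 1] and the cosine. *)
have cl : 1 - 6 * expR (- peak_exp T) @[T --> \oo] --> (1 : R).
  rewrite -[X in _ --> X]subr0 -[X in _ --> _ - X](mulr0 6); apply: cvgB; first exact: cvg_cst.
  by apply: cvgM; [exact: cvg_cst|exact: c0].
have cu : 1 + 3 * expR (- peak_exp T) @[T --> \oo] --> (1 : R).
  rewrite -[X in _ --> X]addr0 -[X in _ --> _ + X](mulr0 3); apply: cvgD; first exact: cvg_cst.
  by apply: cvgM; [exact: cvg_cst|exact: c0].
apply: (squeeze_cvgr _ cl cu); near=> T.
set y := peak_exp T; have y0 : 0 <= y by exact: peak_exp_ge0.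
have ey : 0 < expR y by exact: expR_gt0.
have ey4 : 0 < expR y / 4 by rewrite divr_gt0.
have eN : expR (- y) * expR y = 1 by rewrite expRN mulVf// lt0r_neq0.
have eN1 : expR (- y) <= 1 by rewrite expR_le1 oppr_le0.
have eN0 := expR_ge0 (- y).
apply/andP; split.
- rewrite ler_pdivlMr//.
  have := @evw_parity_ge R y (odd T) T.+1 y0.
  (* Since [y] is of order [sqrt T], stopping at [j = T] is eventually far beyond the peak. *)
  have hT : expR 1 * y <= (T.+1).*2%:R.
    rewrite /y peak_expE mulrCA -mul2n natrM ler_wpM2l// /peak_pos mulrCA.
    have TT : T%:R = Num.sqrt T%:R * Num.sqrt T%:R :> R by rewrite -expr2 sqr_sqrtr.
    apply: (@le_trans _ _ T%:R); last by rewrite ler_nat.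
    rewrite [leRHS]TT ler_wpM2l//.
    have -> : expR 1 / rho = Num.sqrt ((expR 1 / rho) ^+ 2).
      by rewrite sqrtr_sqr ger0_norm// divr_ge0 ?expR_ge0// ltW.
    by rewrite ler_wsqrtr//; near: T; exact: nbhs_infty_ger.
  move=> /(_ hT) h; apply: le_trans h.
  have -> : (1 - 6 * expR (- y)) * (expR y / 4) = expR y / 4 - 6 / 4 * (expR (- y) * expR y).
    by ring.
  by rewrite eN; lra.
- rewrite ler_pdivrMr//; apply: le_trans (evw_parity_le _ _ _) _.
  have -> : (1 + 3 * expR (- y)) * (expR y / 4) = expR y / 4 + 3 / 4 * (expR (- y) * expR y).
    by ring.
  by rewrite eN; lra.
Unshelve. all: by end_near. Qed.

(** The two Chernoff exponents fall short of [y] by [c1 y] and [c2 y]. As [y] grows like [sqrt T],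
    this beats any power of [T]. *)
Lemma evw_outside_window s p : 0 < s ->
  T.+1%:R ^+ p * ((\sum_(j < T.+1 | (odd j == odd T) && ~~ in_window s T j)
     evw (peak_exp T) j) / (expR (peak_exp T) / 4)) @[T --> \oo] --> (0 : R).
Proof.
move=> s0.
pose c1 := 1 - expR s * (1 - s); pose c2 := 1 - expR (- s) * (1 - - s).
have c10 : 0 < c1 by rewrite subr_gt0 chernoff_rate_lt1// lt0r_neq0.
have c20 : 0 < c2 by rewrite subr_gt0 chernoff_rate_lt1// oppr_eq0 lt0r_neq0.
have cu : 4 * (T.+1%:R ^+ p * expR (- (c1 * peak_exp T))) +
   4 * (T.+1%:R ^+ p * expR (- (c2 * peak_exp T))) @[T --> \oo] --> (0 : R).
  rewrite -[X in _ --> X]addr0 -[X in _ --> X + _](mulr0 4) -[X in _ --> _ + X](mulr0 4).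
  apply: cvgD; apply: cvgM; try exact: cvg_cst; exact: poly_exp_cvg0.
apply: (squeeze_cvgr _ (cvg_cst (0 : R)) cu); near=> T.
set y := peak_exp T; have y0 : 0 <= y by exact: peak_exp_ge0.
have ey : 0 < expR y by exact: expR_gt0.
apply/andP; split.
  rewrite mulr_ge0 ?exprn_ge0// divr_ge0 ?divr_ge0 ?(ltW ey)// sumr_ge0// => j _.
  exact: evw_ge0.
rewrite !(mulrCA 4) -mulrDr ler_wpM2l ?exprn_ge0// ler_pdivrMr ?divr_gt0//.
rewrite (_ : (4 * _ + 4 * _) * _ = expR (y + - (c1 * y)) + expR (y + - (c2 * y)));
  last by rewrite !expRD; field.
have -> : y + - (c1 * y) = y * (expR s * (1 - s)) by rewrite /c1; ring.
have -> : y + - (c2 * y) = y * (expR (- s) * (1 - - s)) by rewrite /c2; ring.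
pose P1 (j : nat) := (odd j == odd T) && (expR s * peak_pos T < j%:R).
pose P2 (j : nat) := (odd j == odd T) && (j%:R < expR (- s) * peak_pos T).
apply: (@le_trans _ _ (\sum_(j < T.+1 | P1 j) evw y j + \sum_(j < T.+1 | P2 j) evw y j)).
  rewrite big_mkcond [X in _ <= X + _]big_mkcond [X in _ <= _ + X]big_mkcond -big_split.
  apply: ler_sum => j _ /=; have := evw_ge0 y j; rewrite /P1 /P2 /in_window negb_and -!ltNge.
  by case: (odd j == odd T); case: (ltP (expR s * _)); case: (ltP j%:R); rewrite /= ?addr0 ?add0r//; lra.
apply: lerD.
- have := @sum_evw_le R P1 (fun k => 0 <= s * (k%:R - expR s * y)) y T.+1 y0.
  move=> h; apply: le_trans (h _) (exp_tail_le _ _ y0).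
  move=> j /andP[_ hj]; rewrite mulr_ge0 ?(ltW s0)// subr_ge0.
  by rewrite /y peak_expE mulrCA -mul2n natrM ler_wpM2l// ltW.
- have := @sum_evw_le R P2 (fun k => 0 <= - s * (k%:R - expR (- s) * y)) y T.+1 y0.
  move=> h; apply: le_trans (h _) (exp_tail_le _ _ y0).
  move=> j /andP[_ hj]; rewrite mulNr -mulrN mulr_ge0 ?(ltW s0)// oppr_ge0 subr_le0.
  by rewrite /y peak_expE mulrCA -mul2n natrM ler_wpM2l// ltW.
Unshelve. all: by end_near. Qed.

(** Laplace's method for sums: a factor that tends to 1 along the peak and is polynomially bounded
    elsewhere does not change the asymptotics. *)
Lemma evw_concentration (phi : nat -> nat -> R) (K : R) (p : nat) :
  (\forall T \near \oo, forall j, (j <= T)%N -> `|phi T j| <= K * T.+1%:R ^+ p) ->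
  phi q.1 q.2 @[q --> near_peak] --> (1 : R) ->
  (\sum_(j < T.+1 | odd j == odd T) evw (peak_exp T) j * phi T j) /
    (expR (peak_exp T) / 4) @[T --> \oo] --> (1 : R).
Proof.
move=> phiK phi1.
pose r T := (\sum_(j < T.+1 | odd j == odd T) evw (peak_exp T) j) / (expR (peak_exp T) / 4).
have rc : r T @[T --> \oo] --> (1 : R) by exact: evw_peak_asymp.
apply/cvgrPdist_le => e e0.
have e4 : 0 < e / 4 by rewrite divr_gt0.
have [s s0 hs] : \forall q \near near_peak, `|1 - phi q.1 q.2| <= e / 4.
  by move/cvgrPdist_le : phi1; apply.
pose o T := (\sum_(j < T.+1 | (odd j == odd T) && ~~ in_window s T j)
     evw (peak_exp T) j) / (expR (peak_exp T) / 4).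
have oc : (1 + `|K|) * (T.+1%:R ^+ p * o T) @[T --> \oo] --> (0 : R).
  rewrite -[X in _ --> X](mulr0 (1 + `|K|)); apply: cvgM; first exact: cvg_cst.
  exact: evw_outside_window.
near=> T.
(* The bound by 1 is what later gives [r T <= 2]. *)
have h1 : `|1 - r T| <= minr (e / 4) 1.
  by near: T; move/cvgrPdist_le: rc; apply; rewrite lt_min e4 ltr01.
have h2 : `|0 - (1 + `|K|) * (T.+1%:R ^+ p * o T)| <= e / 4.
  by near: T; move/cvgrPdist_le: oc; apply.
have h3 : forall j, in_window s T j -> `|1 - phi T j| <= e / 4 by near: T; exact: hs.
have h4 : forall j, (j <= T)%N -> `|phi T j| <= K * T.+1%:R ^+ p by near: T.
set y := peak_exp T; have ey4 : 0 < expR y / 4 by rewrite divr_gt0 ?expR_gt0.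
set S := (X in `|1 - X| <= _).
(* Termwise: inside the window [phi] is within [e / 4] of 1; outside, its distance from 1 is at most
   [1 + |K| (T + 1)^p]. *)
have main : `|r T - S| <= e / 4 * r T + (1 + `|K|) * (T.+1%:R ^+ p * o T).
  rewrite /r /S /o -mulrBl normrM (ger0_norm (ltW _ : 0 <= (expR y / 4)^-1)) ?invr_gt0//.
  rewrite !mulrA -mulrDl ler_wpM2r ?invr_ge0 ?(ltW ey4)//.
  rewrite -sumrB; apply: le_trans (ler_norm_sum _ _ _) _.
  rewrite !mulr_sumr big_mkcond [X in _ <= X + _]big_mkcond [X in _ <= _ + X]big_mkcond -big_split.
  apply: ler_sum => j _ /=; case: (odd j == odd T) => /=; last by rewrite addr0.
  have w0 := evw_ge0 y j.
  rewrite -{1}(mulr1 (evw y j)) -mulrBr normrM (ger0_norm w0).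
  case: ifPn => hj /=; last first.
    by rewrite addr0 mulrC ler_wpM2r// h3//; move: hj; rewrite negbK.
  rewrite -mulrDl mulrC ler_wpM2r//.
  apply: le_trans (ler_normB _ _) _; rewrite normr1.
  have t1 : 1 <= T.+1%:R ^+ p :> R by rewrite exprn_ege1// ler1n.
  have := h4 j ltac:(by have := ltn_ord j; lia).
  have : K * T.+1%:R ^+ p <= `|K| * T.+1%:R ^+ p.
    by rewrite ler_wpM2r ?ler_norm// (le_trans _ t1).
  by rewrite mulrDl mul1r; lra.
have r2 : r T <= 2.
  move: h1; rewrite le_min => /andP[_]; rewrite distrC ler_distl => /andP[_]; lra.
move: h1; rewrite le_min => /andP[h1 _].
move: h2; rewrite sub0r normrN => h2; have h2' := le_trans (ler_norm _) h2.
have -> : 1 - S = (1 - r T) + (r T - S) by ring.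
apply: le_trans (ler_normD _ _) _.
have : e / 4 * r T <= e / 4 * 2 by rewrite ler_wpM2l// ltW.
lra.
Unshelve. all: by end_near. Qed.

End Concentration.

(** * Limits along the peak *)

Section ElementaryLimits.
Variable R : realType.

Lemma cvg_sqrt (T : Type) (F : set_system T) {FF : Filter F} (f : T -> R) (a : R) :
  f x @[x --> F] --> a -> Num.sqrt (f x) @[x --> F] --> Num.sqrt a.
Proof. by move=> h; apply: continuous_cvg => //; exact: sqrt_continuous. Qed.

Lemma cvg_near_eq (T : Type) (F : set_system T) {FF : Filter F} (f g : T -> R) (a : R) :
  (\forall x \near F, f x = g x) -> f x @[x --> F] --> a -> g x @[x --> F] --> a.
Proof. by move=> fg h; apply: cvg_trans h; exact: near_eq_cvg. Qed.

Lemma cvg_sqrt_nat : (Num.sqrt n%:R : R) @[n --> \oo] --> +oo.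
Proof.
apply/cvgryPge => A; near=> n.
have -> : A <= Num.sqrt n%:R by apply: le_trans (ler_norm A) _;
  rewrite -sqrtr_sqr ler_wsqrtr//; near: n; exact: nbhs_infty_ger.
by [].
Unshelve. all: by end_near. Qed.

Lemma cvg_inv_sqrt_nat : (Num.sqrt n%:R : R)^-1 @[n --> \oo] --> (0 : R).
Proof. by apply/gtr0_cvgV0; [near=> n; rewrite sqrtr_gt0 ltr0n; near: n; exact: nbhs_infty_gt|exact: cvg_sqrt_nat].
Unshelve. all: by end_near. Qed.

Lemma cbin_le1 m : @cbin R m <= 1.
Proof.
elim: m => [|m IH]; first by rewrite /cbin double0 fact0 expr0 expr1n mulr1 divr1.
rewrite cbinS mulr_ile1 ?(ltW (cbin_gt0 _ _))//.
by rewrite ler_pdivrMr ?ltr0n// mul1r ler_nat.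
Qed.

Lemma cbin_asymp : @cbin R m * Num.sqrt (pi * m%:R) @[m --> \oo] --> (1 : R).
Proof.
have pi0 := @pi_ge0 R.
have e m : @cbin R m * Num.sqrt (pi * m%:R) = Num.sqrt (pi * m%:R * cbin m ^+ 2).
  rewrite [in RHS]sqrtrM ?mulr_ge0// sqrtr_sqr ger0_norm ?(ltW (cbin_gt0 _ _))//.
  by rewrite mulrC.
rewrite -[X in _ --> X]sqrtr1; under eq_fun do rewrite e.
apply: cvg_sqrt.
have cl : 1 - (m.+1%:R)^-1 @[m --> \oo] --> (1 : R).
  rewrite -[X in _ --> X]subr0; apply: cvgB; [exact: cvg_cst|exact: cvg_harmonic].
apply: (squeeze_cvgr _ cl (cvg_cst (1 : R))); near=> m.
have [h1 h2] := wallis R m; rewrite h2 andbT.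
have m0 : 0 <= m%:R :> R by [].
apply: (@le_trans _ _ (m%:R * (2 / m.*2.+1%:R))); last first.
  by rewrite (mulrC pi) -mulrA ler_wpM2l.
rewrite mulrA ler_pdivlMr ?ltr0n// -mul2n -(natr1 (2 * m)) natrM -natr1.
have : 0 < m%:R + 1 :> R by rewrite natr1 ltr0n.
move: (m%:R) m0 => x xp x0.
have -> : (1 - (x + 1)^-1) * (2 * x + 1) = x * (2 * x + 1) / (x + 1) by field; lra.
rewrite ler_pdivrMr//; nra.
Unshelve. all: by end_near. Qed.

Lemma invr_sqrt (n : nat) : n%:R^-1 = (Num.sqrt n%:R)^-1 * (Num.sqrt n%:R)^-1 :> R.
Proof. by rewrite -invfM -expr2 sqr_sqrtr. Qed.

Lemma sum_natr j : \sum_(i < j) i%:R = j%:R * (j%:R - 1) / 2 :> R.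
Proof.
elim: j => [|j IH]; first by rewrite big_ord0; field.
by rewrite big_ord_recr /= IH -natr1; field.
Qed.

Lemma ffrac_le T j : (j <= T)%N -> ffrac R T j <= expR (- (j%:R * (j%:R - 1) / 2 / T%:R)).
Proof.
move=> jT; rewrite -sum_natr mulr_suml -sumrN expR_sum /ffrac.
apply: ler_prod => i _; rewrite expR_ge1Dx andbT.
have iT : i%:R <= T%:R :> R by rewrite ler_nat; have := ltn_ord i; lia.
have T0 : 0 < T%:R :> R by rewrite ltr0n; have := ltn_ord i; lia.
by rewrite subr_ge0 ler_pdivrMr// mul1r.
Qed.

(** Each factor obeys [1 / (1 - a) = 1 + a / (1 - a) <= expR (a / (1 - a))]. The denominators are
    then all replaced by the smaller [1 - j / T], so that the exponents can be summed. *)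
Lemma ffrac_ge T j : (j < T)%N ->
  expR (- (j%:R * (j%:R - 1) / 2 / T%:R / (1 - j%:R / T%:R))) <= ffrac R T j.
Proof.
move=> jT; have T0 : 0 < T%:R :> R by rewrite ltr0n; lia.
have jT1 : j%:R / T%:R < 1 :> R by rewrite ltr_pdivrMr// mul1r ltr_nat.
rewrite -sum_natr !mulr_suml -sumrN expR_sum /ffrac.
apply: ler_prod => i _; rewrite expR_ge0 /= expRN.
have ij : i%:R / T%:R <= j%:R / T%:R :> R.
  by rewrite ler_wpM2r ?invr_ge0 ?(ltW T0)// ler_nat ltnW.
have i0 : 0 <= i%:R / T%:R :> R by rewrite divr_ge0// ltW.
move: (i%:R / T%:R) (j%:R / T%:R) ij i0 jT1 => a b ab a0 b1.
have a1 : 0 < 1 - a by lra.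
rewrite -[leRHS]invrK lef_pV2 ?posrE ?expR_gt0 ?invr_gt0//.
apply: le_trans (expR_ge1Dx _).
apply: (@le_trans _ _ (1 + a / (1 - a))).
  by rewrite le_eqVlt; apply/orP; left; apply/eqP; field; lra.
by rewrite lerD2l ler_wpM2l// lef_pV2 ?posrE//; lra.
Qed.

(** About [T^(3/4)]: long compared with [sqrt T], so that the geometric weights of the trial vector
    die out, and short compared with [T], so that the degrees in use stay equivalent to [T]. *)
Definition cutoff (T : nat) : nat := truncn (Num.sqrt T%:R * Num.sqrt (Num.sqrt T%:R) : R).

(** The ratio of [habs_ge_ratio] with [V] a lower bound for all degrees in the trial vector. *)
Definition row_ratio (T j : nat) : R := maxr 0 (1 - j%:R / (T - (cutoff T).*2)%:R).

Lemma row_ratio_bounds T j : 0 <= row_ratio T j <= 1.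
Proof.
by rewrite le_max lexx /= ge_max ler01 /= lerBlDr lerDl divr_ge0.
Qed.

Lemma cutoff_le T : (cutoff T)%:R <= Num.sqrt T%:R * Num.sqrt (Num.sqrt T%:R) :> R.
Proof. by rewrite /cutoff truncn_le// mulr_ge0. Qed.

Lemma cvg_sqrt_sqrt : (Num.sqrt (Num.sqrt n%:R) : R) @[n --> \oo] --> +oo.
Proof.
apply/cvgryPge => A; near=> n.
apply: le_trans (ler_norm A) _; rewrite -sqrtr_sqr ler_wsqrtr//.
by near: n; move/cvgryPge : cvg_sqrt_nat; apply.
Unshelve. all: by end_near. Qed.

Lemma cutoff_quot : (cutoff n)%:R / n%:R @[n --> \oo] --> (0 : R).
Proof.
have c : (Num.sqrt (Num.sqrt n%:R) : R)^-1 @[n --> \oo] --> (0 : R).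
  apply/gtr0_cvgV0; last exact: cvg_sqrt_sqrt.
  by near=> n; rewrite !sqrtr_gt0 ltr0n; near: n; exact: nbhs_infty_gt.
apply: (squeeze_cvgr _ (cvg_cst (0 : R)) c); near=> n.
have n0 : 0 < n%:R :> R by rewrite ltr0n; near: n; exact: nbhs_infty_gt.
rewrite divr_ge0//= ler_pdivrMr//; apply: le_trans (cutoff_le n) _.
have s0 : 0 < Num.sqrt n%:R :> R by rewrite sqrtr_gt0.
have e1 : Num.sqrt n%:R * Num.sqrt n%:R = n%:R :> R by rewrite -expr2 sqr_sqrtr.
have e2 : Num.sqrt (Num.sqrt n%:R) * Num.sqrt (Num.sqrt n%:R) = Num.sqrt n%:R :> R.
  by rewrite -expr2 sqr_sqrtr.
have s1 : 0 < Num.sqrt (Num.sqrt n%:R) :> R by rewrite sqrtr_gt0.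
rewrite -[X in _ <= _^-1 * X]e1 ler_pdivlMl// mulrCA e2.
by rewrite lexx.
Unshelve. all: by end_near. Qed.

Lemma cutoff_lt : \forall T \near \oo, ((cutoff T).*2 < T)%N.
Proof.
have h : \forall T \near \oo, `|0 - (cutoff T)%:R / T%:R : R| < 2^-1.
  by move/cvgrPdist_lt : cutoff_quot; apply; rewrite invr_gt0.
near=> T; have T0 : 0 < T%:R :> R by rewrite ltr0n; near: T; exact: nbhs_infty_gt.
have : `|0 - (cutoff T)%:R / T%:R : R| < 2^-1 by near: T.
rewrite sub0r normrN ger0_norm ?divr_ge0// ltr_pdivrMr// mulrC ltr_pdivlMr//.
by rewrite -natrM ltr_nat muln2.
Unshelve. all: by end_near. Qed.

End ElementaryLimits.

(** * Limits of the slowly varying factors near the peak *)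

Section WeightLimits.
Variables (R : realType) (rho : R).
Hypothesis rho_gt0 : 0 < rho.
Local Notation ppos := (peak_pos rho).
Local Notation pexp := (peak_exp rho).
Local Notation near_peak := (near_peak rho).
Local Notation cutoff := (cutoff R).
Local Notation row_ratio := (row_ratio R).

#[local] Instance near_peak_filter_inst : Filter near_peak := near_peak_filter rho_gt0.

Lemma near_peak_sqrt : q.2%:R / Num.sqrt q.1%:R @[q --> near_peak] --> rho^-1.
Proof.
rewrite -[X in _ --> X]mul1r.
have -> : (fun q : nat * nat => q.2%:R / Num.sqrt q.1%:R : R) =
          (fun q => q.2%:R / ppos q.1 / rho).
  apply/funext => q; rewrite /peak_pos invf_div mulrA -mulrA mulrAC.
  by rewrite -mulrA divfK// lt0r_neq0.
by apply: cvgM; [exact: near_peak_ratio|exact: cvg_cst].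
Qed.

Lemma near_peak_inv_sqrt : (Num.sqrt q.1%:R)^-1 @[q --> near_peak] --> (0 : R).
Proof. exact: (@near_peak_cvg_fst R rho _ (fun n : nat => (Num.sqrt n%:R : R)^-1) _ (@cvg_inv_sqrt_nat R)). Qed.

Lemma near_peak_quot : q.2%:R / q.1%:R @[q --> near_peak] --> (0 : R).
Proof.
rewrite -[X in _ --> X](mulr0 rho^-1).
under eq_fun do rewrite invr_sqrt mulrA.
by apply: cvgM; [exact: near_peak_sqrt|exact: near_peak_inv_sqrt].
Qed.

Lemma near_peak_invn : q.1%:R^-1 @[q --> near_peak] --> (0 : R).
Proof.
rewrite -[X in _ --> X](mulr0 0).
under eq_fun do rewrite invr_sqrt.
by apply: cvgM; exact: near_peak_inv_sqrt.
Qed.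

Lemma near_peak_snd : q.2 @[q --> near_peak] --> \oo.
Proof.
apply/cvgnyPge => A.
have h1 : \forall q \near near_peak, `|1 - q.2%:R / ppos q.1| <= 2^-1.
  by move/cvgrPdist_le : (near_peak_ratio rho_gt0); apply; rewrite invr_gt0.
have h2 : \forall q \near near_peak, 2 * rho * A%:R <= Num.sqrt q.1%:R.
  apply: (@near_peak_fst R rho (fun T => 2 * rho * A%:R <= Num.sqrt T%:R)).
  by move/cvgryPge : (@cvg_sqrt_nat R); apply.
have h3 : \forall q \near near_peak, (0 < q.1)%N.
  by apply: (@near_peak_fst R rho (fun T => (0 < T)%N)); exact: nbhs_infty_gt.
near=> q.
have x0 : 0 < ppos q.1 by apply: peak_pos_gt0 => //; near: q.
have : `|1 - q.2%:R / ppos q.1| <= 2^-1 by near: q.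
have : 2 * rho * A%:R <= Num.sqrt q.1%:R by near: q.
rewrite -(@ler_nat R).
have -> : Num.sqrt q.1%:R = rho * ppos q.1.
  by rewrite /peak_pos mulrCA divff ?mulr1// lt0r_neq0.
rewrite (mulrC 2) -mulrA ler_pM2l// => hA.
rewrite ler_distlC => /andP[+ _]; rewrite ler_pdivlMr//; lra.
Unshelve. all: by end_near. Qed.

Lemma near_peak_le : \forall q \near near_peak, (q.2 <= q.1)%N.
Proof.
have h1 : \forall q \near near_peak, `|0 - q.2%:R / q.1%:R : R| <= 1.
  by move/cvgrPdist_le : near_peak_quot; apply.
have h3 : \forall q \near near_peak, (0 < q.1)%N.
  by apply: (@near_peak_fst R rho (fun T => (0 < T)%N)); exact: nbhs_infty_gt.
near=> q; have q0 : 0 < q.1%:R :> R by rewrite ltr0n; near: q.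
have : `|0 - q.2%:R / q.1%:R : R| <= 1 by near: q.
by rewrite sub0r normrN ger0_norm ?divr_ge0// ler_pdivrMr// mul1r ler_nat.
Unshelve. all: by end_near. Qed.

Lemma near_peak_half : ((q.1 - q.2)./2).*2%:R / q.1%:R @[q --> near_peak] --> (1 : R).
Proof.
have cu : 1 - q.2%:R / q.1%:R @[q --> near_peak] --> (1 : R).
  rewrite -[X in _ --> X]subr0; apply: cvgB; [exact: cvg_cst|exact: near_peak_quot].
(* The filter does not fix the parity of [T - j], so halving and doubling can lose 1. *)
have cl : 1 - q.2%:R / q.1%:R - q.1%:R^-1 @[q --> near_peak] --> (1 : R).
  rewrite -[X in _ --> X]subr0; apply: cvgB; [exact: cu|exact: near_peak_invn].
have h3 : \forall q \near near_peak, (0 < q.1)%N.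
  by apply: (@near_peak_fst R rho (fun T => (0 < T)%N)); exact: nbhs_infty_gt.
apply: (squeeze_cvgr _ cl cu); near=> q.
have q0 : 0 < q.1%:R :> R by rewrite ltr0n; near: q.
have qle : (q.2 <= q.1)%N by near: q; exact: near_peak_le.
have e1 : 1 - q.2%:R / q.1%:R = (q.1 - q.2)%:R / q.1%:R :> R.
  by rewrite natrB// mulrBl divff ?lt0r_neq0.
have e2 : (q.1 - q.2)%:R / q.1%:R - q.1%:R^-1 = ((q.1 - q.2)%:R - 1) / q.1%:R :> R.
  by rewrite mulrBl mul1r.
rewrite e1 e2 !ler_pM2r ?invr_gt0//.
by rewrite lerBlDr -[1]/(1%:R) -natrD !ler_nat; lia.
Unshelve. all: by end_near. Qed.

Lemma near_peak_half_oo : (q.1 - q.2)./2 @[q --> near_peak] --> \oo.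
Proof.
apply/cvgnyPge => A.
have h1 : \forall q \near near_peak, (A.*2.+2 <= q.1 - q.2)%N.
  have h : \forall q \near near_peak, `|0 - q.2%:R / q.1%:R : R| <= 2^-1.
    by move/cvgrPdist_le : near_peak_quot; apply; rewrite invr_gt0.
  have h3 : \forall q \near near_peak, ((A.*2.+2).*2 < q.1)%N.
    by apply: (@near_peak_fst R rho (fun T => (A.*2.+2).*2 < T)%N); exact: nbhs_infty_gt.
  near=> q; have q1 : ((A.*2.+2).*2 < q.1)%N by near: q.
  have q0 : 0 < q.1%:R :> R by rewrite ltr0n; lia.
  have : `|0 - q.2%:R / q.1%:R : R| <= 2^-1 by near: q.
  rewrite sub0r normrN ger0_norm ?divr_ge0// ler_pdivrMr// mulrC ler_pdivlMr//.
  by rewrite -natrM ler_nat; lia.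
near=> q; have : (A.*2.+2 <= q.1 - q.2)%N by near: q.
by lia.
Unshelve. all: by end_near. Qed.

Lemma near_peak_cbin_half :
  cbin (q.1 - q.2)./2 * Num.sqrt (pi * q.1%:R / 2) @[q --> near_peak] --> (1 : R).
Proof.
have pi0 := @pi_ge0 R.
have c1 : cbin (q.1 - q.2)./2 * Num.sqrt (pi * (q.1 - q.2)./2%:R)
    @[q --> near_peak] --> (1 : R) by exact: cvg_comp near_peak_half_oo (@cbin_asymp R).
have c2 : Num.sqrt (((q.1 - q.2)./2).*2%:R / q.1%:R)^-1 @[q --> near_peak] --> (1 : R).
  rewrite -[X in _ --> X]sqrtr1 -[X in _ --> Num.sqrt X]invr1.
  by apply: cvg_sqrt; apply: cvgV; [exact: oner_neq0|exact: near_peak_half].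
apply: (@cvg_near_eq _ _ _ _ (fun q => cbin (q.1 - q.2)./2 * Num.sqrt (pi * (q.1 - q.2)./2%:R) *
  Num.sqrt (((q.1 - q.2)./2).*2%:R / q.1%:R)^-1)); last first.
  by rewrite -[X in _ --> X]mulr1; apply: cvgM.
near=> q.
have m0 : (0 < (q.1 - q.2)./2)%N.
  by near: q; move/cvgnyPgt : near_peak_half_oo; apply.
rewrite /= -mulrA -sqrtrM ?mulr_ge0// invf_div -mul2n natrM; congr (_ * Num.sqrt _).
by field; rewrite pnatr_eq0 -lt0n.
Unshelve. all: by end_near. Qed.

Lemma near_peak_cbin_snd :
  cbin q.2 * Num.sqrt (pi * ppos q.1) @[q --> near_peak] --> (1 : R).
Proof.
have pi0 := @pi_ge0 R.
have c1 : cbin q.2 * Num.sqrt (pi * q.2%:R) @[q --> near_peak] --> (1 : R).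
  exact: cvg_comp near_peak_snd (@cbin_asymp R).
have c2 : Num.sqrt (q.2%:R / ppos q.1)^-1 @[q --> near_peak] --> (1 : R).
  rewrite -[X in _ --> X]sqrtr1 -[X in _ --> Num.sqrt X]invr1.
  by apply: cvg_sqrt; apply: cvgV; [exact: oner_neq0|exact: near_peak_ratio].
apply: (@cvg_near_eq _ _ _ _ (fun q => cbin q.2 * Num.sqrt (pi * q.2%:R) *
  Num.sqrt (q.2%:R / ppos q.1)^-1)); last first.
  by rewrite -[X in _ --> X]mulr1; apply: cvgM.
near=> q.
have j0 : (0 < q.2)%N.
  by near: q; move/cvgnyPgt : near_peak_snd; apply.
rewrite /= -mulrA -sqrtrM ?mulr_ge0// invf_div; congr (_ * Num.sqrt _).
by rewrite -mulrA (mulrCA q.2%:R) divff ?mulr1// pnatr_eq0 -lt0n.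
Unshelve. all: by end_near. Qed.

(** Both exponential bounds have exponent equivalent to [- j^2 / (2T)], and [j ~ sqrt T / rho]. The
    inverse of this limit is the factor [expR (1 / (2 rho^2))] of [lambda_min]. *)
Lemma near_peak_ffrac :
  ffrac R q.1 q.2 @[q --> near_peak] --> expR (- (2 * rho ^+ 2)^-1).
Proof.
have cE : q.2%:R * (q.2%:R - 1) / 2 / q.1%:R @[q --> near_peak] --> (2 * rho ^+ 2)^-1.
  have -> : (2 * rho ^+ 2)^-1 = 2^-1 * (rho^-1 * rho^-1) - 2^-1 * 0.
    by field; exact: lt0r_neq0.
  have -> : (fun q : nat * nat => q.2%:R * (q.2%:R - 1) / 2 / q.1%:R) = (fun q =>
    2^-1 * (q.2%:R / Num.sqrt q.1%:R * (q.2%:R / Num.sqrt q.1%:R)) -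
    2^-1 * (q.2%:R / q.1%:R) : R).
    by apply/funext => q; rewrite !invr_sqrt; ring.
  apply: cvgB; apply: cvgM; try exact: cvg_cst; last exact: near_peak_quot.
  by apply: cvgM; exact: near_peak_sqrt.
have cu : expR (- (q.2%:R * (q.2%:R - 1) / 2 / q.1%:R)) @[q --> near_peak] -->
    expR (- (2 * rho ^+ 2)^-1).
  by apply: continuous_cvg; [exact: continuous_expR|exact: cvgN].
have cl : expR (- (q.2%:R * (q.2%:R - 1) / 2 / q.1%:R / (1 - q.2%:R / q.1%:R)))
    @[q --> near_peak] --> expR (- (2 * rho ^+ 2)^-1).
  apply: continuous_cvg; [exact: continuous_expR|apply: cvgN].
  rewrite -[X in _ --> X]divr1; apply: cvgM; first exact: cE.
  apply: cvgV; first exact: oner_neq0.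
  rewrite -[X in _ --> X]subr0; apply: cvgB; [exact: cvg_cst|exact: near_peak_quot].
apply: (squeeze_cvgr _ cl cu).
have h : \forall q \near near_peak, `|0 - q.2%:R / q.1%:R : R| <= 2^-1.
  by move/cvgrPdist_le : near_peak_quot; apply; rewrite invr_gt0.
have h3 : \forall q \near near_peak, (0 < q.1)%N.
  by apply: (@near_peak_fst R rho (fun T => (0 < T)%N)); exact: nbhs_infty_gt.
near=> q; have q0 : (0 < q.1)%N by near: q.
have jT : (q.2 < q.1)%N.
  have : `|0 - q.2%:R / q.1%:R : R| <= 2^-1 by near: q.
  rewrite sub0r normrN ger0_norm ?divr_ge0// ler_pdivrMr ?ltr0n// mulrC ler_pdivlMr//.
  by rewrite -natrM ler_nat; lia.
by rewrite ffrac_ge// ffrac_le// ltnW.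
Unshelve. all: by end_near. Qed.

Lemma near_peak_upper_weight :
  upper_weight R q.1 q.2 * (2 / (rho * Num.sqrt q.1%:R)) @[q --> near_peak] --> (1 : R).
Proof.
have ci := near_peak_inv_sqrt.
(* This is [sqrt T] times [d = (j - 1) / (T - 1)], and the weight is
   [1 / (1 - (1 - d)^2) = 1 / (d (2 - d))]. *)
pose dl (q : nat * nat) : R := (q.2%:R / Num.sqrt q.1%:R - (Num.sqrt q.1%:R)^-1) / (1 - q.1%:R^-1).
have cd : dl q @[q --> near_peak] --> rho^-1.
  have -> : rho^-1 = (rho^-1 - 0) / (1 - 0) by rewrite !subr0 divr1.
  apply: cvgM; first by apply: cvgB => //; exact: near_peak_sqrt.
  apply: cvgV; first by rewrite subr0 oner_neq0.
  by apply: cvgB; [exact: cvg_cst|exact: near_peak_invn].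
have c : (2 / rho) / (dl q * (2 - dl q * (Num.sqrt q.1%:R)^-1)) @[q --> near_peak] --> (1 : R).
  rewrite [X in _ --> X](_ : _ = (2 / rho) / (rho^-1 * (2 - rho^-1 * 0))); last first.
    by field; exact: lt0r_neq0.
  apply: cvgM; first exact: cvg_cst.
  apply: cvgV.
    by rewrite mulr0 subr0 mulf_neq0// invr_neq0// lt0r_neq0.
  apply: cvgM => //; apply: cvgB; first exact: cvg_cst.
  exact: cvgM.
apply: (cvg_near_eq _ c).
have h3 : \forall q \near near_peak, (1 < q.1)%N.
  by apply: (@near_peak_fst R rho (fun T => (1 < T)%N)); exact: nbhs_infty_gt.
near=> q; have q1 : (1 < q.1)%N by near: q.
have j1 : (1 < q.2)%N by near: q; move/cvgnyPgt : near_peak_snd; apply.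
rewrite /upper_weight j1 /dl.
have s2 : q.1%:R = Num.sqrt q.1%:R ^+ 2 :> R by rewrite sqr_sqrtr.
have s1 : 1 < Num.sqrt q.1%:R ^+ 2 :> R by rewrite -s2 ltr1n.
have s0 : 0 < Num.sqrt q.1%:R :> R by rewrite sqrtr_gt0 ltr0n; lia.
have -> : q.2.-1%:R = q.2%:R - 1 :> R by rewrite -subn1 natrB//; lia.
have -> : q.1.-1%:R = q.1%:R - 1 :> R by rewrite -subn1 natrB//; lia.
have j0 : 1 < q.2%:R :> R by rewrite ltr1n.
have jT : q.2%:R <= q.1%:R :> R.
  by rewrite ler_nat; near: q; exact: near_peak_le.
move: (q.1%:R) (Num.sqrt q.1%:R) (q.2%:R) s2 s0 s1 j0 jT => t s j -> s0 s1 j0 jT.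
have a1 : s ^+ 2 - 1 != 0 by rewrite lt0r_neq0// subr_gt0.
have a2 : j - 1 != 0 by rewrite lt0r_neq0// subr_gt0.
have a3 : 2 * (s ^+ 2 - 1) - (j - 1) != 0 by rewrite lt0r_neq0//; lra.
have a4 : (s ^+ 2 - 1) ^+ 2 - (s ^+ 2 - 1 - (j - 1)) ^+ 2 != 0.
  have -> : (s ^+ 2 - 1) ^+ 2 - (s ^+ 2 - 1 - (j - 1)) ^+ 2 =
    (j - 1) * (2 * (s ^+ 2 - 1) - (j - 1)) by ring.
  exact: mulf_neq0.
by field; rewrite a1 a2 a3 a4 !lt0r_neq0.
Unshelve. all: by end_near. Qed.


(** Equals [1 - 1 / (rho sqrt T)] to first order, the row ratio at the peak, in a form that lies in
    [[0, 1)] for every [T]. *)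
Definition decay (T : nat) : R := rho * Num.sqrt T%:R / (rho * Num.sqrt T%:R + 1).

(** The Rayleigh quotient of the vector [decay^u] for the rank-one matrix with entries
    [row_ratio^(u + v)]. *)
Definition lower_weight (T j : nat) : R :=
  (\sum_(u < cutoff T) (row_ratio T j * decay T) ^+ u) ^+ 2 /
  \sum_(u < cutoff T) (decay T ^+ 2) ^+ u.

Lemma decay_ge0 T : 0 <= decay T.
Proof. by rewrite divr_ge0 ?addr_ge0 ?mulr_ge0// ltW. Qed.

Lemma decay_lt1 T : decay T < 1.
Proof.
rewrite ltr_pdivrMr; last by rewrite ltr_pwDr// mulr_ge0// ltW.
by rewrite mul1r ltrDl.
Qed.

Lemma decay_rate : Num.sqrt T%:R * (1 - decay T) @[T --> \oo] --> rho^-1.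
Proof.
have c : (rho + (Num.sqrt n%:R)^-1)^-1 @[n --> \oo] --> rho^-1.
  apply: cvgV; first exact: lt0r_neq0.
  by rewrite -[X in _ --> X]addr0; apply: cvgD; [exact: cvg_cst|exact: cvg_inv_sqrt_nat].
apply: (cvg_near_eq _ c); near=> n.
have s0 : 0 < Num.sqrt n%:R :> R.
  by rewrite sqrtr_gt0 ltr0n; near: n; exact: nbhs_infty_gt.
rewrite /decay; move: (Num.sqrt n%:R) s0 => s s0.
have rs : 0 < rho * s by rewrite mulr_gt0.
by field; rewrite !lt0r_neq0//; lra.
Unshelve. all: by end_near. Qed.

Lemma decay_cvg1 : decay T @[T --> \oo] --> (1 : R).
Proof.
have -> : decay = fun T => 1 - (1 - decay T) by apply/funext => T; rewrite subKr.
rewrite -[X in _ --> X]subr0; apply: cvgB; first exact: cvg_cst.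
have c : Num.sqrt T%:R * (1 - decay T) * (Num.sqrt T%:R)^-1 @[T --> \oo] --> (0 : R).
  by rewrite -[X in _ --> X](mulr0 rho^-1); apply: cvgM; [exact: decay_rate|exact: cvg_inv_sqrt_nat].
apply: (cvg_near_eq _ c); near=> n.
have s0 : Num.sqrt n%:R != 0 :> R.
  by rewrite lt0r_neq0// sqrtr_gt0 ltr0n; near: n; exact: nbhs_infty_gt.
by rewrite mulrAC divff// mul1r.
Unshelve. all: by end_near. Qed.

(** Use [decay <= expR (- (1 - decay))], where eventually [1 - decay >= 1 / (2 rho sqrt T)]; as
    [cutoff >= sqrt T (T^(1/4) - 1)], the exponent is at least [(T^(1/4) - 1) / (2 rho)]. *)
Lemma decay_pow_cutoff : decay T ^+ cutoff T @[T --> \oo] --> (0 : R).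
Proof.
have g : (2 * rho)^-1 * (Num.sqrt (Num.sqrt n%:R) - 1) @[n --> \oo] --> +oo.
  apply/cvgryPge => A.
  have h : \forall n \near \oo, 2 * rho * A + 1 <= Num.sqrt (Num.sqrt n%:R).
    by move/cvgryPge : (@cvg_sqrt_sqrt R); apply.
  near=> n; rewrite ler_pdivlMl ?mulr_gt0// lerBrDr; by near: n.
have c : expR (- ((2 * rho)^-1 * (Num.sqrt (Num.sqrt n%:R) - 1))) @[n --> \oo] --> (0 : R).
  exact: cvg_comp g (@cvgr_expR R).
have h : \forall n \near \oo, `|rho^-1 - Num.sqrt n%:R * (1 - decay n)| <= (2 * rho)^-1.
  by move/cvgrPdist_le : decay_rate; apply; rewrite invr_gt0 mulr_gt0.
apply: (squeeze_cvgr _ (cvg_cst (0 : R)) c); near=> n.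
rewrite exprn_ge0 ?decay_ge0//=.
have d1 : decay n <= expR (- (1 - decay n)).
  by apply: le_trans (expR_ge1Dx _); rewrite opprB addrC subrK.
apply: (@le_trans _ _ (expR (- (1 - decay n)) ^+ cutoff n)).
  by apply: lerXn2r; rewrite ?nnegrE ?decay_ge0 ?expR_ge0.
rewrite -expRM_natl ler_expR mulrN lerN2.
have n1 : 1 <= n%:R :> R by rewrite ler1n; near: n; exact: nbhs_infty_gt.
have s1 : 1 <= Num.sqrt n%:R :> R by rewrite -[leLHS]sqrtr1 ler_wsqrtr.
have U1 : Num.sqrt n%:R * Num.sqrt (Num.sqrt n%:R) < (cutoff n)%:R + 1 :> R.
  by rewrite natr1 /cutoff truncnS_gt.
have : `|rho^-1 - Num.sqrt n%:R * (1 - decay n)| <= (2 * rho)^-1 by near: n.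
rewrite ler_distlC => /andP[+ _].
have -> : rho^-1 - (2 * rho)^-1 = (2 * rho)^-1 by field; exact: lt0r_neq0.
have U0 : 0 <= (cutoff n)%:R :> R by [].
have dl := decay_lt1 n; have r0 : 0 < (2 * rho)^-1 by rewrite invr_gt0 mulr_gt0.
move: (Num.sqrt n%:R) (Num.sqrt (Num.sqrt n%:R)) ((cutoff n)%:R) (decay n) ((2 * rho)^-1) s1 U1 U0 dl r0 => s w U d r s1 U1 U0 dl r0 hr.
have hU : s * (w - 1) <= U by rewrite mulrBr mulr1; lra.
have s0 : 0 < s by lra.
have d0 : 0 <= 1 - d by lra.
case: (leP w 1) => w1.
  apply: (@le_trans _ _ 0); first by rewrite mulr_ge0_le0 ?(ltW r0)//; lra.
  by rewrite mulr_ge0.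
apply: (@le_trans _ _ (s * (1 - d) * (w - 1))); first by rewrite ler_wpM2r//; lra.
by rewrite mulrAC ler_wpM2r.
Unshelve. all: by end_near. Qed.

Lemma near_peak_row_ratio :
  Num.sqrt q.1%:R * (1 - row_ratio q.1 q.2) @[q --> near_peak] --> rho^-1.
Proof.
have cV : (q.1 - (cutoff q.1).*2)%:R / q.1%:R @[q --> near_peak] --> (1 : R).
  apply: (@near_peak_cvg_fst R rho _ (fun T => (T - (cutoff T).*2)%:R / T%:R : R)).
  have c : 1 - 2 * ((cutoff T)%:R / T%:R) @[T --> \oo] --> (1 : R).
    rewrite -[X in _ --> X]subr0 -[X in _ --> _ - X](mulr0 2).
    apply: cvgB; first exact: cvg_cst.
    by apply: cvgM; [exact: cvg_cst|exact: cutoff_quot].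
  apply: (cvg_near_eq _ c); near=> T.
  have T0 : T%:R != 0 :> R by rewrite pnatr_eq0 -lt0n; near: T; exact: nbhs_infty_gt.
  have Ul : ((cutoff T).*2 < T)%N by near: T; exact: cutoff_lt.
  rewrite natrB ?(ltnW Ul)// mulrBl divff// -muln2 natrM; ring.
have c : (q.2%:R / Num.sqrt q.1%:R) / ((q.1 - (cutoff q.1).*2)%:R / q.1%:R)
    @[q --> near_peak] --> rho^-1.
  rewrite -[X in _ --> X]divr1; apply: cvgM; first exact: near_peak_sqrt.
  by apply: cvgV; first exact: oner_neq0.
have h1 : \forall q \near near_peak, `|1 - (q.1 - (cutoff q.1).*2)%:R / q.1%:R : R| <= 2^-1.
  by move/cvgrPdist_le : cV; apply; rewrite invr_gt0.
have h2 : \forall q \near near_peak, `|0 - q.2%:R / q.1%:R : R| <= 2^-1.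
  by move/cvgrPdist_le : near_peak_quot; apply; rewrite invr_gt0.
have h3 : \forall q \near near_peak, (0 < q.1)%N.
  by apply: (@near_peak_fst R rho (fun T => (0 < T)%N)); exact: nbhs_infty_gt.
apply: (cvg_near_eq _ c); near=> q.
have T0 : 0 < q.1%:R :> R by rewrite ltr0n; near: q.
have : `|1 - (q.1 - (cutoff q.1).*2)%:R / q.1%:R : R| <= 2^-1 by near: q.
have : `|0 - q.2%:R / q.1%:R : R| <= 2^-1 by near: q.
rewrite sub0r normrN ger0_norm ?divr_ge0// ler_pdivrMr// => k1.
rewrite ler_distlC => /andP[+ _]; rewrite ler_pdivlMr// => k2.
have V0 : 0 < (q.1 - (cutoff q.1).*2)%:R :> R by lra.
rewrite /row_ratio max_r; last by rewrite subr_ge0 ler_pdivrMr// mul1r; lra.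
have s2 : q.1%:R = Num.sqrt q.1%:R ^+ 2 :> R by rewrite sqr_sqrtr.
have s0 : 0 < Num.sqrt q.1%:R :> R by rewrite sqrtr_gt0.
rewrite subKr invf_div.
move: ((q.1 - (cutoff q.1).*2)%:R) V0 => V V0.
move: (q.1%:R) (Num.sqrt q.1%:R) (q.2%:R) s2 s0 => t s j -> s0.
by field; rewrite !lt0r_neq0.
Unshelve. all: by end_near. Qed.

Lemma near_peak_lower_weight :
  lower_weight q.1 q.2 * (2 / (rho * Num.sqrt q.1%:R)) @[q --> near_peak] --> (1 : R).
Proof.
have cq : decay q.1 @[q --> near_peak] --> (1 : R).
  exact: (@near_peak_cvg_fst R rho _ decay _ decay_cvg1).
have cqr : Num.sqrt q.1%:R * (1 - decay q.1) @[q --> near_peak] --> rho^-1.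
  exact: (@near_peak_cvg_fst R rho _ (fun T => Num.sqrt T%:R * (1 - decay T)) _ decay_rate).
have cqU : decay q.1 ^+ cutoff q.1 @[q --> near_peak] --> (0 : R).
  exact: (@near_peak_cvg_fst R rho _ (fun T => decay T ^+ cutoff T) _ decay_pow_cutoff).
pose z q := row_ratio q.1 q.2 * decay q.1.
have z0 q : 0 <= z q.
  by rewrite mulr_ge0 ?decay_ge0//; case/andP: (row_ratio_bounds R q.1 q.2).
have zq q : z q <= decay q.1.
  by rewrite ler_piMl ?decay_ge0//; case/andP: (row_ratio_bounds R q.1 q.2).
have czU : z q ^+ cutoff q.1 @[q --> near_peak] --> (0 : R).
  apply: (squeeze_cvgr _ (cvg_cst (0 : R)) cqU); near=> q.
  by rewrite exprn_ge0//=; apply: lerXn2r; rewrite ?nnegrE ?decay_ge0.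
have czr : Num.sqrt q.1%:R * (1 - z q) @[q --> near_peak] --> rho^-1 + rho^-1.
  have -> : (fun q => Num.sqrt q.1%:R * (1 - z q)) = (fun q =>
     Num.sqrt q.1%:R * (1 - decay q.1) +
     decay q.1 * (Num.sqrt q.1%:R * (1 - row_ratio q.1 q.2))).
    by apply/funext => q; rewrite /z; ring.
  apply: cvgD => //; rewrite -[X in _ --> X]mul1r; apply: cvgM => //.
  exact: near_peak_row_ratio.
have rn : rho != 0 by exact: lt0r_neq0.
(* The summed geometric series, with each of [1 - decay] and [1 - z] scaled by [sqrt T]; the scaled
   quantities tend to [1 / rho] and [2 / rho]. *)
pose G q := (1 - z q ^+ cutoff q.1) ^+ 2 / (1 - (decay q.1 ^+ cutoff q.1) ^+ 2) *
  ((Num.sqrt q.1%:R * (1 - decay q.1)) * (1 + decay q.1) /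
   (Num.sqrt q.1%:R * (1 - z q)) ^+ 2) * (2 / rho).
have cG : G q @[q --> near_peak] --> (1 : R).
  rewrite [X in _ --> X](_ : _ = (1 - 0) ^+ 2 / (1 - 0 ^+ 2) *
    (rho^-1 * (1 + 1) / (rho^-1 + rho^-1) ^+ 2) * (2 / rho)); last by field.
  have c1 : 1 - z q ^+ cutoff q.1 @[q --> near_peak] --> (1 - 0 : R).
    by apply: cvgB; first exact: cvg_cst.
  apply: cvgM; last exact: cvg_cst.
  apply: cvgM.
    apply: cvgM; first by rewrite expr2; apply: cvgM.
    apply: cvgV; first by rewrite expr0n subr0 oner_neq0.
    by apply: cvgB; [exact: cvg_cst|rewrite expr2; apply: cvgM].
  apply: cvgM.
    by apply: cvgM => //; apply: cvgD => //; exact: cvg_cst.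
  apply: cvgV; last by rewrite expr2; apply: cvgM.
  by rewrite expf_neq0// -mulr2n mulrn_eq0/= invr_eq0.
have h3 : \forall q \near near_peak, (0 < cutoff q.1)%N.
  apply: (@near_peak_fst R rho (fun T => (0 < cutoff T)%N)); near=> n.
  have n1 : 1 <= n%:R :> R by rewrite ler1n; near: n; exact: nbhs_infty_gt.
  have s1 : 1 <= Num.sqrt n%:R :> R by rewrite -[leLHS]sqrtr1 ler_wsqrtr.
  have s2 : 1 <= Num.sqrt (Num.sqrt n%:R) :> R by rewrite -[leLHS]sqrtr1 ler_wsqrtr.
  by rewrite /cutoff truncn_gt0 mulr_ege1.
have h4 : \forall q \near near_peak, (0 < q.1)%N.
  by apply: (@near_peak_fst R rho (fun T => (0 < T)%N)); exact: nbhs_infty_gt.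
apply: (cvg_near_eq _ cG); near=> q.
have U0 : (0 < cutoff q.1)%N by near: q.
have s0 : 0 < Num.sqrt q.1%:R :> R by rewrite sqrtr_gt0 ltr0n; near: q.
have d1 := decay_lt1 q.1; have d0 := decay_ge0 q.1.
have z1 : z q < 1 := le_lt_trans (zq q) d1.
rewrite /lower_weight -/(z q) !geometric_sum ?lt_eqF// ?expr_lt1// /G.
rewrite -[(decay q.1 ^+ cutoff q.1) ^+ 2]exprM mulnC exprM.
have dU : (decay q.1 ^+ 2) ^+ cutoff q.1 < 1.
  by rewrite exprn_ilt1 ?exprn_ge0// ?expr_lt1// -lt0n.
have n2 : 1 - decay q.1 ^+ 2 != 0 by rewrite subr_eq0 eq_sym lt_eqF// expr_lt1.
move: (Num.sqrt q.1%:R) (z q) (decay q.1) (z q ^+ cutoff q.1)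
  ((decay q.1 ^+ 2) ^+ cutoff q.1) dU n2 z1 s0 => s zz d Z D D1 n2 z1 s0.
have n1 : 1 - D != 0 by rewrite subr_eq0 eq_sym lt_eqF.
have n3 : 1 - zz != 0 by rewrite subr_eq0 eq_sym lt_eqF.
by field; rewrite n1 n2 n3 rn lt0r_neq0.
Unshelve. all: by end_near. Qed.

End WeightLimits.

(** * Spectral bounds for the Hankel matrices *)

(** By Lagrange's identity. *)
Lemma cauchy_schwarz_sum (R : realType) (I : finType) (P : pred I) (a b : I -> R) :
  (\sum_(i | P i) a i * b i) ^+ 2 <=
  (\sum_(i | P i) a i ^+ 2) * (\sum_(i | P i) b i ^+ 2).
Proof.
have h : 0 <= \sum_(i | P i) \sum_(j | P j) (a i * b j - a j * b i) ^+ 2.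
  by apply: sumr_ge0 => i _; apply: sumr_ge0 => j _; exact: sqr_ge0.
suff e : \sum_(i | P i) \sum_(j | P j) (a i * b j - a j * b i) ^+ 2 =
    2 * ((\sum_(i | P i) a i ^+ 2) * (\sum_(i | P i) b i ^+ 2)
         - (\sum_(i | P i) a i * b i) ^+ 2).
  by move: h; rewrite e pmulr_rge0// subr_ge0.
pose A := \sum_(i | P i) a i ^+ 2; pose B := \sum_(i | P i) b i ^+ 2.
pose C := \sum_(i | P i) a i * b i.
transitivity (\sum_(i | P i) (a i ^+ 2 * B + b i ^+ 2 * A - 2 * (a i * b i) * C)).
  apply: eq_bigr => i _; rewrite /A /B /C !mulr_sumr -big_split -sumrB.
  by apply: eq_bigr => j _ /=; ring.
rewrite sumrB big_split /= -!mulr_suml -mulr_sumr -/A -/B -/C; ring.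
Qed.

Section HankelBounds.
Variables (R : realType) (rho : R).
Hypothesis rho_gt0 : 0 < rho.
Local Notation habs := (habs rho).
Local Notation B := (hankelB rho).

Lemma hankelB_sym T : (B T)^T = B T.
Proof. by apply/matrixP => i j; rewrite !mxE addnC. Qed.

Definition hmx T : 'M[R]_T.+1 := \matrix_(n, j) hcoef rho n j.

Lemma hmx_orthonormal T : hmx T *m B T *m (hmx T)^T = 1%:M.
Proof.
exact: (hcoef_orthonormal rho_gt0 (gauss_moment0 rho_gt0) (gauss_moment1 rho_gt0)
  (gauss_momentS rho_gt0)).
Qed.

Lemma hmx_unit T : hmx T \in unitmx.
Proof.
by have := hmx_orthonormal T; rewrite -mulmxA => /mulmx1_unit[].
Qed.

Lemma qform1E n (v : 'rV[R]_n) : qform 1%:M v = \sum_j v 0 j ^+ 2.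
Proof.
by rewrite /qform mulmx1 mxE; apply: eq_bigr => j _; rewrite mxE expr2.
Qed.

(** In the coordinates [v = y C] the Rayleigh quotient of [B] becomes [|y|^2 / |y C|^2], so
    [lambda_min] is estimated through the size of [y C], and [B] is never inverted. *)
Lemma qform_hmx T (y : 'rV[R]_T.+1) : qform (B T) (y *m hmx T) = qform 1%:M y.
Proof.
by rewrite /qform trmx_mul -[in RHS](hmx_orthonormal T) !mulmxA.
Qed.

Lemma qform_hankelB_ge0 T (v : 'rV[R]_T.+1) : 0 <= qform (B T) v.
Proof.
rewrite -[v](mulmxKV (hmx_unit T)) qform_hmx qform1E.
by apply: sumr_ge0 => j _; exact: sqr_ge0.
Qed.

Lemma eigval_hankelB_ge0 T i : (i <= T)%N -> 0 <= eigval (B T) i.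
Proof.
move=> iT; apply: eigval_ge_qform => //; first exact: hankelB_sym.
by move=> v; rewrite mul0r qform_hankelB_ge0.
Qed.

Lemma hcoef_sq n j : hcoef rho n j ^+ 2 = habs n j ^+ 2.
Proof. by rewrite hcoefE// exprMn -exprM mulnC exprM sqrrN expr1n expr1n mul1r. Qed.

Lemma hcoef_parity n j : odd n != odd j -> hcoef rho n j = 0.
Proof.
move=> o; apply/eqP; rewrite -sqrf_eq0 hcoef_sq sqrf_eq0.
by apply/negPn/negP => /habs_neq0; lia.
Qed.

Definition weighted_row (W : nat -> nat -> R) T : R :=
  \sum_(j < T.+1 | odd j == odd T) habs T j ^+ 2 * W T j.

Lemma parity_block_le T : \sum_(j < T.+1 | odd j == odd T)
  \sum_(n < T.+1 | odd n == odd T) habs n j ^+ 2 <= weighted_row (@upper_weight R) T.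
Proof.
apply: ler_sum => j _; rewrite mulrC; apply: habs_sq_column => //.
by have := ltn_ord j; lia.
Qed.

(** Index [T + 1] has the other parity and drops out. With [T - 1] for [T], this bounds the second
    parity block of [B_T^-1]. *)
Lemma parity_block_pred_le T : \sum_(j < T.+2 | odd j == odd T)
  \sum_(n < T.+2 | odd n == odd T) habs n j ^+ 2 <= weighted_row (@upper_weight R) T.
Proof.
have drop (g : nat -> R) : \sum_(n < T.+2 | odd n == odd T) g n =
    \sum_(n < T.+1 | odd n == odd T) g n.
  rewrite big_mkcond big_ord_recr /= -big_mkcond /=.
  by rewrite ifN ?addr0//; case: (odd T).
rewrite (drop (fun j => \sum_(n < T.+2 | odd n == odd T) habs n j ^+ 2)).
under eq_bigr => j _ do rewrite (drop (fun n => habs n j ^+ 2)).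
exact: parity_block_le.
Qed.

(** For [v = y C], Cauchy-Schwarz within the parity of [j] bounds each [v_j^2]; summing over [j]
    produces the trace of a block times the part of [|y|^2] of that parity. *)
Lemma lambda_min_ge T (S : R) : (0 < T)%N -> 0 < S ->
  weighted_row (@upper_weight R) T <= S -> weighted_row (@upper_weight R) T.-1 <= S ->
  1 <= S * lambda_min (B T).
Proof.
move=> T0 S0 h1 h2; rewrite mulrC -ler_pdivrMr// mul1r.
apply: eigval_ge_qform => //; first exact: hankelB_sym.
move=> v; rewrite ler_pdivrMl//.
have [y vE] : exists y, v = y *m hmx T.
  by exists (v *m invmx (hmx T)); rewrite mulmxKV ?hmx_unit.
rewrite {2}vE qform_hmx !qform1E.
have vj (j : 'I_T.+1) : v 0 j ^+ 2 <= (\sum_(n < T.+1 | odd n == odd j) habs n j ^+ 2) *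
    (\sum_(n < T.+1 | odd n == odd j) y 0 n ^+ 2).
  have -> : v 0 j = \sum_(n < T.+1 | odd n == odd j) hcoef rho n j * y 0 n.
    rewrite vE mxE [RHS]big_mkcond; apply: eq_bigr => n _; rewrite mxE mulrC.
    by case: ifPn => // o; rewrite hcoef_parity// mul0r.
  apply: le_trans (cauchy_schwarz_sum _ _ _) _.
  by under eq_bigr do rewrite hcoef_sq.
pose Sb b := \sum_(j < T.+1 | odd j == b) \sum_(n < T.+1 | odd n == b) habs n j ^+ 2.
pose Yb b := \sum_(n < T.+1 | odd n == b) y 0 n ^+ 2.
have SbS b : Sb b <= S.
  case: (eqVneq b (odd T)) => [->|bT]; first exact: le_trans (parity_block_le T) h1.
  have -> : b = odd T.-1 by lia.
  by apply: le_trans h2; have := parity_block_pred_le T.-1; rewrite prednK.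
have split (g : 'I_T.+1 -> R) : \sum_j g j =
    \sum_(j < T.+1 | odd j == true) g j + \sum_(j < T.+1 | odd j == false) g j.
  rewrite (bigID (fun j : 'I_T.+1 => odd j)) /=; congr (_ + _); apply: eq_bigl => j.
    by rewrite eqb_id.
  by rewrite eqbF_neg.
have Yb0 b : 0 <= Yb b by apply: sumr_ge0 => n _; exact: sqr_ge0.
have half b : \sum_(j < T.+1 | odd j == b) v 0 j ^+ 2 <= S * Yb b.
  apply: (@le_trans _ _ (Sb b * Yb b)); last by rewrite ler_wpM2r.
  rewrite /Sb mulr_suml; apply: ler_sum => j /eqP jb.
  by apply: le_trans (vj j) _; rewrite jb.
by rewrite !split mulrDr lerD.
Qed.

(** The trial vector [y C], with [y] supported on the degrees [T - 2u], [u < cutoff]; only its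
    entries of the parity of [T] are used. *)
Lemma lambda_min_le T : ((cutoff R T).*2 < T)%N -> (0 < cutoff R T)%N ->
  lambda_min (B T) * weighted_row (lower_weight rho) T <= 1.
Proof.
move=> UT U0; set U := cutoff R T; set q := decay rho T.
have q0 : 0 <= q := decay_ge0 rho_gt0 T.
(* Written as a sum over [u] instead of solving [n = T - 2u], so that any sum against it becomes a
   sum over [u]. *)
pose yv (n : nat) : R := \sum_(u < U) (T - u.*2 == n)%N%:R * ((-1) ^+ u * q ^+ u).
pose y : 'rV[R]_T.+1 := \row_n yv n.
have sel (g : nat -> R) : \sum_(n < T.+1) yv n * g n =
    \sum_(u < U) ((-1) ^+ u * q ^+ u) * g (T - u.*2)%N.
  rewrite /yv; under eq_bigr do rewrite mulr_suml.
  rewrite exchange_big; apply: eq_bigr => u _ /=.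
  have ltu : (T - u.*2 < T.+1)%N by lia.
  rewrite (bigD1 (Ordinal ltu))//= eqxx mul1r big1 ?addr0// => n nn.
  have -> : (T - u.*2 == n)%N = false.
    by apply/negbTE; apply: contra nn => /eqP e; apply/eqP/val_inj.
  by rewrite !mul0r.
have yvE (u : 'I_U) : yv (T - u.*2)%N = (-1) ^+ u * q ^+ u.
  rewrite /yv (bigD1 u)//= eqxx mul1r big1 ?addr0// => u' uu.
  have -> : (T - u'.*2 == T - u.*2)%N = false.
    apply/negbTE; apply: contra uu => /eqP e; apply/eqP/val_inj.
    by have := ltn_ord u; have := ltn_ord u'; rewrite /= -/U in UT *; lia.
  by rewrite mul0r.
pose Q := \sum_(u < U) (q ^+ 2) ^+ u.
have yy : qform 1%:M y = Q.
  rewrite qform1E; under eq_bigr do rewrite mxE expr2.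
  rewrite (sel yv); apply: eq_bigr => u _; rewrite yvE -expr2 exprMn.
  by rewrite sqrr_sign mul1r -!exprM mulnC.
have Q0 : 0 < Q.
  rewrite /Q -/U in U0 *; case: (U) U0 => // U' _.
  rewrite big_ord_recl expr0 ltr_pwDl// sumr_ge0// => u _.
  by rewrite exprn_ge0// sqr_ge0.
have l0 : 0 <= lambda_min (B T) by exact: eigval_hankelB_ge0.
have /andP[+ _] := qform_bounds (hankelB_sym T) (y *m hmx T).
rewrite qform_hmx yy /= -/(lambda_min (B T)) => h.
rewrite -(ler_pM2r Q0) mul1r; apply: le_trans h; rewrite -mulrA ler_wpM2l//.
rewrite qform1E /weighted_row mulr_suml big_mkcond; apply: ler_sum => j _.
case: ifPn => [/eqP jT|_]; last exact: sqr_ge0.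
have -> : (y *m hmx T) 0 j ^+ 2 = (\sum_(u < U) q ^+ u * habs (T - u.*2) j) ^+ 2.
  have -> : (y *m hmx T) 0 j = (-1) ^+ (T - j)./2 * \sum_(u < U) q ^+ u * habs (T - u.*2) j.
    rewrite mxE; under eq_bigr do rewrite !mxE.
    rewrite (sel (fun n => hcoef rho n j)) mulr_sumr; apply: eq_bigr => u _.
    rewrite hcoefE//.
    have [->|hn] := eqVneq (habs (T - u.*2) j) 0; first by rewrite !mulr0.
    have /andP[ju _] := habs_neq0 rho_gt0 hn.
    (* The sign [(-1)^u] compensates that of [hcoef] at degree [T - 2u]: the product does not depend
       on [u], so no cancellation occurs within a column. *)
    have -> : ((T - j)./2 = u + (T - u.*2 - j)./2)%N by have := ltn_ord u; lia.
    by rewrite exprD; ring.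
  by rewrite exprMn sqrr_sign mul1r.
set r := row_ratio R T j; have /andP[r0 _] : 0 <= r <= 1 := row_ratio_bounds R T j.
have -> : habs T j ^+ 2 * lower_weight rho T j * Q =
    (\sum_(u < U) (r * q) ^+ u * habs T j) ^+ 2.
  rewrite /lower_weight -/U -/q -/Q -/r -mulr_suml exprMn.
  by rewrite mulrA divfK ?lt0r_neq0// mulrC.
have t0 (u : 'I_U) : 0 <= (r * q) ^+ u * habs T j.
  by apply: mulr_ge0; [apply: exprn_ge0; exact: mulr_ge0|exact: habs_ge0].
have t1 (u : 'I_U) : (r * q) ^+ u * habs T j <= q ^+ u * habs (T - u.*2) j.
  rewrite exprMn (mulrC (r ^+ u)) -mulrA ler_wpM2l ?exprn_ge0//.
  apply: habs_ge_ratio => //; first by rewrite subn_gt0.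
  by have := ltn_ord u; rewrite -/U in UT *; lia.
apply: lerXn2r; rewrite ?nnegrE; last by apply: ler_sum => u _; exact: t1.
  by apply: sumr_ge0 => u _; exact: t0.
by apply: sumr_ge0 => u _; exact: le_trans (t0 u) (t1 u).
Qed.

Definition even_moment t := gauss_moment rho t.*2.

Lemma even_moment0 : even_moment 0 = 1. Proof. exact: gauss_moment0. Qed.

Lemma even_momentS t : even_moment t.+1 = t.*2.+1%:R * rho ^+ 2 * even_moment t.
Proof. by rewrite /even_moment doubleS gauss_momentS. Qed.

Lemma tr_hankelB T : \tr (B T) = \sum_(i < T.+1) even_moment i.
Proof. by apply: eq_bigr => i _; rewrite mxE addnn. Qed.

Lemma lambda_max_bounds T : even_moment T <= lambda_max (B T) <= \tr (B T).
Proof.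
apply/andP; split.
  have /andP[_] := qform_bounds (hankelB_sym T) (delta_mx 0 ord_max).
  have -> : qform (B T) (delta_mx 0 ord_max) = even_moment T.
    by rewrite /qform -rowE trmx_delta -colE !mxE addnn.
  have -> : qform 1%:M (delta_mx 0 ord_max : 'rV[R]_T.+1) = 1.
    by rewrite /qform -rowE trmx_delta -colE !mxE eqxx.
  by rewrite mulr1.
rewrite -(sum_eigval (hankelB_sym T)) big_ord_recl /= lerDl sumr_ge0// => i _.
by apply: eigval_hankelB_ge0; have := ltn_ord i; rewrite /bump; lia.
Qed.

End HankelBounds.

(** * Asymptotics *)

Section LambdaMin.
Variables (R : realType) (rho : R).
Hypothesis rho_gt0 : 0 < rho.
Local Notation B := (hankelB rho).
Local Notation near_peak := (near_peak rho).
Local Notation pexp := (peak_exp rho).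
Local Notation ppos := (peak_pos rho).
Local Notation weighted_row := (weighted_row rho).

#[local] Instance near_peak_filter_inst' : Filter near_peak := near_peak_filter rho_gt0.

Definition target (T : nat) : R :=
  2 `^ (5 / 2) * pi * T%:R `^ (1 / 4) / rho `^ (3 / 2)
    * expR ((2 * rho ^+ 2)^-1 - 2 * Num.sqrt T%:R / rho).

Lemma targetE T : target T = 4 * Num.sqrt 2 * pi * Num.sqrt (Num.sqrt T%:R) /
  (rho * Num.sqrt rho) * expR ((2 * rho ^+ 2)^-1) * expR (- pexp T).
Proof.
rewrite /target expRD /peak_exp.
have -> : 2 `^ (5 / 2) = 4 * Num.sqrt 2 :> R.
  have -> : 5 / 2 = 2 + 2^-1 :> R by field.
  rewrite powRD; last by rewrite pnatr_eq0 implybT.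
  by rewrite powR12_sqrt// powR_mulrn// -natrX.
have -> : T%:R `^ (1 / 4) = Num.sqrt (Num.sqrt T%:R) :> R.
  have -> : 1 / 4 = 2^-1 * 2^-1 :> R by field.
  by rewrite powRrM !powR12_sqrt.
have -> : rho `^ (3 / 2) = rho * Num.sqrt rho.
  have -> : 3 / 2 = 1 + 2^-1 :> R by field.
  rewrite powRD; last by rewrite (gt_eqF rho_gt0) implybT.
  by rewrite powR12_sqrt ?powRr1// ltW.
by rewrite !mulrA.
Qed.

Lemma target_gt0 T : (0 < T)%N -> 0 < target T.
Proof.
move=> T0; rewrite targetE.
by rewrite !(mulr_gt0, divr_gt0, invr_gt0, expR_gt0, sqrtr_gt0, pi_gt0, ltr0n).
Qed.

(** The inverse of [target] in factors by origin: the limit of [ffrac], the two central binomial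
    coefficients, the geometric sum over degrees, and the total mass [expR y / 4] of one parity. *)
Lemma target_norm T : (0 < T)%N -> target T =
  expR ((2 * rho ^+ 2)^-1) * Num.sqrt (pi * T%:R / 2) * Num.sqrt (pi * ppos T) *
  (2 / (rho * Num.sqrt T%:R)) / (expR (pexp T) / 4).
Proof.
move=> T0; have pi0 := @pi_ge0 R; have pip := @pi_gt0 R.
have sT : 0 < Num.sqrt T%:R :> R by rewrite sqrtr_gt0 ltr0n.
have sr : 0 < Num.sqrt rho by rewrite sqrtr_gt0.
have s2 : 0 < Num.sqrt 2 :> R by rewrite sqrtr_gt0.
have e2 : Num.sqrt 2 ^+ 2 = 2 :> R by rewrite sqr_sqrtr.
have epi : Num.sqrt pi ^+ 2 = pi :> R by rewrite sqr_sqrtr.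
have spi : 0 < Num.sqrt pi :> R by rewrite sqrtr_gt0.
rewrite targetE expRN /peak_pos.
have -> : Num.sqrt (pi * T%:R / 2) = Num.sqrt pi * Num.sqrt T%:R / Num.sqrt 2 :> R.
  by rewrite sqrtrM ?mulr_ge0// sqrtrM// sqrtrV.
have -> : Num.sqrt (pi * (Num.sqrt T%:R / rho)) =
    Num.sqrt pi * Num.sqrt (Num.sqrt T%:R) / Num.sqrt rho :> R.
  by rewrite mulrA sqrtrM ?mulr_ge0// sqrtrM// sqrtrV// ltW.
rewrite -{1}epi.
have ey := expR_gt0 (pexp T).
have -> : 4 * Num.sqrt 2 = 8 / Num.sqrt 2 :> R.
  apply: (mulIf (lt0r_neq0 s2)); rewrite divfK ?lt0r_neq0// -mulrA -expr2 e2; ring.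
move: (Num.sqrt pi) (Num.sqrt (Num.sqrt T%:R)) (Num.sqrt 2) s2 (Num.sqrt rho) sr (expR (pexp T)) ey.
move: (Num.sqrt T%:R) sT (expR _) => st sT E p sst q2 s2 sr' sr ey' ey.
by field; rewrite !lt0r_neq0.
Qed.

Lemma cbin_bounds m : 0 <= @cbin R m <= 1.
Proof. by rewrite ltW ?cbin_gt0 ?cbin_le1. Qed.

Lemma weighted_row_asymp (W : nat -> nat -> R) :
  (\forall T \near \oo, forall j, (j <= T)%N -> 0 <= W T j <= T.+1%:R ^+ 2) ->
  W q.1 q.2 * (2 / (rho * Num.sqrt q.1%:R)) @[q --> near_peak] --> (1 : R) ->
  weighted_row W T * target T @[T --> \oo] --> (1 : R).
Proof.
move=> Wb Wc; have pi0 := @pi_ge0 R.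
pose inrm T : R := expR ((2 * rho ^+ 2)^-1) * Num.sqrt (pi * T%:R / 2) *
  Num.sqrt (pi * ppos T) * (2 / (rho * Num.sqrt T%:R)).
pose phi T j : R := ffrac R T j * cbin (T - j)./2 * cbin j * W T j * inrm T.
(* The factor [1 + pi / rho] comes from [sqrt x <= 1 + x] at [x = pi * ppos T], with
   [sqrt T <= T + 1]. *)
pose K : R := expR ((2 * rho ^+ 2)^-1) * Num.sqrt (pi / 2) * (1 + pi / rho) * (2 / rho).
have inrm_bound T : (0 < T)%N -> 0 <= inrm T <= K * T.+1%:R.
  move=> T0; have sT : 0 < Num.sqrt T%:R :> R by rewrite sqrtr_gt0 ltr0n.
  have -> : inrm T = expR ((2 * rho ^+ 2)^-1) * Num.sqrt (pi / 2) *
      Num.sqrt (pi * ppos T) * (2 / rho).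
    have sE : Num.sqrt (pi * T%:R / 2) = Num.sqrt (pi / 2) * Num.sqrt T%:R :> R.
      by rewrite mulrAC sqrtrM ?divr_ge0.
    rewrite /inrm sE.
    move: (expR _) (Num.sqrt (pi / 2)) (Num.sqrt (pi * ppos T)) => a b c.
    by field; rewrite !lt0r_neq0.
  rewrite /K; set A := expR _ * Num.sqrt (pi / 2).
  have A0 : 0 <= A := mulr_ge0 (expR_ge0 _) (sqrtr_ge0 _).
  have r0 : 0 <= 2 / rho by rewrite divr_ge0// ltW.
  rewrite (mulr_ge0 (mulr_ge0 A0 (sqrtr_ge0 _)) r0) /=.
  have -> : A * (1 + pi / rho) * (2 / rho) * T.+1%:R =
      A * ((1 + pi / rho) * T.+1%:R) * (2 / rho) by ring.
  rewrite ler_wpM2r// ler_wpM2l//.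
  have sle (x : R) : 0 <= x -> Num.sqrt x <= 1 + x.
    move=> x0; rewrite -[leRHS]ger0_norm ?addr_ge0// -sqrtr_sqr ler_wsqrtr//.
    by rewrite sqrrD expr1n mul1r; have := sqr_ge0 x; lra.
  apply: le_trans (sle _ _) _; first by rewrite mulr_ge0// peak_pos_ge0.
  have T1 : 1 <= T.+1%:R :> R by rewrite ler1n.
  have st : Num.sqrt T%:R <= T.+1%:R :> R.
    by apply: le_trans (sle _ _) _; rewrite // nat1r.
  rewrite [leRHS]mulrDl mul1r lerD// /peak_pos mulrA mulrAC.
  by rewrite ler_wpM2l// divr_ge0// ltW.
(* Degree 3: two for the bound on [W], one for [inrm]. *)
have c := @evw_concentration R rho rho_gt0 phi K 3.
have {}c : (\sum_(j < T.+1 | odd j == odd T) evw (pexp T) j * phi T j) /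
    (expR (pexp T) / 4) @[T --> \oo] --> (1 : R).
  apply: c.
    near=> T => j jT.
    have T0 : (0 < T)%N by near: T; exact: nbhs_infty_gt.
    have /andP[i0 iK] := inrm_bound T T0.
    have /andP[W0 WT] : 0 <= W T j <= T.+1%:R ^+ 2.
      by move: j jT; near: T.
    have /andP[f0 f1] := ffrac_bounds R jT.
    have /andP[a0 a1] := cbin_bounds (T - j)./2; have /andP[b0 b1] := cbin_bounds j.
    rewrite /phi.
    move: (inrm T) (ffrac R T j) (cbin (T - j)./2) (cbin j) (W T j)
      i0 iK W0 WT f0 f1 a0 a1 b0 b1 => I f a b w i0 iK w0 wT f0 f1 a0 a1 b0 b1.
    have fab0 : 0 <= f * a * b := mulr_ge0 (mulr_ge0 f0 a0) b0.
    have fab1 : f * a * b <= 1 := mulr_ile1 (mulr_ge0 f0 a0) b0 (mulr_ile1 f0 a0 f1 a1) b1.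
    rewrite ger0_norm; last exact: mulr_ge0 (mulr_ge0 fab0 w0) i0.
    have -> : K * T.+1%:R ^+ 3 = T.+1%:R ^+ 2 * (K * T.+1%:R) by rewrite (exprS _ 2); ring.
    apply: ler_pM => //; first exact: mulr_ge0 fab0 w0.
    by apply: le_trans wT; rewrite ler_piMl.
  have cc : (ffrac R q.1 q.2 * expR ((2 * rho ^+ 2)^-1)) *
     (cbin (q.1 - q.2)./2 * Num.sqrt (pi * q.1%:R / 2)) *
     (cbin q.2 * Num.sqrt (pi * ppos q.1)) *
     (W q.1 q.2 * (2 / (rho * Num.sqrt q.1%:R))) @[q --> near_peak] --> (1 : R).
    rewrite [X in _ --> X](_ : _ = (expR (- (2 * rho ^+ 2)^-1) *
      expR ((2 * rho ^+ 2)^-1)) * 1 * 1 * 1); last first.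
      by rewrite !mulr1 expRN mulVf// lt0r_neq0// expR_gt0.
    apply: cvgM; last exact: Wc.
    apply: cvgM; last exact: near_peak_cbin_snd.
    apply: cvgM; last exact: near_peak_cbin_half.
    by apply: cvgM; [exact: near_peak_ffrac|exact: cvg_cst].
  apply: (cvg_near_eq _ cc); near=> q.
  by rewrite /phi /inrm; ring.
apply: (cvg_near_eq _ c); near=> T.
have T0 : (0 < T)%N by near: T; exact: nbhs_infty_gt.
rewrite target_norm// -/(inrm T) mulrA; congr (_ / _).
rewrite mulr_suml; apply: eq_bigr => j jT.
rewrite (habs_sq_weight rho_gt0) //; last by have := ltn_ord j; lia.
by rewrite /phi /evw; ring.
Unshelve. all: by end_near. Qed.

Lemma upper_row_asymp :
  weighted_row (@upper_weight R) T * target T @[T --> \oo] --> (1 : R).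
Proof.
apply: weighted_row_asymp; last exact: near_peak_upper_weight.
by near=> T => j jT; rewrite upper_weight_ge0// upper_weight_le.
Unshelve. all: by end_near. Qed.

Lemma lower_row_asymp :
  weighted_row (lower_weight rho) T * target T @[T --> \oo] --> (1 : R).
Proof.
apply: weighted_row_asymp; last exact: near_peak_lower_weight.
near=> T => j jT; have UT : ((cutoff R T).*2 < T)%N by near: T; exact: cutoff_lt.
rewrite /lower_weight; set U := cutoff R T in UT *; set q := decay rho T.
have q0 : 0 <= q := decay_ge0 rho_gt0 T.
have q1 : q <= 1 := ltW (decay_lt1 rho_gt0 T).
set r := row_ratio R T j; have /andP[r0 r1] : 0 <= r <= 1 := row_ratio_bounds R T j.
apply/andP; split.
  by rewrite divr_ge0 ?sqr_ge0// sumr_ge0// => u _; rewrite exprn_ge0// sqr_ge0.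
case: (posnP U) => [->|U0]; first by rewrite !big_ord0 invr0 mulr0 exprn_ge0.
have d1 : 1 <= \sum_(u < U) (q ^+ 2) ^+ u.
  case: (U) U0 => // U' _; rewrite big_ord_recl expr0 lerDl sumr_ge0// => u _.
  by rewrite exprn_ge0// sqr_ge0.
have n0 : 0 <= \sum_(u < U) (r * q) ^+ u.
  by apply: sumr_ge0 => u _; rewrite exprn_ge0// mulr_ge0.
have nU : \sum_(u < U) (r * q) ^+ u <= T.+1%:R.
  apply: (@le_trans _ _ (\sum_(u < U) 1)).
    by apply: ler_sum => u _; apply: exprn_ile1; [exact: mulr_ge0|exact: mulr_ile1].
  by rewrite sumr_const card_ord ler_nat; lia.
apply: (@le_trans _ _ ((\sum_(u < U) (r * q) ^+ u) ^+ 2)).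
  by rewrite ler_pdivrMr ?(lt_le_trans ltr01)// ler_peMr// sqr_ge0.
by apply: lerXn2r; rewrite ?nnegrE.
Unshelve. all: by end_near. Qed.

(** Makes the block of the other parity, whose top degree is [T - 1], comparable with [target T]. It
    rests on [sqrt (n + 1) - sqrt n] tending to 0. *)
Lemma target_shift : target n.+1 / target n @[n --> \oo] --> (1 : R).
Proof.
have c1 : Num.sqrt (Num.sqrt (1 + n%:R^-1)) @[n --> \oo] --> (1 : R).
  rewrite -[X in _ --> X]sqrtr1 -[X in _ --> Num.sqrt X]sqrtr1.
  apply: cvg_sqrt; apply: cvg_sqrt; rewrite -[X in _ --> X]addr0.
  apply: cvgD; first exact: cvg_cst.
  rewrite -[X in _ --> X](mulr0 0); under eq_fun do rewrite invr_sqrt.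
  by apply: cvgM; exact: cvg_inv_sqrt_nat.
have c2 : expR (- (2 / rho * (Num.sqrt n.+1%:R - Num.sqrt n%:R))) @[n --> \oo] --> (1 : R).
  rewrite -[X in _ --> X]expR0; apply: continuous_cvg; first exact: continuous_expR.
  rewrite -[X in _ --> X]oppr0; apply: cvgN.
  rewrite -[X in _ --> X](mulr0 (2 / rho)); apply: cvgM; first exact: cvg_cst.
  apply: (squeeze_cvgr _ (cvg_cst (0 : R)) (@cvg_inv_sqrt_nat R)); near=> n.
  have n0 : 0 < Num.sqrt n%:R :> R.
    by rewrite sqrtr_gt0 ltr0n; near: n; exact: nbhs_infty_gt.
  have e1 : Num.sqrt n%:R ^+ 2 = n%:R :> R by rewrite sqr_sqrtr.
  have e2 : Num.sqrt n.+1%:R ^+ 2 = n%:R + 1 :> R by rewrite sqr_sqrtr// natr1.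
  have le : Num.sqrt n%:R <= Num.sqrt n.+1%:R :> R by rewrite ler_wsqrtr// ler_nat.
  rewrite subr_ge0 le /= -[leRHS]mul1r ler_pdivlMr//.
  move: (Num.sqrt n%:R) (Num.sqrt n.+1%:R) n0 e1 e2 le => a b n0 e1 e2 le.
  have : (b - a) * (b + a) = 1 by rewrite -subr_sqr e1 e2; ring.
  nra.
apply: (@cvg_near_eq _ _ _ _ (fun n => Num.sqrt (Num.sqrt (1 + n%:R^-1)) *
  expR (- (2 / rho * (Num.sqrt n.+1%:R - Num.sqrt n%:R))))); last first.
  by rewrite -[X in _ --> X]mulr1; apply: cvgM.
near=> n.
have n0 : (0 < n)%N by near: n; exact: nbhs_infty_gt.
have t0 := target_gt0 n0.
apply: (mulIf (lt0r_neq0 t0)); rewrite [RHS]divfK ?lt0r_neq0//.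
have nR : 0 < n%:R :> R by rewrite ltr0n.
rewrite !targetE /peak_exp.
have -> : Num.sqrt (Num.sqrt n.+1%:R) =
    Num.sqrt (Num.sqrt (1 + n%:R^-1)) * Num.sqrt (Num.sqrt n%:R) :> R.
  rewrite -sqrtrM// -sqrtrM ?addr_ge0// mulrDl mul1r mulVf ?lt0r_neq0//.
  by rewrite natr1.
have -> : expR (- (2 * Num.sqrt n.+1%:R / rho)) =
  expR (- (2 / rho * (Num.sqrt n.+1%:R - Num.sqrt n%:R))) *
  expR (- (2 * Num.sqrt n%:R / rho)).
  by rewrite -expRD; congr expR; ring.
ring.
Unshelve. all: by end_near. Qed.

Lemma lambda_min_asymp : lambda_min (B T) / target T @[T --> \oo] --> (1 : R).
Proof.
pose up T := weighted_row (@upper_weight R) T.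
have cup : up T * target T @[T --> \oo] --> (1 : R) by exact: upper_row_asymp.
have cup1 : up T.-1 * target T @[T --> \oo] --> (1 : R).
  rewrite -cvg_shiftS /=.
  apply: (@cvg_near_eq _ _ _ _ (fun n => up n * target n * (target n.+1 / target n))); last first.
    rewrite -[X in _ --> X]mulr1; apply: cvgM => //; exact: target_shift.
  near=> n; have n0 : (0 < n)%N by near: n; exact: nbhs_infty_gt.
  have t0 := target_gt0 n0.
  by field; rewrite lt0r_neq0.
(* A common bound for both blocks, in place of their maximum; times [target] the difference vanishes
   in the limit. *)
pose S T := up T + `|up T.-1 - up T|.
have cS : S T * target T @[T --> \oo] --> (1 : R).
  apply: (@cvg_near_eq _ _ _ _ (fun T => up T * target T +
     `|up T.-1 * target T - up T * target T|)); last first.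
    rewrite -[X in _ --> X]addr0; apply: cvgD => //.
    rewrite -[X in _ --> X](@normr0 R R); apply: cvg_norm.
    by rewrite -[X in _ --> X](subrr 1); apply: cvgB.
  near=> n; have n0 : (0 < n)%N by near: n; exact: nbhs_infty_gt.
  by rewrite /S mulrDl -mulrBl normrM (ger0_norm (ltW (target_gt0 n0))).
have cl : (S T * target T)^-1 @[T --> \oo] --> (1 : R).
  by rewrite -[X in _ --> X]invr1; apply: cvgV => //; exact: oner_neq0.
have cu : (weighted_row (lower_weight rho) T * target T)^-1 @[T --> \oo] --> (1 : R).
  by rewrite -[X in _ --> X]invr1; apply: cvgV; [exact: oner_neq0|exact: lower_row_asymp].
have hS : \forall T \near \oo, `|1 - S T * target T| <= 2^-1.
  by move/cvgrPdist_le : cS; apply; rewrite invr_gt0.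
have hL : \forall T \near \oo, `|1 - weighted_row (lower_weight rho) T * target T| <= 2^-1.
  by move/cvgrPdist_le : lower_row_asymp; apply; rewrite invr_gt0.
apply: (squeeze_cvgr _ cl cu); near=> T.
have T0 : (0 < T)%N by near: T; exact: nbhs_infty_gt.
have t0 := target_gt0 T0.
have S0 : 0 < S T.
  have : `|1 - S T * target T| <= 2^-1 by near: T.
  by rewrite ler_distlC => /andP[h _]; rewrite -(pmulr_lgt0 _ t0); lra.
have L0 : 0 < weighted_row (lower_weight rho) T.
  have : `|1 - weighted_row (lower_weight rho) T * target T| <= 2^-1 by near: T.
  by rewrite ler_distlC => /andP[h _]; rewrite -(pmulr_lgt0 _ t0); lra.
have UT : ((cutoff R T).*2 < T)%N by near: T; exact: cutoff_lt.
have U0 : (0 < cutoff R T)%N.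
  have n1 : 1 <= T%:R :> R by rewrite ler1n.
  have s1 : 1 <= Num.sqrt T%:R :> R by rewrite -[leLHS]sqrtr1 ler_wsqrtr.
  have s2 : 1 <= Num.sqrt (Num.sqrt T%:R) :> R by rewrite -[leLHS]sqrtr1 ler_wsqrtr.
  by rewrite /cutoff truncn_gt0 mulr_ege1.
have h1 : 1 <= S T * lambda_min (B T).
  apply: lambda_min_ge => //; first by rewrite lerDl.
  by rewrite -lerBlDl ler_norm.
have h2 := lambda_min_le rho_gt0 UT U0.
rewrite (invfM (S T) (target T)).
rewrite (invfM (weighted_row (lower_weight rho) T) (target T)).
have ti0 : 0 <= (target T)^-1 by rewrite invr_ge0 ltW.
apply/andP; split; apply: ler_wpM2r => //.
- by rewrite -[leLHS]mulr1 ler_pdivrMl.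
- by rewrite -[leRHS]mul1r ler_pdivlMr.
Unshelve. all: by end_near. Qed.

Lemma lambda_max_trace : lambda_max (B T) / \tr (B T) @[T --> \oo] --> (1 : R).
Proof.
have cs := even_moment_sum_asymp rho_gt0 (even_moment0 rho_gt0) (even_momentS rho_gt0).
have cl : ((\sum_(i < T.+1) even_moment rho i) / even_moment rho T)^-1 @[T --> \oo] --> (1 : R).
  by rewrite -[X in _ --> X]invr1; apply: cvgV => //; exact: oner_neq0.
apply: (squeeze_cvgr _ cl (cvg_cst (1 : R))); near=> T.
have /andP[h1 h2] := lambda_max_bounds rho_gt0 T.
have m0 : 0 < even_moment rho T.
  exact: (even_moment_gt0 rho_gt0 (even_moment0 rho_gt0) (even_momentS rho_gt0)).
have tr0 : 0 < \tr (B T) := lt_le_trans m0 (le_trans h1 h2).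
rewrite invf_div -tr_hankelB ler_wpM2r ?invr_ge0 ?(ltW tr0)//=.
by rewrite ler_pdivrMr// mul1r.
Unshelve. all: by end_near. Qed.

Lemma lambda_max_asymp : lambda_max (B T) /
  (Num.sqrt 2 * (2 * rho ^+ 2 * T%:R / expR 1) ^+ T) @[T --> \oo] --> (1 : R).
Proof.
have cs := even_moment_sum_asymp rho_gt0 (even_moment0 rho_gt0) (even_momentS rho_gt0).
apply: (@cvg_near_eq _ _ _ _ (fun T => (lambda_max (B T) / \tr (B T)) *
  ((\sum_(i < T.+1) even_moment rho i) / even_moment rho T) *
  ((T.*2)`!%:R / (2 ^+ T * T`!%:R) / (Num.sqrt 2 * (2 * T%:R / expR 1) ^+ T)))); last first.
  rewrite -[X in _ --> X]mulr1; apply: cvgM; last exact: double_fact_asymp.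
  by rewrite -[X in _ --> X]mulr1; apply: cvgM => //; exact: lambda_max_trace.
near=> T; have T0 : (0 < T)%N by near: T; exact: nbhs_infty_gt.
have m0 : 0 < even_moment rho T.
  exact: (even_moment_gt0 rho_gt0 (even_moment0 rho_gt0) (even_momentS rho_gt0)).
have /andP[h1 h2] := lambda_max_bounds rho_gt0 T.
have tr0 : 0 < \tr (B T) := lt_le_trans m0 (le_trans h1 h2).
rewrite -tr_hankelB mulrA divfK ?lt0r_neq0// -mulrA; congr (_ * _).
rewrite (even_momentE rho_gt0 (even_moment0 rho_gt0) (even_momentS rho_gt0)).
have -> : 2 * rho ^+ 2 * T%:R / expR 1 = rho ^+ 2 * (2 * T%:R / expR 1) by ring.
rewrite (exprMn T (rho ^+ 2)) -(exprM rho) mul2n.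
have f1 : 0 < (T.*2)`!%:R / (2 ^+ T * T`!%:R) :> R.
  by rewrite divr_gt0 ?mulr_gt0 ?exprn_gt0// ltr0n fact_gt0.
have f2 : 0 < Num.sqrt 2 :> R by rewrite sqrtr_gt0.
have f3 : 0 < (2 * T%:R / expR 1) ^+ T :> R.
  by rewrite exprn_gt0// divr_gt0 ?expR_gt0// mulr_gt0// ltr0n.
have f4 : 0 < rho ^+ T.*2 by rewrite exprn_gt0.
move: (_ / (2 ^+ T * _)) (Num.sqrt 2) ((2 * _ / _) ^+ T) (rho ^+ T.*2) f1 f2 f3 f4.
by move=> a b c d a0 b0 c0 d0; field; rewrite !lt0r_neq0.
Unshelve. all: by end_near. Qed.

End LambdaMin.

Theorem mainTheorem4 (R : realType) (rho : R) (hrho : 0 < rho) :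
  [/\ ((lambda_max (hankelB rho T) /
         \sum_(i < T.+1) eigval (hankelB rho T) i) @[T --> \oo] --> (1 : R)),
      ((lambda_max (hankelB rho T) /
         (Num.sqrt 2 * (2 * rho ^+ 2 * T%:R / expR 1) ^+ T)) @[T --> \oo] --> (1 : R))
    & ((lambda_min (hankelB rho T) /
         (2 `^ (5 / 2) * pi * T%:R `^ (1 / 4) / rho `^ (3 / 2)
          * expR ((2 * rho ^+ 2)^-1 - 2 * Num.sqrt T%:R / rho)))
         @[T --> \oo] --> (1 : R))].
Proof.
split.
- under eq_fun do rewrite (sum_eigval (hankelB_sym _ _)).
  exact: lambda_max_trace.
- exact: lambda_max_asymp.
- exact: lambda_min_asymp.
Qed.
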